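(* Let $0<a<\pi$ and $\alpha>0$ with $a(1+\alpha)>\pi\alpha$, and let $\rho(x)=1$ for $0\le x\le a$, $\rho(x)=\alpha^2$ for $a<x\le\pi$. Let $q,\tilde q\in L_2(0,\pi)$ be real-valued, and let $L$ and $\tilde L$ be the boundary value problems $$-y''+q(x)y=\lambda^2\rho(x)y,\quad y'(0)=y(\pi)=0,\qquad\text{and}\qquad -y''+\tilde q(x)y=\lambda^2\rho(x)y,\quad y'(0)=y(\pi)=0,$$ on $[0,\pi]$. For $L$ let $\varphi(x,\lambda)$ be the solution of the equation with $\varphi(0,\lambda)=1$, $\varphi'(0,\lambda)=0$, let $\lambda_n^2$ ($\lambda_n\ge0$) be the eigenvalues (the $\lambda_n$ being the roots of $\varphi(\pi,\lambda)=0$) and $\alpha_n=\int_0^\pi\rho(x)\varphi^2(x,\lambda_n)\,dx$ the norming constants; let $\tilde\lambda_n$, $\tilde\alpha_n$ be defined analogously for $\tilde L$. If $\lambda_n=\tilde\lambda_n$ and $\alpha_n=\tilde\alpha_n$ for all $n\ge1$, then $q(x)=\tilde q(x)$ for (almost every) $x\in[0,\pi]$. *)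

(* Defs.v *)
From HB Require Import structures.
From mathcomp Require Import all_boot all_order all_algebra.
From mathcomp Require Import all_classical all_reals all_analysis.
Set Implicit Arguments. Unset Strict Implicit. Unset Printing Implicit Defensive.
Import Order.TTheory GRing.Theory Num.Theory.
Import numFieldNormedType.Exports.
Local Open Scope classical_set_scope.
Local Open Scope ring_scope.

Definition rho (R : realType) (a al : R) (x : R) : R :=
  if x <= a then 1 else al ^+ 2.

Definition L2_on (R : realType) (q : R -> R) : Prop :=
  measurable_fun `[0, pi] q /\
  (@lebesgue_measure R).-integrable `[0, pi] (fun x => (q x ^+ 2)%:E).

(* y solves -y'' + q y = mu rho y on [0,pi] (mu = lambda^2) with
   y(0)=1, y'(0)=0, in the Caratheodory sense: y1 = y' and y1 is
   absolutely continuous with y1' = (q - mu rho) y a.e. *)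
Definition ivp_solution (R : realType) (a al : R) (q : R -> R) (mu : R)
  (y : R -> R) : Prop :=
  exists y1 : R -> R,
  [/\ y 0 = 1 /\ y1 0 = 0,
      ((@lebesgue_measure R).-integrable `[0, pi] (fun t => (y1 t)%:E)),
      ((@lebesgue_measure R).-integrable `[0, pi]
         (fun t => ((q t - mu * rho a al t) * y t)%:E)),
      (forall x, 0 <= x <= pi ->
         y x = y 0 + Rintegral (@lebesgue_measure R) `[0, x] y1) &
      (forall x, 0 <= x <= pi ->
         y1 x = y1 0 + Rintegral (@lebesgue_measure R) `[0, x]
                          (fun t => (q t - mu * rho a al t) * y t))].

Definition norming (R : realType) (a al : R) (y : R -> R) : R :=
  Rintegral (@lebesgue_measure R) `[0, pi] (fun x => rho a al x * y x ^+ 2).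

(* Main.v *)
Require Import Defs.
From HB Require Import structures.
From mathcomp Require Import all_boot all_order all_algebra.
From mathcomp Require Import all_classical all_reals all_analysis.
From mathcomp Require Import measurable_realfun ring lra.
Set Implicit Arguments.
Unset Strict Implicit.
Unset Printing Implicit Defensive.
Import Order.TTheory GRing.Theory Num.Theory.
Import numFieldNormedType.Exports.
Local Open Scope classical_set_scope.
Local Open Scope ring_scope.

(* Everything is done with real spectral parameters z = lambda^2.  For z off the
   spectrum let g_z be the solution with g_z(pi) = 0, g_z'(0) = -1 and put
   M(z) = g_z(0), so that (M(z) - M(w)) / (z - w) = <g_z, g_w> in L^2(rho).

   1. The spectral data determine M.  If f is orthogonal to the eigenfunctions
   with eigenvalue below X, the resolvent U_z of f extends over the whole
   half-line z < X, and h(z) = <U_z, f> satisfies h' = |U_z|^2, hence the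
   Riccati inequality h^2 <= |f|^2 h'; absence of blow-up forces
   0 <= h(z) <= |f|^2 / (X - z).  For f = g_w minus its projection on those
   eigenfunctions, h is an explicit expression in M and the spectral data, so
   letting X grow shows that the difference of the two functions M is affine;
   it tends to 0 at -oo, so it vanishes.

   2. M determines q.  Let b be maximal with q = qt on [0, b], p = qt - q.  The
   Wronskian of g_z and gt_z vanishes at b, so for z = -kappa^2 the integral of
   p g_z gt_z over [b, e] is exponentially small.  Writing
   g_z = g_z(b) exp (- k (x - b)) m_k, the functions m_k satisfy a Volterra
   equation which shows that, up to exponentially small errors, replacing
   exp (- 2 k (x - b)) by exp (- 2 k (x - b)) m_k mt_k in a Dirichlet polynomial
   P = sum_j c_j exp (- 2 k_j v) changes its value at v = x - b by at most a
   constant times the integral of |P| over [v, e - b].  With Dirichlet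
   polynomials approximating indicator functions of intervals this bounds
   |p| a.e. near b by a constant times its own integral, so p = 0 there. *)

(** * Integrals over intervals *)

(** For real z the main tool is the quadratic form: the energy of a solution over [a, T] is a
    boundary term, and a coercivity constant that does not depend on z yields the lower bound of the
    spectrum, the decay of M at -oo and the size of the Weyl solutions.

    The obstacle in part 2 is that Dirichlet polynomials close to an indicator function have
    enormous coefficients: the cutoff (1 - exp (- 2 N v)) ^ M, with M about N exp (2 N t), has
    coefficients of order up to M ^ j at exp (- 2 j N v). Errors must be measured by the polynomial
    itself, hence the integral of |P|; only errors of size exp (- 2 k (e - b)), up to powers of k,
    may meet the coefficients, and they win because t < e - b. This is why polynomial bounds in k on
    the m_k suffice.

    The jump of the density is absorbed by the choice of e: to the right of any b the density is a
    constant c ^ 2 on a short interval, where z = - (k / c) ^ 2 turns the equation into u'' = (q + k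
    ^ 2) u. *)

Section interval_integral.
Context {R : realType}.
Notation mu := (@lebesgue_measure R).
Implicit Types (a b c x y : R) (f g h : R -> R).

(** Half-open intervals turn additivity over adjacent intervals into a disjoint union, and
    [int a b f] is 0 when b <= a. The bounded measurable functions [bm] serve as multipliers of
    integrable ones. *)
Definition ig a b f := mu.-integrable `]a, b] (EFin \o f).
Definition int a b f := Rintegral mu `]a, b] f.
Definition bm a b f := measurable_fun `]a, b] f /\
  exists M : R, forall x, a < x <= b -> `|f x| <= M.

Lemma igS a b c d f : a <= c -> d <= b -> ig a b f -> ig c d f.
Proof.
move=> ac db; apply: integrableS => //.
by apply: subset_itv; rewrite bnd_simp.
Qed.

Lemma eq_ig a b f g : (forall x, a < x <= b -> f x = g x) -> ig a b f -> ig a b g.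
Proof.
move=> fg; apply: eq_integrable => // x; rewrite inE/= in_itv/= => xab.
by rewrite fg.
Qed.

Lemma eq_int a b f g : (forall x, a < x <= b -> f x = g x) -> int a b f = int a b g.
Proof.
by move=> fg; apply: eq_Rintegral => x; rewrite inE/= in_itv/= => xab; exact: fg.
Qed.

Lemma igD a b f g : ig a b f -> ig a b g -> ig a b (fun x => f x + g x).
Proof.
move=> fi gi; rewrite /ig (_ : _ \o _ = (EFin \o f) \+ (EFin \o g))%E.
  exact: integrableD.
by apply/funext => x /=; rewrite EFinD.
Qed.

Lemma igZ a b k f : ig a b f -> ig a b (fun x => k * f x).
Proof.
move=> fi; rewrite /ig (_ : _ \o _ = (fun x => k%:E * (EFin \o f) x)%E).
  exact: integrableZl.
by apply/funext => x /=; rewrite EFinM.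
Qed.

Lemma igN a b f : ig a b f -> ig a b (fun x => - f x).
Proof. by move=> /(igZ (-1)); apply: eq_ig => x _; rewrite mulN1r. Qed.

Lemma igB a b f g : ig a b f -> ig a b g -> ig a b (fun x => f x - g x).
Proof. by move=> fi /igN gi; exact: igD. Qed.

Lemma ig_norm a b f : ig a b f -> ig a b (fun x => `|f x|).
Proof. by move=> /integrable_norm. Qed.

Lemma ig_meas a b f : ig a b f -> measurable_fun `]a, b] f.
Proof. by move=> /measurable_int /measurable_EFinP. Qed.

Lemma bmP a b f : bm a b f -> [bounded f x | x in `]a, b]].
Proof.
move=> [_ [M fM]]; exists M; split; first exact: num_real.
move=> N MN x /=; rewrite in_itv/= => /fM/le_trans; apply; exact: ltW.
Qed.

Lemma bm_igM a b f g : bm a b f -> ig a b g -> ig a b (fun x => f x * g x).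
Proof.
move=> bf gi; rewrite /ig (_ : _ \o _ = (EFin \o f) \* (EFin \o g))%E.
  by apply: integrableMr => //; [exact: bf.1|exact: bmP].
by apply/funext => x /=; rewrite EFinM.
Qed.

Lemma ig_bmM a b f g : ig a b f -> bm a b g -> ig a b (fun x => f x * g x).
Proof. by move=> fi gb; apply: eq_ig (bm_igM gb fi) => x _; rewrite mulrC. Qed.

Lemma bm_ig a b f : bm a b f -> ig a b f.
Proof.
move=> bf; apply: measurable_bounded_integrable => //; last 2 first.
- exact: bf.1.
- exact: bmP.
rewrite /= lebesgue_measure_itv/=; case: ifP => // _.
by rewrite -EFinB ltry.
Qed.

Lemma bm_cst a b k : bm a b (fun=> k).
Proof. by split; [exact: measurable_cst|exists `|k|]. Qed.

Lemma bmD a b f g : bm a b f -> bm a b g -> bm a b (fun x => f x + g x).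
Proof.
move=> [mf [M fM]] [mg [N gN]]; split; first exact: measurable_funD.
exists (M + N) => x xab; apply: le_trans (ler_normD _ _) _.
by apply: lerD; [exact: fM|exact: gN].
Qed.

Lemma bmM a b f g : bm a b f -> bm a b g -> bm a b (fun x => f x * g x).
Proof.
move=> [mf [M fM]] [mg [N gN]]; split; first exact: measurable_funM.
exists (M * N) => x xab; rewrite normrM.
by apply: ler_pM => //; [exact: fM|exact: gN].
Qed.

Lemma eq_bm a b f g : (forall x, a < x <= b -> f x = g x) -> bm a b f -> bm a b g.
Proof.
move=> fg [mf [M fM]]; split.
  by apply: eq_measurable_fun mf => x; rewrite inE/= in_itv/= => /fg.
by exists M => x xab; rewrite -fg//; exact: fM.
Qed.

Lemma bmZ a b k f : bm a b f -> bm a b (fun x => k * f x).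
Proof. by apply: bmM; exact: bm_cst. Qed.

Lemma bmN a b f : bm a b f -> bm a b (fun x => - f x).
Proof. by move=> /(bmZ (-1)); apply: eq_bm => x _; rewrite mulN1r. Qed.

Lemma bmB a b f g : bm a b f -> bm a b g -> bm a b (fun x => f x - g x).
Proof. by move=> fb /bmN gb; exact: bmD. Qed.

Lemma bmS a b c d f : a <= c -> d <= b -> bm a b f -> bm c d f.
Proof.
move=> ac db [mf [M fM]]; split.
  by apply: measurable_funS mf => //; apply: subset_itv; rewrite bnd_simp.
exists M => x /andP[cx xd]; apply: fM.
by rewrite (le_lt_trans ac cx) (le_trans xd db).
Qed.

Lemma bm_sum a b (I : Type) (s : seq I) (F : I -> R -> R) :
  (forall i, bm a b (F i)) -> bm a b (fun x => \sum_(i <- s) F i x).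
Proof.
move=> Fb; elim: s => [|i s ih].
  by apply: eq_bm (bm_cst a b 0) => x _; rewrite big_nil.
by apply: eq_bm (bmD (Fb i) ih) => x _; rewrite big_cons.
Qed.

Lemma bm_norm a b f : bm a b f -> bm a b (fun x => `|f x|).
Proof.
move=> [mf [M fM]]; split; first exact: measurableT_comp.
by exists M => x xab; rewrite normr_id fM.
Qed.

Lemma intD a b f g : ig a b f -> ig a b g ->
  int a b (fun x => f x + g x) = int a b f + int a b g.
Proof. by move=> fi gi; rewrite /int RintegralD. Qed.

Lemma intB a b f g : ig a b f -> ig a b g ->
  int a b (fun x => f x - g x) = int a b f - int a b g.
Proof. by move=> fi gi; rewrite /int RintegralB. Qed.

Lemma intZ a b k f : ig a b f -> int a b (fun x => k * f x) = k * int a b f.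
Proof. by move=> fi; rewrite /int RintegralZl. Qed.

Lemma int0 a b : int a b (fun=> 0) = 0.
Proof. by rewrite /int Rintegral_cst// mul0r. Qed.

Lemma int_sum a b (I : Type) (s : seq I) (F : I -> R -> R) :
  (forall i, ig a b (F i)) ->
  ig a b (fun x => \sum_(i <- s) F i x) /\
  int a b (fun x => \sum_(i <- s) F i x) = \sum_(i <- s) int a b (F i).
Proof.
move=> Fi; elim: s => [|i s [ih1 ih2]].
  split; first by apply: eq_ig (bm_ig (bm_cst a b 0)) => x _; rewrite big_nil.
  by rewrite big_nil; apply: etrans (int0 a b); apply: eq_int => x _; rewrite big_nil.
split; first by apply: eq_ig (igD (Fi i) ih1) => x _; rewrite big_cons.
by rewrite big_cons -ih2 -intD//; apply: eq_int => x _; rewrite big_cons.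
Qed.

Lemma int_ge0 a b f : (forall x, a < x <= b -> 0 <= f x) -> 0 <= int a b f.
Proof. by move=> f0; apply: Rintegral_ge0 => x /=; rewrite in_itv/=; exact: f0. Qed.

Lemma le_int a b f g : ig a b f -> ig a b g ->
  (forall x, a < x <= b -> f x <= g x) -> int a b f <= int a b g.
Proof.
by move=> fi gi fg; apply: le_Rintegral => // x /=.
Qed.

Lemma le_norm_int a b f : ig a b f -> `|int a b f| <= int a b (fun x => `|f x|).
Proof. by move=> fi; apply: le_normr_Rintegral. Qed.

Lemma int_cst a b k : a <= b -> int a b (fun=> k) = k * (b - a).
Proof.
move=> ab; rewrite /int Rintegral_cst//; congr (_ * _).
rewrite /= lebesgue_measure_itv/= lte_fin.
move: ab; rewrite le_eqVlt => /predU1P[->|ab].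
  by rewrite ltxx subrr.
by rewrite ab.
Qed.

Lemma int_chasles a b c f : a <= b <= c -> ig a c f ->
  int a c f = int a b f + int b c f.
Proof.
move=> /andP[ab bc] fi; rewrite /int -(@Rintegral_itvB _ f (BRight a) (BRight c) b)//.
by rewrite addrC subrK.
Qed.

Lemma int_nil a b f : b <= a -> int a b f = 0.
Proof.
move=> ba; rewrite /int set_itv_ge ?Rintegral_set0//.
by rewrite bnd_simp -leNgt.
Qed.

Lemma norm_int_le a b f (M : R) : a <= b -> ig a b f ->
  (forall x, a < x <= b -> `|f x| <= M) -> `|int a b f| <= M * (b - a).
Proof.
move=> ab fi fM; apply: le_trans (le_norm_int fi) _; rewrite -int_cst//.
by apply: le_int => //; [exact: ig_norm|exact: bm_ig (bm_cst _ _ _)].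
Qed.

Lemma norm_int_le_int a b f g : ig a b f -> ig a b g ->
  (forall x, a < x <= b -> `|f x| <= g x) -> `|int a b f| <= int a b g.
Proof.
move=> fi gi fM; apply: le_trans (le_norm_int fi) _.
by apply: le_int => //; exact: ig_norm.
Qed.

Lemma ig_cc a b f : mu.-integrable `[a, b] (EFin \o f) <-> ig a b f.
Proof.
split.
  by apply: integrableS => //; exact: subset_itv_oc_cc.
have [ab|ba] := leP a b; last first.
  by move=> _; rewrite set_itv_ge ?bnd_simp -?ltNge//; exact: integrable_set0.
move=> /integrableP[mf fi]; apply/integrableP; split.
  by apply/emeasurable_fun_itv_obnd_cbndP.
rewrite -integral_itv_obnd_cbnd//.
by apply: measurableT_comp.
Qed.

Lemma int_cc a b f : ig a b f -> Rintegral mu `[a, b] f = int a b f.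
Proof. by move=> fi; rewrite /int Rintegral_itv_obnd_cbnd. Qed.

Lemma ig_le a b f g : measurable_fun `]a, b] f -> ig a b g ->
  (forall x, a < x <= b -> `|f x| <= g x) -> ig a b f.
Proof.
move=> mf gi fg; apply: le_integrable gi => //.
- exact/measurable_EFinP.
- move=> x /=; rewrite in_itv/= => /fg h; rewrite lee_fin.
  by apply: le_trans h (ler_norm _).
Qed.

Lemma continuous_bm a b f : {within `[a, b], continuous f} -> bm a b f.
Proof.
move=> cf; split.
  have : measurable_fun `[a, b] f by exact: subspace_continuous_measurable_fun.
  by apply: measurable_funS => //; exact: subset_itv_oc_cc.
have /compact_bounded [M [_ HM]] : compact (f @` `[a, b]).
  by apply: continuous_compact => //; exact: segment_compact.
exists (M + 1) => x /andP[ax xb]; apply: (HM (M + 1)); first by rewrite ltrDl.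
by exists x => //=; rewrite in_itv/= (ltW ax).
Qed.

Lemma int_continuous a b f : a <= b -> ig a b f ->
  {within `[a, b], continuous (fun x => int a x f)}.
Proof.
move=> ab fi; have /ig_cc fi' := fi.
have := parameterized_integral_continuous ab fi'.
apply: subspace_eq_continuous => x; rewrite inE/= in_itv/= => /andP[ax xb].
by rewrite /from_subspace /parameterized_integral int_cc//; exact: igS fi.
Qed.

End interval_integral.

(** * Primitives of integrable functions *)

Ltac bm_tac := repeat first
  [ assumption | exact: bm_cst | apply: bmD | apply: bmB | apply: bmN
  | apply: bmM | apply: bm_norm ].
Ltac ig_tac := repeat first
  [ assumption | apply: igD | apply: igB | apply: igN | apply: ig_norm
  | by apply: bm_ig; bm_tac
  | by apply: bm_igM; [solve [bm_tac]|]; ig_tac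
  | by apply: ig_bmM; [|solve [bm_tac]]; ig_tac ].

Section absolutely_continuous_pairs.
Context {R : realType}.
Implicit Types (a b c x y : R) (f g F G : R -> R).

(** The map K -> K / 2 + C contracts to its fixed point 2 C, so an a priori bound N of any size is
    traded for one that does not depend on N. *)
Lemma halving_bound (P : R -> Prop) (C N : R) : 0 <= N ->
  P N -> (forall K, 0 <= K -> P K -> P (K / 2 + C)) -> 0 <= C ->
  forall e, 0 < e -> exists2 K, 0 <= K <= 2 * C + e & P K.
Proof.
move=> N0 PN step C0 e e0.
have H n : exists2 K, 0 <= K <= 2 * C + N / 2 ^+ n & P K.
  elim: n => [|n [K /andP[K0 KN] PK]].
    by exists N => //; rewrite N0/= expr0 divr1 lerDr; lra.
  exists (K / 2 + C); last exact: step.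
  rewrite exprS invfM mulrA mulrAC; apply/andP; split; lra.
have [n Hn] : exists n, N / 2 ^+ n <= e.
  have [->|Nn0] := eqVneq N 0; first by exists 0%N; rewrite mul0r ltW.
  have Np : 0 < N by rewrite lt_neqAle eq_sym Nn0.
  have [n] : exists n, N / e <= n%:R.
    by exists (Num.truncn (N / e)).+1; apply/ltW/truncnS_gt.
  move=> Hn; exists n; rewrite ler_pdivrMr ?exprn_gt0// mulrC -ler_pdivrMr//.
  by apply: le_trans Hn _; rewrite -natrX ler_nat ltnW// ltn_expl.
have [K /andP[K0 KN] PK] := H n.
by exists K => //; rewrite K0/=; lra.
Qed.

(** The density f is part of the data: F is handled as a primitive of f, so solutions in the
    Caratheodory sense are manipulated without differentiating anything almost everywhere. *)
Definition AC a b F f := ig a b f /\ forall x, a <= x <= b -> F x = F a + int a x f.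

Lemma AC_int a b f : ig a b f -> AC a b (fun x => int a x f) f.
Proof. by move=> fi; split => // x /andP[ax xb]; rewrite (int_nil _ (lexx a)) add0r. Qed.

Lemma AC_diff a b F f x y : AC a b F f -> a <= x -> x <= y -> y <= b ->
  F y - F x = int x y f.
Proof.
move=> [fi FE] ax xy yb; rewrite (FE x) ?(FE y) ?ax ?yb ?(le_trans ax xy) ?(le_trans xy yb)//.
rewrite (@int_chasles _ a x y) ?ax//; last exact: igS fi.
by rewrite addrA [X in X - _]addrC addrK.
Qed.

Lemma AC_sub a b c d F f : a <= c -> d <= b -> AC a b F f -> AC c d F f.
Proof.
move=> ac db FAC; split; first exact: igS FAC.1.
move=> x /andP[cx xd].
by rewrite -(AC_diff FAC ac cx (le_trans xd db)) addrC subrK.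
Qed.

Lemma AC_ig a b F f : AC a b F f -> ig a b f. Proof. by case. Qed.

Lemma AC_continuous a b F f : a <= b -> AC a b F f -> {within `[a, b], continuous F}.
Proof.
move=> ab [fi FE].
have : {within `[a, b], continuous (fun x => cst (F a) x + int a x f)}.
  move=> x; apply: cvgD; first exact: cvg_cst.
  exact: (int_continuous ab fi).
apply: subspace_eq_continuous => x; rewrite inE/= in_itv/= => xab.
by rewrite /from_subspace [RHS]FE.
Qed.

Lemma AC_bm a b F f : a <= b -> AC a b F f -> bm a b F.
Proof. by move=> ab /(AC_continuous ab); exact: continuous_bm. Qed.

Lemma eq_AC a b F f G g : (forall x, a <= x <= b -> F x = G x) ->
  (forall x, a < x <= b -> f x = g x) -> AC a b F f -> AC a b G g.
Proof.
move=> FG fg [fi FE]; split; first exact: eq_ig fi.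
move=> x /andP[ax xb]; rewrite -!FG ?lexx ?ax ?(le_trans ax xb)// FE ?ax//.
congr (_ + _); apply: eq_int => y /andP[ay yx].
by rewrite fg// ay (le_trans yx xb).
Qed.

Lemma AC_cst a b k : AC a b (fun=> k) (fun=> 0).
Proof.
split; first exact: bm_ig (bm_cst _ _ _).
by move=> x _; rewrite int0 addr0.
Qed.

Lemma ACD a b F f G g : AC a b F f -> AC a b G g ->
  AC a b (fun x => F x + G x) (fun x => f x + g x).
Proof.
move=> [fi FE] [gi GE]; split; first exact: igD.
move=> x /[dup] /andP[ax xb] xab; rewrite (FE x)// (GE x)// intD; first by ring.
- exact: igS fi.
- exact: igS gi.
Qed.

Lemma ACZ a b k F f : AC a b F f -> AC a b (fun x => k * F x) (fun x => k * f x).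
Proof.
move=> [fi FE]; split; first exact: igZ.
move=> x /[dup] /andP[ax xb] xab; rewrite (FE x)// intZ; first by ring.
exact: igS fi.
Qed.

Lemma ACN a b F f : AC a b F f -> AC a b (fun x => - F x) (fun x => - f x).
Proof. by move=> /(ACZ (-1)); apply: eq_AC => x _; rewrite mulN1r. Qed.

Lemma ACB a b F f G g : AC a b F f -> AC a b G g ->
  AC a b (fun x => F x - G x) (fun x => f x - g x).
Proof. by move=> Ff /ACN Gg; exact: ACD. Qed.

(* Cutting [a, b] into n pieces of equal [Z]-variation bounds the total
   variation of [H] by 2 (Z b - Z a)^2 / n. *)
Lemma quadratic_variation_const a b (H Z : R -> R) : a <= b ->
  {within `[a, b], continuous Z} ->
  (forall x y, a <= x -> x <= y -> y <= b -> Z x <= Z y) ->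
  (forall x y, a <= x -> x <= y -> y <= b -> `|H y - H x| <= 2 * (Z y - Z x) ^+ 2) ->
  H b = H a.
Proof.
move=> ab cZ mZ HZ.
have step (e : R) (n : nat) x : 0 <= e -> a <= x <= b -> Z x - Z a <= n%:R * e ->
    `|H x - H a| <= n%:R * (2 * e ^+ 2).
  move=> e0; elim: n x => [|n ih] x /andP[ax xb].
    rewrite !mul0r => h; apply: le_trans (HZ _ _ (lexx a) ax xb) _.
    have : Z x - Z a = 0 by apply/eqP; rewrite eq_le h subr_ge0 mZ.
    by move=> ->; rewrite expr0n/= mulr0.
  move=> h; have [h1|h1] := leP (Z x - Z a) (n%:R * e).
    apply: le_trans (ih x _ h1) _; first by rewrite ax xb.
    rewrite ler_wpM2r ?mulr_ge0 ?sqr_ge0 ?ler_nat//; lra.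
  have cZx : {within `[a, x], continuous Z}.
    by apply: continuous_subspaceW cZ; apply: subset_itvl; rewrite bnd_simp.
  have : Num.min (Z a) (Z x) <= Z a + n%:R * e <= Num.max (Z a) (Z x).
    rewrite min_l ?max_r ?mZ//.
    have : 0 <= n%:R * e by rewrite mulr_ge0.
    by move=> ?; apply/andP; split; lra.
  move=> /(IVT ax cZx)[c]; rewrite in_itv/= => /andP[ac cx] Zc.
  have h2 : `|H c - H a| <= n%:R * (2 * e ^+ 2).
    by apply: ih; rewrite ?ac ?(le_trans cx xb)//; lra.
  have h3 : `|H x - H c| <= 2 * e ^+ 2.
    apply: le_trans (HZ _ _ ac cx xb) _; rewrite ler_wpM2l// ler_sqr ?nnegrE.
    - by rewrite Zc; rewrite -natr1 mulrDl mul1r in h; lra.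
    - by rewrite subr_ge0 mZ.
    - by [].
  rewrite -natr1 mulrDl mul1r -(subrK (H c) (H x)) -addrA.
  apply: le_trans (ler_normD _ _) _; rewrite [leRHS]addrC; exact: lerD.
apply/eqP; rewrite -subr_eq0 -normr_eq0 eq_le normr_ge0 andbT.
have [V0|V0] := eqVneq (Z b - Z a) 0.
  by have := HZ _ _ (lexx a) ab (lexx b); rewrite V0 expr0n/= mulr0.
set V := Z b - Z a in V0; have V1 : 0 < V by rewrite lt_neqAle eq_sym V0 subr_ge0 mZ.
apply/ler_addgt0Pr => e e0; rewrite add0r.
pose n := (Num.truncn (2 * V ^+ 2 / e)).+1.
have Hn : 2 * V ^+ 2 / e <= n%:R by apply/ltW/truncnS_gt.
have n0 : 0 < n%:R :> R by rewrite ltr0n.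
apply: le_trans (step (V / n%:R) n b _ _ _) _.
- by rewrite divr_ge0// ltW.
- by rewrite ab lexx.
- by rewrite mulrCA divff ?mulr1// gt_eqF.
- have -> : n%:R * (2 * (V / n%:R) ^+ 2) = 2 * V ^+ 2 / n%:R.
    by field; rewrite gt_eqF.
  by rewrite ler_pdivrMr// [e * _]mulrC -ler_pdivrMr.
Qed.

(** Let H be F G minus the integral of f G + F g. Its increment over [u, v] is the integral of f(t)
    (G v - G t) - (F t - F u) g(t), which is quadratic in the integral of |f| + |g| over [u, v]. A
    function with such increments is constant. *)
Lemma ACM a b F f G g : a <= b -> AC a b F f -> AC a b G g ->
  AC a b (fun x => F x * G x) (fun x => f x * G x + F x * g x).
Proof.
move=> ab Ff Gg; have Fb := AC_bm ab Ff; have Gb := AC_bm ab Gg.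
have [fi gi] := (AC_ig Ff, AC_ig Gg).
have fGi : ig a b (fun x => f x * G x + F x * g x) by ig_tac.
split=> // x /andP[ax xb].
pose H x := F x * G x - int a x (fun x => f x * G x + F x * g x).
suff : H x = H a.
  by rewrite /H (int_nil _ (lexx a)) subr0 => <-; rewrite subrK.
pose Z x := int a x (fun x => `|f x| + `|g x|).
have Zi : ig a b (fun x => `|f x| + `|g x|) by ig_tac.
have ZE u v : a <= u -> u <= v -> v <= x -> Z v - Z u = int u v (fun x => `|f x| + `|g x|).
  by move=> au uv vx; apply: (AC_diff (AC_int Zi) au uv (le_trans vx xb)).
apply: (@quadratic_variation_const a x H Z) => //.
- by apply: int_continuous => //; exact: igS Zi.
- move=> u v au uv vx; rewrite -subr_ge0 ZE//; apply: int_ge0 => t _.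
  by rewrite addr_ge0.
- move=> u v au uv vx.
  have vb := le_trans vx xb.
  have -> : H v - H u = int u v (fun t => f t * (G v - G t) - (F t - F u) * g t).
    have HE : int a v (fun x => f x * G x + F x * g x) - int a u (fun x => f x * G x + F x * g x)
        = int u v (fun x => f x * G x + F x * g x).
      exact: (AC_diff (AC_int fGi) au uv vb).
    rewrite /H.
    transitivity (F v * G v - F u * G u - int u v (fun x => f x * G x + F x * g x)).
      by rewrite -HE; ring.
    have fi' : ig u v f by exact: igS fi.
    have gi' : ig u v g by exact: igS gi.
    have Fb' : bm u v F by exact: bmS Fb.
    have Gb' : bm u v G by exact: bmS Gb.
    transitivity (G v * int u v f + F u * int u v g - int u v (fun x => f x * G x + F x * g x)).
      by rewrite -(AC_diff Ff au uv vb) -(AC_diff Gg au uv vb); ring.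
    rewrite -!intZ// -intD; [|ig_tac..].
    rewrite -intB; [|ig_tac..].
    by apply: eq_int => t _; ring.
  have fi' : ig u v f by exact: igS fi.
  have gi' : ig u v g by exact: igS gi.
  have Fb' : bm u v F by exact: bmS Fb.
  have Gb' : bm u v G by exact: bmS Gb.
  have nf := ig_norm fi'; have ng := ig_norm gi'.
  apply: (@le_trans _ _ (int u v (fun t => (Z v - Z u) * `|f t| + (Z v - Z u) * `|g t|))).
    apply: norm_int_le_int; [ig_tac..|].
    move=> t /andP[ut tv].
    have fsub p r : u <= p -> p <= r -> r <= v -> `|F r - F p| <= Z v - Z u.
      move=> up pr rv.
      rewrite (AC_diff Ff (le_trans au up) pr (le_trans rv vb)).
      have fi'' : ig p r f by apply: igS fi'.
      apply: le_trans (le_norm_int fi'') _; rewrite ZE//.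
      have ni : ig u v (fun x => `|f x| + `|g x|) by ig_tac.
      rewrite (@int_chasles _ u p v) ?up ?(le_trans pr rv)//.
      rewrite (@int_chasles _ p r v) ?rv ?pr//; last exact: igS ni.
      have ? : 0 <= int u p (fun x => `|f x| + `|g x|) by apply: int_ge0 => *; rewrite addr_ge0.
      have ? : 0 <= int r v (fun x => `|f x| + `|g x|) by apply: int_ge0 => *; rewrite addr_ge0.
      have ? : int p r (fun x => `|f x|) <= int p r (fun x => `|f x| + `|g x|).
        apply: le_int; [exact: ig_norm|exact: igS ni|].
        by move=> z _; rewrite lerDl.
      by lra.
    have gsub p r : u <= p -> p <= r -> r <= v -> `|G r - G p| <= Z v - Z u.
      move=> up pr rv.
      rewrite (AC_diff Gg (le_trans au up) pr (le_trans rv vb)).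
      have gi'' : ig p r g by apply: igS gi'.
      apply: le_trans (le_norm_int gi'') _; rewrite ZE//.
      have ni : ig u v (fun x => `|f x| + `|g x|) by ig_tac.
      rewrite (@int_chasles _ u p v) ?up ?(le_trans pr rv)//.
      rewrite (@int_chasles _ p r v) ?rv ?pr//; last exact: igS ni.
      have ? : 0 <= int u p (fun x => `|f x| + `|g x|) by apply: int_ge0 => *; rewrite addr_ge0.
      have ? : 0 <= int r v (fun x => `|f x| + `|g x|) by apply: int_ge0 => *; rewrite addr_ge0.
      have ? : int p r (fun x => `|g x|) <= int p r (fun x => `|f x| + `|g x|).
        apply: le_int; [exact: ig_norm|exact: igS ni|].
        by move=> z _; rewrite lerDr.
      by lra.
    apply: le_trans (ler_normB _ _) _; rewrite !normrM; apply: lerD.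
      by rewrite mulrC ler_wpM2r// gsub// ltW.
    by rewrite ler_wpM2r// fsub// ltW.
  rewrite intD; [|ig_tac..]; rewrite !intZ// -mulrDr -intD//.
  rewrite -ZE// -expr2; have := sqr_ge0 (Z v - Z u); lra.
Qed.

Lemma AC_derive a b F f : a <= b -> (forall x : R, is_derive x 1 F (f x)) ->
  continuous f -> AC a b F f.
Proof.
move=> ab dF cf.
have fi x y : ig x y f.
  apply: bm_ig; apply: continuous_bm; exact: continuous_subspaceT.
split=> // x /andP[ax xb].
move: ax; rewrite le_eqVlt => /predU1P[->|ax]; first by rewrite int_nil// addr0.
rewrite -int_cc// /Rintegral (@continuous_FTC2 _ f F)//.
- by rewrite -EFinB/= addrC subrK.
- exact: continuous_subspaceT.
- split.
  + by move=> y _.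
  + apply: cvg_at_right_filter; apply: differentiable_continuous.
    exact/derivable1_diffP.
  + apply: cvg_at_left_filter; apply: differentiable_continuous.
    exact/derivable1_diffP.
- by move=> y _; rewrite derive1E; apply: derive_val.
Qed.

End absolutely_continuous_pairs.

(** * Linear Volterra equations *)

Section volterra.
Context {R : realType}.
Implicit Types (a b c x y T k : R) (f g F G Q : R -> R).

Lemma AC_expR a b k c : a <= b ->
  AC a b (fun x => expR (k * x + c)) (fun x => k * expR (k * x + c)).
Proof.
move=> ab; apply: AC_derive => //.
  move=> x; have d1 : is_derive x 1 (fun x => k * x + c) k.
    by apply: is_derive_eq; rewrite addr0 /GRing.scale/= mulr1.
  have -> : (fun x => expR (k * x + c)) = expR \o (fun x => k * x + c) by [].
  by apply: is_derive_eq; rewrite mulrC.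
move=> x; apply: cvgM; first exact: cvg_cst.
apply: continuous_cvg; first exact: continuous_expR.
apply: cvgD; last exact: cvg_cst.
by apply: cvgM; [exact: cvg_cst|exact: cvg_id].
Qed.

Lemma expR_bm a b k c : a <= b -> bm a b (fun x => expR (k * x + c)).
Proof. by move=> ab; apply: AC_bm (AC_expR k c ab). Qed.

(** The intervals of centre u n and radius 2 C / 2 ^ n are nested, and the supremum of their left
    ends lies in all of them. This gives the limit of the Picard iterates together with an explicit
    rate. *)
Lemma geometric_increments_limit (u : nat -> R) (C : R) :
  (forall n, `|u n.+1 - u n| <= C / 2 ^+ n) ->
  exists l, forall n, `|l - u n| <= 2 * C / 2 ^+ n.
Proof.
move=> uC; have C0 : 0 <= C.
  by have := uC 0%N; rewrite expr0 divr1; apply: le_trans.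
pose d n : R := 2 * C / 2 ^+ n.
have dS n : d n = 2 * d n.+1 by rewrite /d exprS; field; rewrite expf_neq0.
have dC n : C / 2 ^+ n = d n.+1 by rewrite /d exprS; field; rewrite expf_neq0.
have d0 n : 0 <= d n by rewrite /d divr_ge0 ?mulr_ge0 ?exprn_ge0.
have dec m n : u n - d n <= u (n + m)%N - d (n + m)%N.
  elim: m => [|m ih]; first by rewrite addn0.
  apply: le_trans ih _; rewrite addnS.
  by have := uC (n + m)%N; rewrite dC ler_norml => /andP[]; have := dS (n + m)%N; lra.
have inc m n : u (n + m)%N + d (n + m)%N <= u n + d n.
  elim: m => [|m ih]; first by rewrite addn0.
  apply: le_trans ih; rewrite addnS.
  by have := uC (n + m)%N; rewrite dC ler_norml => /andP[]; have := dS (n + m)%N; lra.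
have cross m n : u n - d n <= u m + d m.
  have h1 := dec (maxn m n - n)%N n; have h2 := inc (maxn m n - m)%N m.
  rewrite subnKC ?leq_maxr// in h1; rewrite subnKC ?leq_maxl// in h2.
  by have := d0 (maxn m n); lra.
pose A := [set x | exists n, x = u n - d n].
have A0 : A !=set0 by exists (u 0%N - d 0%N), 0%N.
have Aub n : ubound A (u n + d n) by move=> x [m ->].
exists (sup A) => n.
have h1 : u n - d n <= sup A.
  by apply: ub_le_sup; [exists (u 0%N + d 0%N); exact: Aub|exists n].
have h2 : sup A <= u n + d n by apply: ge_sup.
by rewrite ler_norml -/(d n); apply/andP; split; lra.
Qed.

Lemma half_pow_small (C e : R) : 0 <= C -> 0 < e ->
  exists N, forall n, (N <= n)%N -> C / 2 ^+ n <= e.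
Proof.
move=> C0 e0; exists (Num.truncn (C / e)).+1 => n Nn.
rewrite ler_pdivrMr ?exprn_gt0// [e * _]mulrC -ler_pdivrMr//.
apply: (@le_trans _ _ n%:R); last by rewrite -natrX ler_nat ltnW// ltn_expl.
by apply: le_trans (ltW (truncnS_gt _)) _; rewrite ler_nat.
Qed.

Lemma half_pow_le0 (x C : R) : (forall n, x <= C / 2 ^+ n) -> x <= 0.
Proof.
move=> h; have [C0|C0] := leP 0 C; last first.
  by apply: le_trans (h 0%N) _; rewrite expr0 divr1 ltW.
apply/ler_addgt0Pr => e e0; rewrite add0r.
have [N HN] := half_pow_small C0 e0.
by apply: le_trans (h N) (HN N _).
Qed.

(** In the norm sup |u x| exp (- lam x) the Volterra operator, u mapped to the double integral of Q
    u, then has norm at most 1/2. *)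
Definition expweight T Q (lam : R) := forall x, 0 <= x <= T ->
  T * int 0 x (fun t => `|Q t| * expR (lam * t)) <= expR (lam * x) / 2.

(** With s = exp (lam (t - x)), the inequality |Q| s <= d Q ^ 2 + s ^ 2 / (4 d) separates Q from the
    weight, and the integral of s ^ 2 is at most 1 / (2 lam). The values of d and lam make each of
    the two contributions at most 1/4 after multiplication by T. Since lam depends on Q only through
    the bound K on its L^2 norm, one weight serves all spectral parameters in a bounded set. *)
Lemma expweight_exists T (K : R) : 0 < T -> 0 <= K -> exists2 lam : R, 0 < lam &
  forall Q, ig 0 T Q -> ig 0 T (fun x => Q x ^+ 2) ->
    int 0 T (fun x => Q x ^+ 2) <= K -> expweight T Q lam.
Proof.
move=> T0 K0; pose d := (4 * T * (K + 1))^-1.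
have d0 : 0 < d by rewrite invr_gt0 !mulr_gt0//; lra.
exists (T / (2 * d)); first by rewrite divr_gt0// mulr_gt0.
set lam := T / (2 * d) => Q Qi Q2i QK x /andP[x0 xT].
have lam0 : 0 < lam by rewrite divr_gt0// mulr_gt0.
have Q2i' : ig 0 x (fun t => Q t ^+ 2) by exact: igS Q2i.
have Qi' : ig 0 x Q by exact: igS Qi.
have Eb : bm 0 x (fun t => expR (2 * lam * t + - (2 * lam * x))) by exact: expR_bm.
have E1b : bm 0 x (fun t => expR (lam * t + 0)) by exact: expR_bm.
have E2b : bm 0 x (fun t => expR (lam * t)).
  by apply: eq_bm E1b => t _; rewrite addr0.
have le1 : int 0 x (fun t => `|Q t| * expR (lam * t)) <=
    int 0 x (fun t => expR (lam * x) * (d * Q t ^+ 2 + (4 * d)^-1 * expR (2 * lam * t + - (2 * lam * x)))).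
  apply: le_int.
  - by ig_tac.
  - by apply: igZ; apply: igD; [exact: igZ|apply: igZ; exact: bm_ig].
  move=> t _; set s := expR (lam * t - lam * x).
  have -> : expR (2 * lam * t + - (2 * lam * x)) = s ^+ 2.
    by rewrite expr2 -expRD; congr expR; ring.
  have -> : expR (lam * t) = expR (lam * x) * s by rewrite -expRD; congr expR; ring.
  rewrite mulrCA; apply: ler_wpM2l; first exact: expR_ge0.
  have -> : Q t ^+ 2 = `|Q t| ^+ 2 by rewrite real_normK ?num_real.
  rewrite -subr_ge0.
  have -> : d * `|Q t| ^+ 2 + (4 * d)^-1 * s ^+ 2 - `|Q t| * s
    = (2 * d * `|Q t| - s) ^+ 2 / (4 * d) by field; rewrite gt_eqF.
  by rewrite divr_ge0 ?sqr_ge0// mulr_ge0// ltW.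
have Q2x : int 0 x (fun t => Q t ^+ 2) <= K.
  apply: le_trans QK; rewrite (@int_chasles _ 0 x T) ?x0// lerDl.
  by apply: int_ge0 => t _; exact: sqr_ge0.
have Ex : int 0 x (fun t => expR (2 * lam * t + - (2 * lam * x))) <= (2 * lam)^-1.
  have H := AC_diff (AC_expR (2 * lam) (- (2 * lam * x)) x0) (lexx 0) x0 (lexx x).
  rewrite intZ ?subrr ?expR0 ?mulr0 ?add0r in H; last exact: bm_ig.
  have l2 : 0 < 2 * lam by rewrite mulr_gt0.
  rewrite -(ler_pM2l l2) divff ?gt_eqF// -H.
  by rewrite gerBl expR_ge0.
apply: le_trans (ler_wpM2l (ltW T0) le1) _.
have Ei := bm_ig Eb.
rewrite intZ; last by apply: igD; exact: igZ.
rewrite intD; [|exact: igZ..]; rewrite intZ// intZ//.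
rewrite mulrCA; apply: ler_wpM2l; first exact: expR_ge0.
apply: (@le_trans _ _ (T * (d * K + (4 * d)^-1 * (2 * lam)^-1))).
  apply: ler_wpM2l; first exact: ltW.
  have d4 : 0 < (4 * d)^-1 by rewrite invr_gt0 mulr_gt0.
  by apply: lerD; rewrite ler_pM2l.
have -> : T * (d * K + (4 * d)^-1 * (2 * lam)^-1) = K / (K + 1) / 4 + 1 / 4.
  rewrite /lam /d; field; rewrite ?gt_eqF//; lra.
have : K / (K + 1) <= 1 by rewrite ler_pdivrMr; lra.
lra.
Qed.

(** Under [expweight] a bound K exp (lam x) on |y| improves to (K / 2 + F) exp (lam x); boundedness
    of y provides a first K, and [halving_bound] removes it. *)
Lemma gronwall T Q (lam : R) (y : R -> R) (F : R) : 0 < T -> 0 <= lam -> ig 0 T Q ->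
  expweight T Q lam -> bm 0 T y -> 0 <= F ->
  (forall x, 0 <= x <= T -> `|y x| <= F + T * int 0 x (fun t => `|Q t| * `|y t|)) ->
  forall x, 0 <= x <= T -> `|y x| <= 2 * F * expR (lam * x).
Proof.
move=> T0 lam0 Qi Qlam yb F0 yF.
pose P K := forall x, 0 <= x <= T -> `|y x| <= K * expR (lam * x).
have e1 x : 0 <= x -> 1 <= expR (lam * x).
  by move=> x0; rewrite -expR0 ler_expR mulr_ge0.
have [M yM] := yb.2.
have PN : P (`|M| + F).
  move=> x /andP[x0 xT]; apply: (@le_trans _ _ (`|M| + F)); last first.
    by rewrite ler_peMr ?addr_ge0// e1.
  move: x0; rewrite le_eqVlt => /predU1P[<-|x0].
    have := yF 0; rewrite lexx ltW// int_nil// mulr0 addr0 => /(_ isT).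
    by move=> h; apply: le_trans h _; rewrite lerDr.
  apply: le_trans (yM x _) _; first by rewrite x0.
  by apply: (le_trans (ler_norm M)); rewrite lerDl.
have step K : 0 <= K -> P K -> P (K / 2 + F).
  move=> K0 PK x /andP[x0 xT]; apply: le_trans (yF x _) _; first by rewrite x0.
  have yb' : bm 0 x y by exact: bmS yb.
  have Qi' : ig 0 x Q by exact: igS Qi.
  have Eb : bm 0 x (fun t => expR (lam * t)).
    by apply: eq_bm (expR_bm lam 0 x0) => t _; rewrite addr0.
  have : int 0 x (fun t => `|Q t| * `|y t|) <= int 0 x (fun t => K * (`|Q t| * expR (lam * t))).
    apply: le_int; [by ig_tac|by apply: igZ; ig_tac|].
    move=> t /andP[t0 tx]; rewrite mulrCA ler_wpM2l// PK// ltW//=.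
    exact: le_trans tx xT.
  rewrite intZ; last by ig_tac.
  have := Qlam x; rewrite x0 xT => /(_ isT) h1 h2.
  have h3 : T * int 0 x (fun t => `|Q t| * `|y t|) <= K * (expR (lam * x) / 2).
    apply: le_trans (ler_wpM2l (ltW T0) h2) _; rewrite mulrCA; exact: ler_wpM2l.
  have := e1 _ x0 => h4.
  have : F <= F * expR (lam * x) by rewrite ler_peMr.
  by rewrite mulrDl; lra.
move=> x xT; apply/ler_addgt0Pr => e e0.
have e'0 : 0 < e / expR (lam * x) by rewrite divr_gt0// expR_gt0.
have NN : 0 <= `|M| + F by rewrite addr_ge0.
have [K /andP[K0 KF] PK] := halving_bound NN PN step F0 e'0.
apply: le_trans (PK x xT) _.
apply: (@le_trans _ _ ((2 * F + e / expR (lam * x)) * expR (lam * x))).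
  by rewrite ler_wpM2r// expR_ge0.
by rewrite mulrDl divfK// gt_eqF// expR_gt0.
Qed.

Lemma double_int_le T (H G : R -> R) x : 0 < T -> 0 <= x <= T -> ig 0 T H -> ig 0 T G ->
  (forall t, 0 < t <= T -> `|H t| <= G t) ->
  `|int 0 x (fun s => int 0 s H)| <= T * int 0 x G.
Proof.
move=> T0 /andP[x0 xT] Hi Gi HG.
have Hi' : ig 0 x H by exact: igS Hi.
have Gi' : ig 0 x G by exact: igS Gi.
have G0 t : 0 < t <= T -> 0 <= G t by move=> /HG; exact: le_trans.
have h : `|int 0 x (fun s => int 0 s H)| <= int 0 x G * (x - 0).
  apply: norm_int_le => //; first exact: AC_ig (AC_int (bm_ig (AC_bm x0 (AC_int Hi')))).
  move=> s /andP[s0 sx].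
  apply: (@le_trans _ _ (int 0 s G)).
    apply: norm_int_le_int; [exact: igS Hi'|exact: igS Gi'|].
    by move=> t /andP[t0 ts]; apply: HG; rewrite t0 (le_trans ts (le_trans sx xT)).
  rewrite (@int_chasles _ 0 s x) ?sx ?(ltW s0)// lerDl; apply: int_ge0 => t /andP[st tx].
  by apply: G0; rewrite (lt_trans s0 st) (le_trans tx xT).
apply: le_trans h _; rewrite subr0 mulrC ler_wpM2r//.
by apply: int_ge0 => t /andP[t0 tx]; apply: G0; rewrite t0 (le_trans tx xT).
Qed.

(* Picard iteration; the increments decay geometrically in the weight exp (lam x). *)
Lemma volterra_exists T Q (lam : R) (r : R -> R) (y0 y10 : R) : 0 < T -> 0 <= lam -> ig 0 T Q ->
  expweight T Q lam -> ig 0 T r ->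
  exists y y1 : R -> R, [/\ y 0 = y0, y1 0 = y10, AC 0 T y y1
    & AC 0 T y1 (fun t => Q t * y t - r t)].
Proof.
move=> T0 lam0 Qi Qlam ri.
pose V (u : R -> R) x := y0 + int 0 x (fun s => y10 + int 0 s (fun t => Q t * u t - r t)).
have VAC1 u : bm 0 T u -> AC 0 T (fun s => y10 + int 0 s (fun t => Q t * u t - r t))
    (fun t => Q t * u t - r t).
  move=> ub; apply: (@eq_AC _ _ _ (fun s => y10 + int 0 s (fun t => Q t * u t - r t))
     (fun t => 0 + (Q t * u t - r t))) => //; first by move=> t _; rewrite add0r.
  by apply: ACD; [exact: AC_cst|apply: AC_int; ig_tac].
have VAC u : bm 0 T u -> AC 0 T (V u) (fun s => y10 + int 0 s (fun t => Q t * u t - r t)).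
  move=> ub; apply: (@eq_AC _ _ _ (V u)
     (fun s => 0 + (y10 + int 0 s (fun t => Q t * u t - r t)))) => //.
    by move=> t _; rewrite add0r.
  apply: ACD; [exact: AC_cst|apply: AC_int].
  exact: bm_ig (AC_bm (ltW T0) (VAC1 u ub)).
have Vb u : bm 0 T u -> bm 0 T (V u) by move=> /VAC; exact: AC_bm (ltW T0).
have Vdiff u v x : bm 0 T u -> bm 0 T v -> 0 <= x <= T ->
    V u x - V v x = int 0 x (fun s => int 0 s (fun t => Q t * (u t - v t))).
  move=> ub vb /andP[x0 xT]; rewrite /V opprD addrACA subrr add0r.
  rewrite -intB; last first.
  - by apply: igS (bm_ig (AC_bm (ltW T0) (VAC1 v vb))).
  - by apply: igS (bm_ig (AC_bm (ltW T0) (VAC1 u ub))).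
  apply: eq_int => s /andP[s0 sx]; rewrite opprD addrACA subrr add0r.
  have sT := le_trans sx xT.
  have Qi' : ig 0 s Q by exact: igS Qi.
  have ri' : ig 0 s r by exact: igS ri.
  have ub' : bm 0 s u by exact: bmS ub.
  have vb' : bm 0 s v by exact: bmS vb.
  rewrite -intB; [|ig_tac..].
  by apply: eq_int => t _; ring.
have Eb x : 0 <= x -> bm 0 x (fun t => expR (lam * t)).
  by move=> x0; apply: eq_bm (expR_bm lam 0 x0) => t _; rewrite addr0.
have EbT := Eb T (ltW T0).
have e1 x : 0 <= x -> 1 <= expR (lam * x).
  by move=> x0; rewrite -expR0 ler_expR mulr_ge0.
have Vcontr u v (K : R) x : bm 0 T u -> bm 0 T v -> 0 <= K -> 0 <= x <= T ->
    (forall t, 0 < t <= T -> `|u t - v t| <= K * expR (lam * t)) ->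
    `|V u x - V v x| <= K / 2 * expR (lam * x).
  move=> ub vb K0 xT uv; rewrite Vdiff//.
  apply: le_trans (@double_int_le T _ (fun t => K * (`|Q t| * expR (lam * t))) x T0 xT _ _ _) _.
  - by ig_tac.
  - by apply: igZ; ig_tac.
  - by move=> t tT; rewrite normrM mulrCA ler_wpM2l// uv.
  have x0 : 0 <= x by case/andP: xT.
  rewrite intZ; last first.
    have Qi' : ig 0 x Q by apply: igS Qi => //; case/andP: xT.
    have := Eb x x0 => ?; by ig_tac.
  rewrite mulrCA [K / 2 * _]mulrAC -mulrA; apply: ler_wpM2l => //; exact: Qlam.
pose u n := iter n V (fun=> 0).
have ub n : bm 0 T (u n) by elim: n => [|n ih]; [exact: bm_cst|exact: Vb].
have [B HB] := (Vb _ (bm_cst 0 T 0)).2.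
pose B1 := `|B| + `|y0|.
have B10 : 0 <= B1 by rewrite addr_ge0.
have u0B x : 0 <= x <= T -> `|V (fun=> 0) x| <= B1.
  move=> /andP[]; rewrite le_eqVlt => /predU1P[<- _|x0 xT].
    by rewrite /V int_nil// addr0 lerDr.
  apply: le_trans (HB x _) _; rewrite ?x0//.
  by apply: (le_trans (ler_norm B)); rewrite lerDl.
have uinc n x : 0 <= x <= T -> `|u n.+1 x - u n x| <= B1 * expR (lam * x) / 2 ^+ n.
  elim: n x => [|n ih] x xT.
    rewrite /u/= subr0 expr0 divr1; apply: le_trans (u0B x xT) _.
    by rewrite ler_peMr// e1//; case/andP: xT.
  have -> : B1 * expR (lam * x) / 2 ^+ n.+1 = (B1 / 2 ^+ n) / 2 * expR (lam * x).
    by rewrite exprS; field; rewrite expf_neq0.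
  apply: (@Vcontr (u n.+1) (u n)) => //; first by rewrite divr_ge0 ?exprn_ge0.
  move=> t /andP[t0 tT]; apply: le_trans (ih t _) _; first by rewrite ltW.
  by rewrite mulrAC.
have ylim x : exists l, 0 <= x <= T -> forall n,
    `|l - u n x| <= 2 * (B1 * expR (lam * x)) / 2 ^+ n.
  have [xT|xT] := pselect (0 <= x <= T); last by exists 0 => /xT.
  have [l Hl] := @geometric_increments_limit (fun n => u n x) (B1 * expR (lam * x)) (fun n => uinc n x xT).
  by exists l.
have [y Hy] := choice ylim.
have ym : measurable_fun `]0, T] y.
  apply: (@measurable_fun_cvg _ _ _ `]0, T] (fun n x => u n x) y).
  - by move=> n; exact: (ub n).1.
  - move=> x /=; rewrite in_itv/= => /andP[x0 xT].
    apply/cvgrPdist_le => e e0.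
    have C0 : 0 <= 2 * (B1 * expR (lam * x)) by rewrite !mulr_ge0// expR_ge0.
    have [N HN] := half_pow_small C0 e0.
    exists N => // n /= Nn; apply: le_trans (HN n Nn).
    by apply: Hy; rewrite ltW.
have yb : bm 0 T y.
  split=> //; have [M HM] := (ub 0%N).2.
  exists (2 * (B1 * expR (lam * T)) + M) => x /andP[x0 xT].
  have := Hy x; rewrite ltW//= xT => /(_ isT 0%N); rewrite expr0 divr1 => h.
  have h' := HM x; rewrite x0 xT/= in h'.
  rewrite -(subrK (u 0%N x) (y x)); apply: le_trans (ler_normD _ _) _.
  apply: lerD; last exact: h'.
  apply: le_trans h _; rewrite !ler_wpM2l// ler_expR ler_wpM2l//.
have yV x : 0 <= x <= T -> y x = V y x.
  move=> xT; apply/eqP; rewrite -subr_eq0 -normr_le0.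
  apply: (@half_pow_le0 _ (2 * (B1 * expR (lam * x)))) => n.
  have h1 := Hy x xT n.+1.
  have h2 : `|V (u n) x - V y x| <= (2 * B1 / 2 ^+ n) / 2 * expR (lam * x).
    apply: Vcontr => //; first by rewrite divr_ge0 ?mulr_ge0 ?exprn_ge0.
    move=> t /andP[t0 tT]; rewrite distrC; apply: le_trans (Hy t _ n) _; first by rewrite ltW.
    by rewrite mulrA mulrAC.
  rewrite -(subrK (u n.+1 x) (y x)) -addrA; apply: le_trans (ler_normD _ _) _.
  apply: le_trans (lerD h1 h2) _; rewrite exprS le_eqVlt; apply/orP; left; apply/eqP.
  by field; rewrite expf_neq0.
exists y, (fun s => y10 + int 0 s (fun t => Q t * y t - r t)); split.
- by rewrite yV ?lexx ?ltW// /V int_nil// addr0.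
- by rewrite int_nil// addr0.
- apply: eq_AC (VAC y yb) => // x xT; by rewrite -yV.
- exact: VAC1.
Qed.

End volterra.

(** * The Sturm-Liouville equation *)

Lemma lipschitz_continuous (R : realType) (F : R -> R) :
  (forall Z : R, exists C : R, forall z w, `|z| <= Z -> `|w| <= Z -> `|F z - F w| <= C * `|z - w|) ->
  continuous F.
Proof.
move=> H w; have [C HC] := H (`|w| + 1).
apply/cvgrPdist_le => e e0.
have C0 : 0 < `|C| + 1 by rewrite ltr_wpDl.
near=> z.
have zw : `|w - z| <= e / (`|C| + 1).
  by near: z; apply: cvgr_dist_le; [exact: cvg_id|rewrite divr_gt0].
have zw1 : `|w - z| <= 1.
  by near: z; apply: cvgr_dist_le; [exact: cvg_id|].
apply: le_trans (HC w z _ _) _.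
- by rewrite lerDl.
- rewrite -[z](subrK w) addrC; apply: le_trans (ler_normD _ _) _.
  by rewrite lerD2l distrC.
- apply: (@le_trans _ _ ((`|C| + 1) * `|w - z|)).
    by rewrite ler_wpM2r// (le_trans (ler_norm C))// lerDl.
  by rewrite mulrC -ler_pdivlMr.
Unshelve. all: by end_near.
Qed.

Section sobolev.
Context {R : realType}.
Implicit Types (a b : R) (q v : R -> R).

(** The oscillation of v ^ 2 is at most the integral of 2 |v v1|, hence at most the integral J of v
    ^ 2 / d + d v1 ^ 2. So v(x) ^ 2 <= v(y) ^ 2 + J for every y, and the claim is the average over
    y. *)
Lemma sup_sq_le a b v v1 (d x : R) : a < b -> 0 < d -> AC a b v v1 -> bm a b v1 ->
  a <= x <= b ->
  v x ^+ 2 <= ((b - a)^-1 + d^-1) * int a b (fun t => v t ^+ 2) + d * int a b (fun t => v1 t ^+ 2).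
Proof.
move=> ab d0 Av v1b /andP[ax xb].
have vb := AC_bm (ltW ab) Av.
have sqb : bm a b (fun t => v t ^+ 2) by exact: bmM.
have sq1b : bm a b (fun t => v1 t ^+ 2) by exact: bmM.
have Jb : bm a b (fun t => d^-1 * v t ^+ 2 + d * v1 t ^+ 2) by bm_tac.
have A2 := ACM (ltW ab) Av Av.
set J := int a b (fun t => d^-1 * v t ^+ 2 + d * v1 t ^+ 2).
have JE : J = d^-1 * int a b (fun t => v t ^+ 2) + d * int a b (fun t => v1 t ^+ 2).
  by rewrite /J intD ?intZ//; try exact: bm_ig; apply: igZ; exact: bm_ig.
have dJ u w : a <= u -> u <= w -> w <= b -> `|v w * v w - v u * v u| <= J.
  move=> au uw wb; rewrite (AC_diff A2 au uw wb).
  apply: (@le_trans _ _ (int u w (fun t => d^-1 * v t ^+ 2 + d * v1 t ^+ 2))).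
    apply: norm_int_le_int.
    - by apply: igS (AC_ig A2).
    - by apply: igS (bm_ig Jb).
    move=> t _; have -> : v1 t * v t + v t * v1 t = 2 * (v t * v1 t) by ring.
    rewrite normrM ger0_norm// normrM.
    have -> : v t ^+ 2 = `|v t| ^+ 2 by rewrite real_normK ?num_real.
    have -> : v1 t ^+ 2 = `|v1 t| ^+ 2 by rewrite real_normK ?num_real.
    rewrite -subr_ge0.
    have -> : d^-1 * `|v t| ^+ 2 + d * `|v1 t| ^+ 2 - 2 * (`|v t| * `|v1 t|)
       = (`|v t| - d * `|v1 t|) ^+ 2 / d by field; rewrite gt_eqF.
    by rewrite divr_ge0 ?sqr_ge0// ltW.
  have Jnn t : 0 <= d^-1 * v t ^+ 2 + d * v1 t ^+ 2.
    by rewrite addr_ge0// mulr_ge0 ?sqr_ge0// ?invr_ge0 ltW.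
  rewrite /J (@int_chasles _ a u b) ?au ?(le_trans uw wb)//; last exact: bm_ig.
  rewrite (@int_chasles _ u w b) ?uw ?wb//; last by apply: igS (bm_ig Jb).
  rewrite addrCA lerDl; apply: addr_ge0; apply: int_ge0 => *; exact: Jnn.
have vJ y : a < y <= b -> v x ^+ 2 <= v y ^+ 2 + J.
  move=> /andP[ay yb]; rewrite !expr2.
  have [xy|yx] := leP x y.
    by have := dJ _ _ ax xy yb; rewrite ler_norml => /andP[]; lra.
  by have := dJ _ _ (ltW ay) (ltW yx) xb; rewrite ler_norml => /andP[]; lra.
have : int a b (fun=> v x ^+ 2) <= int a b (fun y => v y ^+ 2 + J).
  apply: le_int => //; [exact: bm_ig (bm_cst _ _ _)|apply: bm_ig; bm_tac].
rewrite int_cst ?(ltW ab)// intD; [|exact: bm_ig|exact: bm_ig (bm_cst _ _ _)].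
rewrite int_cst ?(ltW ab)// => h.
have ba0 : 0 < b - a by rewrite subr_gt0.
rewrite mulrDl -addrA -JE -(ler_pM2r ba0).
apply: le_trans h _; rewrite le_eqVlt; apply/orP; left; apply/eqP.
by field; rewrite gt_eqF.
Qed.

(** An integrable potential is a form perturbation of the derivative with relative bound 1/2: the
    supremum of v ^ 2 leaves the integral, and d is so small that d times the L^1 norm of q is at
    most 1/2. *)
Lemma potential_form_bound a b q : a < b -> ig a b q -> exists2 C : R, 0 <= C &
  forall v v1, AC a b v v1 -> bm a b v1 ->
  int a b (fun t => `|q t| * v t ^+ 2) <=
    int a b (fun t => v1 t ^+ 2) / 2 + C * int a b (fun t => v t ^+ 2).
Proof.
move=> ab qi; set N := int a b (fun t => `|q t|).
have N0 : 0 <= N by apply: int_ge0.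
pose d := (2 * (N + 1))^-1.
have d0 : 0 < d by rewrite invr_gt0 mulr_gt0//; lra.
have ba0 : 0 < b - a by rewrite subr_gt0.
have C0 : 0 <= (b - a)^-1 + d^-1 by rewrite addr_ge0// invr_ge0 ltW.
exists (N * ((b - a)^-1 + d^-1)); first exact: mulr_ge0.
move=> v v1 Av v1b.
have vb := AC_bm (ltW ab) Av.
have sqb : bm a b (fun t => v t ^+ 2) by exact: bmM.
set S := ((b - a)^-1 + d^-1) * int a b (fun t => v t ^+ 2) + d * int a b (fun t => v1 t ^+ 2).
have h : int a b (fun t => `|q t| * v t ^+ 2) <= int a b (fun t => S * `|q t|).
  apply: le_int; [by ig_tac|by apply: igZ; ig_tac|].
  move=> t /andP[at_ tb]; rewrite mulrC ler_wpM2r//.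
  by apply: sup_sq_le => //; rewrite ltW.
apply: le_trans h _; rewrite intZ; last by ig_tac.
rewrite -/N /S.
have i0 : 0 <= int a b (fun t => v1 t ^+ 2) by apply: int_ge0 => *; exact: sqr_ge0.
have dN : d * N <= 2^-1.
  by rewrite /d mulrC ler_pdivrMr; lra.
have := ler_wpM2l i0 dN.
set I1 := int a b _; set I2 := int a b _; set A := (b - a)^-1 + d^-1 => h1.
rewrite [leLHS](_ : _ = I1 * (d * N) + N * A * I2); last by ring.
by rewrite lerD2r.
Qed.

End sobolev.

Section sturm_liouville.
Context {R : realType}.
Variables (T : R) (q rho : R -> R) (rmin : R).
Hypotheses (T0 : 0 < T) (qi : ig 0 T q) (q2i : ig 0 T (fun x => q x ^+ 2)).
Hypotheses (rhob : bm 0 T rho) (rmin0 : 0 < rmin).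
Hypothesis rho_ge : forall x, 0 < x <= T -> rmin <= rho x.
Implicit Types (z w : R) (f y u v : R -> R).

(** This is (A - z) y = f for A y = (- y'' + q y) / rho, with y1 = y' and no boundary condition.
    [wip] is the inner product for which A is formally symmetric. *)
Definition sol z f y y1 := [/\ bm 0 T f, AC 0 T y y1 &
  AC 0 T y1 (fun t => (q t - z * rho t) * y t - rho t * f t)].

Definition wip u v := int 0 T (fun t => rho t * u t * v t).

Lemma coef_ig z : ig 0 T (fun t => q t - z * rho t).
Proof. by apply: igB => //; apply: bm_ig; bm_tac. Qed.

Lemma coef_expweight (Z : R) : exists2 lam : R, 0 < lam &
  forall z, `|z| <= Z -> expweight T (fun t => q t - z * rho t) lam.
Proof.
pose K := 2 * int 0 T (fun x => q x ^+ 2) + 2 * Z ^+ 2 * int 0 T (fun x => rho x ^+ 2).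
have r2b : bm 0 T (fun x => rho x ^+ 2) by exact: bmM.
have K0 : 0 <= K.
  have i1 : 0 <= int 0 T (fun x => q x ^+ 2) by apply: int_ge0 => *; exact: sqr_ge0.
  have i2 : 0 <= int 0 T (fun x => rho x ^+ 2) by apply: int_ge0 => *; exact: sqr_ge0.
  apply: addr_ge0; first exact: mulr_ge0.
  by apply: mulr_ge0 => //; apply: mulr_ge0 => //; exact: sqr_ge0.
have [lam lam0 Hlam] := expweight_exists T0 K0.
exists lam => // z zZ.
have sqi : ig 0 T (fun x => (q x - z * rho x) ^+ 2).
  have : ig 0 T (fun x => q x ^+ 2 - 2 * z * (rho x * q x) + z ^+ 2 * rho x ^+ 2).
    by ig_tac; apply: igZ; ig_tac.
  by apply: eq_ig => x _; ring.
apply: Hlam => //; first exact: coef_ig.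
rewrite /K -!intZ//; last exact: bm_ig.
rewrite -intD; [|exact: igZ|by apply: igZ; exact: bm_ig].
apply: le_int => //; first by apply: igD; [exact: igZ|by apply: igZ; exact: bm_ig].
move=> x _; have zZ2 : z ^+ 2 <= Z ^+ 2.
  rewrite -[z ^+ 2]real_normK ?num_real// ler_sqr ?nnegrE//.
  exact: le_trans (normr_ge0 _) zZ.
have : z ^+ 2 * rho x ^+ 2 <= Z ^+ 2 * rho x ^+ 2 by rewrite ler_wpM2r ?sqr_ge0.
rewrite -subr_ge0 => h1.
have h2 := sqr_ge0 (q x + z * rho x); rewrite -subr_ge0.
rewrite [leRHS](_ : _ = (q x + z * rho x) ^+ 2 + 2 * (Z ^+ 2 * rho x ^+ 2 - z ^+ 2 * rho x ^+ 2)); last by ring.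
by apply: addr_ge0 => //; apply: mulr_ge0.
Qed.

(** Integrating the equation twice gives the hypothesis of [gronwall] with F = |y 0| + T (|y1 0| +
    the integral of |rho f|). The constant depends on z only through Z, which the Lipschitz
    dependence on z requires. *)
Lemma sol_bound (Z : R) : exists2 C : R, 0 <= C & forall z f y y1, `|z| <= Z ->
  sol z f y y1 -> forall x, 0 <= x <= T ->
  `|y x| <= C * (`|y 0| + `|y1 0| + int 0 T (fun t => `|rho t * f t|)).
Proof.
have [lam lam0 Hlam] := coef_expweight Z.
exists (2 * (1 + T) * expR (lam * T)).
  by rewrite !mulr_ge0 ?expR_ge0// addr_ge0// ltW.
move=> z f y y1 zZ [fb Ay Ay1] x xT.
have yb := AC_bm (ltW T0) Ay.
set r := fun t => rho t * f t.
have rb : bm 0 T r by rewrite /r; bm_tac.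
have Qi := coef_ig z.
set I := int 0 T (fun t => `|rho t * f t|).
have I0 : 0 <= I by apply: int_ge0.
set F := `|y 0| + T * (`|y1 0| + I).
have F0 : 0 <= F by rewrite addr_ge0// mulr_ge0 ?addr_ge0// ltW.
have H := @gronwall _ T _ lam y F T0 (ltW lam0) Qi (Hlam z zZ) yb F0.
apply: le_trans (H _ x xT) _.
  move=> {xT}x /andP[x0 xT].
  rewrite (Ay.2 x) ?x0// /F -addrA; apply: le_trans (ler_normD _ _) _; rewrite lerD2l.
  have -> : int 0 x y1 = int 0 x (fun s => y1 0) + int 0 x (fun s => int 0 s (fun t => (q t - z * rho t) * y t - rho t * f t)).
    rewrite -intD; last 2 first.
    - exact: bm_ig (bm_cst _ _ _).
    - apply: bm_ig; apply: AC_bm => //.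
      by apply: AC_int; apply: igS (AC_ig Ay1).
    apply: eq_int => s /andP[s0 sx]; rewrite (Ay1.2 s)// ltW//=.
    exact: le_trans sx xT.
  apply: le_trans (ler_normD _ _) _.
  rewrite int_cst// subr0 normrM (ger0_norm x0).
  have h1 : `|y1 0| * x <= T * `|y1 0| by rewrite mulrC ler_wpM2r.
  have Gi : ig 0 T (fun t => `|q t - z * rho t| * `|y t| + `|r t|) by ig_tac.
  have h2 := @double_int_le _ T (fun t => (q t - z * rho t) * y t - rho t * f t)
    (fun t => `|q t - z * rho t| * `|y t| + `|r t|) x T0.
  have {}h2 := h2 _ (AC_ig Ay1) Gi.
  apply: le_trans (lerD h1 (h2 _ _)) _; first by rewrite x0.
    by move=> t _; apply: le_trans (ler_normB _ _) _; rewrite normrM.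
  have Qi' : ig 0 x (fun t => q t - z * rho t) by exact: igS Qi.
  have yb' : bm 0 x y by exact: bmS yb.
  have rb' : bm 0 x r by exact: bmS rb.
  rewrite intD; [|by ig_tac..].
  have h3 : int 0 x (fun t => `|r t|) <= I.
    rewrite /I (@int_chasles _ 0 x T) ?x0//; last by apply: bm_ig; bm_tac.
    by rewrite lerDl; apply: int_ge0.
  by have := ler_wpM2l (ltW T0) h3; rewrite !mulrDr; lra.
have E0 : 0 <= expR (lam * T) by exact: expR_ge0.
apply: (@le_trans _ _ (2 * F * expR (lam * T))).
  rewrite ler_wpM2l ?mulr_ge0// ler_expR ler_wpM2l ?(ltW lam0)//; by case/andP: xT.
rewrite [leRHS]mulrAC ler_wpM2r// -[leRHS]mulrA ler_wpM2l// /F.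
have := normr_ge0 (y 0); have := normr_ge0 (y1 0); move: (`|y 0|) (`|y1 0|) => A B B0 A0.
have h1 : 0 <= T * A by rewrite mulr_ge0// ltW.
lra.
Qed.

Lemma sol_exists z f (y0 y10 : R) : bm 0 T f -> exists y y1,
  [/\ sol z f y y1, y 0 = y0 & y1 0 = y10].
Proof.
move=> fb; have [lam lam0 Hlam] := coef_expweight `|z|.
have ri : ig 0 T (fun t => rho t * f t) by apply: bm_ig; bm_tac.
have [y [y1 [yy yy1 Ay Ay1]]] :=
  volterra_exists y0 y10 T0 (ltW lam0) (coef_ig z) (Hlam z (lexx _)) ri.
by exists y, y1.
Qed.

Lemma sol_bm z f y y1 : sol z f y y1 -> [/\ bm 0 T y & bm 0 T y1].
Proof. by move=> [_ /(AC_bm (ltW T0)) ? /(AC_bm (ltW T0)) ?]. Qed.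

Lemma sol_eq z f g y y1 : (forall x, 0 < x <= T -> f x = g x) -> sol z f y y1 -> sol z g y y1.
Proof.
move=> fg [fb Ay Ay1]; split => //; first exact: eq_bm fb.
by apply: eq_AC Ay1 => // x xT; rewrite fg.
Qed.

Lemma solD z f g y y1 v v1 : sol z f y y1 -> sol z g v v1 ->
  sol z (fun t => f t + g t) (fun t => y t + v t) (fun t => y1 t + v1 t).
Proof.
move=> [fb Ay Ay1] [gb Av Av1]; split; [bm_tac|exact: ACD|].
by apply: eq_AC (ACD Ay1 Av1) => // x _; ring.
Qed.

Lemma solZ z k f y y1 : sol z f y y1 ->
  sol z (fun t => k * f t) (fun t => k * y t) (fun t => k * y1 t).
Proof.
move=> [fb Ay Ay1]; split; [bm_tac|exact: ACZ|].
by apply: eq_AC (ACZ k Ay1) => // x _; ring.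
Qed.

Lemma sol_shift z w f y y1 : sol w f y y1 -> sol z (fun t => f t + (w - z) * y t) y y1.
Proof.
move=> [fb Ay Ay1]; have yb := AC_bm (ltW T0) Ay.
split; [bm_tac|exact: Ay|].
by apply: eq_AC Ay1 => // x _; ring.
Qed.

Lemma ip_ig u v : bm 0 T u -> bm 0 T v -> ig 0 T (fun t => rho t * u t * v t).
Proof. by move=> ub vb; apply: bm_ig; bm_tac. Qed.

Lemma ipC u v : wip u v = wip v u.
Proof. by apply: eq_int => t _; ring. Qed.

Lemma ipDl u u' v : bm 0 T u -> bm 0 T u' -> bm 0 T v ->
  wip (fun t => u t + u' t) v = wip u v + wip u' v.
Proof.
move=> ub ub' vb; rewrite /wip -intD; [|exact: ip_ig..].
by apply: eq_int => t _; ring.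
Qed.

Lemma ipZl k u v : bm 0 T u -> bm 0 T v -> wip (fun t => k * u t) v = k * wip u v.
Proof.
move=> ub vb; rewrite /wip -intZ; [|exact: ip_ig].
by apply: eq_int => t _; ring.
Qed.

Lemma ipBl u u' v : bm 0 T u -> bm 0 T u' -> bm 0 T v ->
  wip (fun t => u t - u' t) v = wip u v - wip u' v.
Proof.
move=> ub ub' vb; rewrite /wip -intB; [|exact: ip_ig..].
by apply: eq_int => t _; ring.
Qed.

Lemma ip0l v : wip (fun=> 0) v = 0.
Proof. by rewrite -[RHS](int0 0 T); apply: eq_int => t _; rewrite mulr0 mul0r. Qed.

Lemma ip_suml (I : Type) (s : seq I) (F : I -> R -> R) v :
  (forall i, bm 0 T (F i)) -> bm 0 T v ->
  wip (fun t => \sum_(i <- s) F i t) v = \sum_(i <- s) wip (F i) v.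
Proof.
move=> Fb vb; elim: s => [|i s ih].
  rewrite big_nil -[RHS](ip0l v); apply: eq_int => t _; by rewrite big_nil.
rewrite big_cons -ih -ipDl//; last exact: bm_sum.
by apply: eq_int => t _; rewrite big_cons.
Qed.

Lemma ip_ge0 u : 0 <= wip u u.
Proof.
apply: int_ge0 => t tT; rewrite -mulrA mulr_ge0 -?expr2 ?sqr_ge0//.
by apply: le_trans (rho_ge tT); exact: ltW.
Qed.

Lemma cauchy_schwarz u v : bm 0 T u -> bm 0 T v -> wip u v ^+ 2 <= wip u u * wip v v.
Proof.
move=> ub vb.
have H k : 0 <= wip u u - 2 * k * wip u v + k ^+ 2 * wip v v.
  have := ip_ge0 (fun t => u t - k * v t).
  have kvb : bm 0 T (fun t => k * v t) by bm_tac.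
  have ukb : bm 0 T (fun t => u t - k * v t) by bm_tac.
  have e1 (g : R -> R) : bm 0 T g -> wip (fun t => u t - k * v t) g = wip u g - k * wip v g.
    by move=> gb; rewrite ipBl// ipZl.
  rewrite e1// (ipC u (fun t => _)) (ipC v (fun t => _)) !e1// (ipC v u) => h.
  by apply: le_trans h _; rewrite le_eqVlt; apply/orP; left; apply/eqP; ring.
have [v0|v0] := eqVneq (wip v v) 0.
  rewrite v0 mulr0; rewrite v0 in H.
  have [->|uv0] := eqVneq (wip u v) 0; first by rewrite expr0n.
  have := H ((wip u u + 1) / (2 * wip u v)).
  rewrite (_ : 2 * ((wip u u + 1) / (2 * wip u v)) * wip u v = wip u u + 1); first by lra.
  by field.
have vp : 0 < wip v v by rewrite lt_neqAle eq_sym v0 ip_ge0.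
have := H (wip u v / wip v v).
rewrite -(pmulr_rge0 _ vp).
rewrite (_ : _ * _ = wip u u * wip v v - wip u v ^+ 2); last by field.
by rewrite subr_ge0.
Qed.

Lemma ip_diff_le u u' v (e : R) : bm 0 T u -> bm 0 T u' -> bm 0 T v ->
  (forall x, 0 < x <= T -> `|u x - u' x| <= e) ->
  `|wip u v - wip u' v| <= int 0 T (fun t => `|rho t * v t|) * e.
Proof.
move=> ub ub' vb ue; rewrite -ipBl//.
have rvb : bm 0 T (fun t => `|rho t * v t|) by bm_tac.
rewrite mulrC -intZ; last exact: bm_ig.
apply: norm_int_le_int.
- by apply: bm_ig; bm_tac.
- by apply: igZ; exact: bm_ig.
by move=> t tT; rewrite mulrAC normrM mulrC ler_wpM2r// ue.
Qed.

(** Green's identity with source terms. Orthogonality of eigenfunctions, the pairings of Weyl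
    solutions and the resolvent identities below all follow from it by inserting boundary values. *)
Lemma lagrange z w f g y y1 v v1 : sol z f y y1 -> sol w g v v1 ->
  (y T * v1 T - y1 T * v T) - (y 0 * v1 0 - y1 0 * v 0) =
  (z - w) * wip y v - wip y g + wip f v.
Proof.
move=> ys vs; have [yb y1b] := sol_bm ys; have [vb v1b] := sol_bm vs.
move: ys vs => [fb Ay Ay1] [gb Av Av1].
have A := ACB (ACM (ltW T0) Ay Av1) (ACM (ltW T0) Ay1 Av).
rewrite (AC_diff A (lexx _) (ltW T0) (lexx _)).
have b1 := ip_ig yb vb; have b2 := ip_ig yb gb; have b3 := ip_ig fb vb.
rewrite /wip -intZ// -intB//; last exact: igZ.
rewrite -intD//; last by apply: igB => //; exact: igZ.
by apply: eq_int => t _; ring.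
Qed.

(** By [sol_shift] the difference y - v solves the equation at z with source (z - w) v and zero
    Cauchy data at 0, so [sol_bound] applies twice: to v and to the difference. *)
Lemma sol_lipschitz (Z : R) f (y0 y10 : R) : bm 0 T f ->
  exists2 C : R, 0 <= C & forall z w y y1 v v1, `|z| <= Z -> `|w| <= Z ->
  sol z f y y1 -> sol w f v v1 -> y 0 = y0 -> v 0 = y0 -> y1 0 = y10 -> v1 0 = y10 ->
  forall x, 0 <= x <= T -> `|y x - v x| <= C * `|z - w|.
Proof.
move=> fb; have [C C0 HC] := sol_bound Z.
set D := C * (`|y0| + `|y10| + int 0 T (fun t => `|rho t * f t|)).
have D0 : 0 <= D by rewrite mulr_ge0// !addr_ge0//; apply: int_ge0.
set N := int 0 T (fun t => `|rho t|).
have N0 : 0 <= N by apply: int_ge0.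
exists (C * (D * N)); first by apply: mulr_ge0 => //; exact: mulr_ge0.
move=> z w y y1 v v1 zZ wZ ys vs yy0 vy0 yy10 vy10 x xT.
have vD t : 0 <= t <= T -> `|v t| <= D.
  by move=> tT; have := HC _ _ _ _ wZ vs t tT; rewrite vy0 vy10.
have [vb _] := sol_bm vs.
have ds := solD ys (solZ (-1) (sol_shift z vs)).
have := HC _ _ _ _ zZ ds x xT.
rewrite yy0 vy0 yy10 vy10 !mulN1r !subrr normr0 !add0r => h.
apply: le_trans h _; rewrite -mulrA; apply: ler_wpM2l => //.
rewrite mulrC -/N mulrA -intZ; last by apply: bm_ig; bm_tac.
apply: le_int; [apply: bm_ig; bm_tac|by apply: igZ; apply: bm_ig; bm_tac|].
move=> t /andP[t0 tT].
rewrite [X in `|X|](_ : _ = (z - w) * v t * rho t); last by ring.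
rewrite !normrM ler_wpM2r// ler_wpM2l// vD// ltW//.
Qed.

End sturm_liouville.

(** * Energy estimates and the spectrum *)

Lemma separated_finite (R : realType) (A : set R) (a b d : R) : 0 < d ->
  (forall x, A x -> a <= x <= b) ->
  (forall x y, A x -> A y -> x != y -> d <= `|x - y|) -> finite_set A.
Proof.
move=> d0 Aab Ad.
pose n := (Num.truncn ((b - a) / d)).+1.
(* The default [n] lies outside [I_n], so the preimage of [I_n] is exactly A, and on A the index of
   the cell of length d is injective. *)
pose f x := if `[< A x >] then Num.truncn ((x - a) / d) else n.
have fn x : A x -> (Num.truncn ((x - a) / d) < n)%N.
  move=> Ax; rewrite /n ltnS; apply: le_truncn.
  by rewrite ler_pM2r ?invr_gt0// lerD2r; case/andP: (Aab x Ax).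
have -> : A = f @^-1` `I_n.
  apply/seteqP; split => x /=; rewrite /f.
    by move=> Ax; rewrite asboolT//; exact: fn.
  by case: asboolP => // _; rewrite ltnn.
apply: finite_preimage; last exact: finite_II.
have fA x : x \in f @^-1` `I_n -> A x.
  by rewrite inE/= /f; case: asboolP => // _; rewrite ltnn.
move=> x y /fA Ax /fA Ay; rewrite /f !asboolT// => fxy.
apply/eqP; apply/negP => /negP xy.
have := Ad x y Ax Ay xy; apply/negP; rewrite -ltNge.
have nn z : A z -> 0 <= (z - a) / d.
  by move=> Az; rewrite divr_ge0 ?subr_ge0 ?(ltW d0)//; case/andP: (Aab z Az).
have /andP[hx1 hx2] := truncn_itv (nn x Ax).
have /andP[hy1 hy2] := truncn_itv (nn y Ay).
rewrite fxy -natr1 in hx1 hx2; rewrite -natr1 in hy2.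
have : `|(x - a) / d - (y - a) / d| < 1.
  by rewrite ltr_norml; apply/andP; split; lra.
rewrite -mulrBl normrM [`|d^-1|]gtr0_norm ?invr_gt0// ltr_pdivrMr// mul1r.
by rewrite opprB addrA subrK.
Qed.

(* The Riccati inequality h^2 <= K h' blows up to the right of a point where
   h > K / (X - z), and to the left of a point where h < 0. *)
Lemma riccati_bound (R : realType) (h dh : R -> R) (K X : R) : 0 <= K ->
  (forall z, z < X -> is_derive z 1 h (dh z)) ->
  (forall z, z < X -> h z ^+ 2 <= K * dh z) -> (forall z, z < X -> 0 <= dh z) ->
  forall z, z < X -> 0 <= h z <= K / (X - z).
Proof.
move=> K0 Dh hK dh0.
have hc z : z < X -> {for z, continuous h}.
  move=> zX; apply: differentiable_continuous; apply/derivable1_diffP.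
  by have := Dh z zX; case.
have mono z w : z <= w -> w < X -> h z <= h w.
  move=> zw wX; apply: (@ger0_derive1_ndecr _ h z w) => //.
  - move=> x; rewrite in_itv/= => /andP[zx xw].
    by have := Dh x (lt_trans xw wX); case.
  - move=> x; rewrite in_itv/= => /andP[zx xw].
    have D := Dh x (lt_trans xw wX).
    by rewrite derive1E derive_val dh0// (lt_trans xw wX).
  - apply: continuous_in_subspaceT => x; rewrite inE/= in_itv/= => /andP[zx xw].
    by apply: hc; exact: le_lt_trans wX.
have [K00|Kn0] := eqVneq K 0.
  move=> z zX; have := hK z zX; rewrite K00 mul0r => h2.
  have -> : h z = 0 by apply/eqP; rewrite -sqrf_eq0 eq_le h2 sqr_ge0.
  by rewrite mul0r lexx.
have Kp : 0 < K by rewrite lt_neqAle eq_sym Kn0.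
(* Away from the zeros of h the Riccati inequality reads (- 1 / h)' >= 1 / K, that is, - 1 / h - z /
   K is nondecreasing. *)
have incr z w : z <= w -> w < X -> (forall x, z <= x <= w -> h x != 0) ->
    - (h z)^-1 - z / K <= - (h w)^-1 - w / K.
  move=> zw wX hn0.
  pose F := fun x : R => - (h x)^-1 - x / K.
  have DF x : z <= x <= w -> is_derive x 1 F (dh x / h x ^+ 2 - K^-1).
    move=> xzw; have D := Dh x (le_lt_trans (andP xzw).2 wX).
    have h0 := hn0 x xzw.
    have DV : is_derive x 1 (fun y => (h y)^-1) (- (h x)^-2 *: dh x) by exact: is_deriveV.
    have DN : is_derive x 1 (fun y => - (h y)^-1) (- (- (h x)^-2 *: dh x)) by exact: is_deriveN.
    have DK : is_derive x 1 (fun y : R => y / K) K^-1.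
      by apply: is_derive_eq; rewrite scaler0 add0r /GRing.scale/= mulr1.
    have DD : is_derive x 1 F (- (- (h x)^-2 *: dh x) - K^-1) by exact: is_deriveB.
    by apply: is_derive_eq; rewrite /GRing.scale/= mulNr opprK mulrC.
  apply: (@ger0_derive1_ndecr _ F z w) => //.
  - move=> x; rewrite in_itv/= => /andP[zx xw].
    by have := DF x; rewrite !ltW// => /(_ isT); case.
  - move=> x; rewrite in_itv/= => /andP[zx xw].
    have xzw : z <= x <= w by rewrite !ltW.
    have D := DF x xzw.
    rewrite derive1E derive_val subr_ge0.
    rewrite ler_pdivlMr; last by rewrite lt_neqAle eq_sym sqrf_eq0 hn0// sqr_ge0.
    rewrite mulrC ler_pdivrMr// mulrC; apply: hK; exact: lt_trans wX.
  - apply: continuous_in_subspaceT => x; rewrite inE/= in_itv/= => xzw.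
    apply: differentiable_continuous; apply/derivable1_diffP.
    by have := DF x xzw; case.
have hge0 z : z < X -> 0 <= h z.
  move=> zX; rewrite leNgt; apply/negP => hz0.
  (* This is the point where the comparison solution of h ^ 2 = K h' through (z, h z) blows up.
     Comparing w and z makes - 1 / h w nonpositive although h w < 0. The second half of the proof
     uses the same point, now to the right of z; it lies below X exactly because h z > K / (X -
     z). *)
  pose w := z + K / h z.
  have wz : w <= z by rewrite gerDl mulr_ge0_le0// invr_le0 ltW.
  have hw : h w < 0 by apply: le_lt_trans (mono _ _ wz zX) hz0.
  have := incr w z wz zX.
  have hn x : w <= x <= z -> h x != 0.
    by move=> /andP[_ xz]; rewrite lt_eqF//; apply: le_lt_trans (mono _ _ xz zX) hz0.
  move=> /(_ hn).
  have -> : w / K = z / K + (h z)^-1 by rewrite /w; field; rewrite Kn0 lt_eqF.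
  have : (h w)^-1 < 0 by rewrite invr_lt0.
  lra.
move=> z zX; rewrite hge0//=.
have [hz|hz] := eqVneq (h z) 0.
  by rewrite hz divr_ge0// subr_ge0 ltW.
have hz0 : 0 < h z by rewrite lt_neqAle eq_sym hz hge0.
rewrite leNgt; apply/negP => hlt.
have Xz : 0 < X - z by rewrite subr_gt0.
pose w := z + K / h z.
have zw : z <= w by rewrite lerDl divr_ge0// ltW.
have wX : w < X.
  by rewrite -ltrBrDl ltr_pdivrMr// mulrC -ltr_pdivrMr.
have hn x : z <= x <= w -> h x != 0.
  move=> /andP[zx xw]; rewrite gt_eqF//.
  by apply: lt_le_trans hz0 (mono _ _ zx (le_lt_trans xw wX)).
have := incr z w zw wX hn.
have -> : w / K = z / K + (h z)^-1 by rewrite /w; field; rewrite Kn0 hz.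
have : 0 < (h w)^-1 by rewrite invr_gt0; apply: lt_le_trans hz0 (mono _ _ zw wX).
lra.
Qed.

Section energy.
Context {R : realType}.
Variables (T : R) (q rho : R -> R) (rmin : R).
Hypotheses (T0 : 0 < T) (qi : ig 0 T q).
Hypotheses (rhob : bm 0 T rho) (rmin0 : 0 < rmin).
Hypothesis rho_ge : forall x, 0 < x <= T -> rmin <= rho x.
Implicit Types (z w a b : R) (u v : R -> R).
Let sol := sol T q rho.

Lemma energy_identity z a b u u1 : 0 <= a -> a <= b -> b <= T -> sol z (fun=> 0) u u1 ->
  u b * u1 b - u a * u1 a = int a b (fun t => u1 t ^+ 2 + (q t - z * rho t) * u t ^+ 2).
Proof.
move=> a0 ab bT [_ Au Au1].
rewrite (AC_diff (ACM (ltW T0) Au Au1) a0 ab bT).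
by apply: eq_int => t _; ring.
Qed.

Lemma energy_ig z a b v v1 : 0 <= a -> b <= T -> bm a b v -> bm a b v1 ->
  ig a b (fun t => v1 t ^+ 2 + (q t - z * rho t) * v t ^+ 2).
Proof.
move=> a0 bT vb v1b.
have qi' : ig a b q by exact: igS qi.
have rb : bm a b rho by exact: bmS rhob.
have sqb : bm a b (fun t => v t ^+ 2) by exact: bmM.
have sq1b : bm a b (fun t => v1 t ^+ 2) by exact: bmM.
by ig_tac.
Qed.

(** Half of the derivative term absorbs the potential, and - z rho >= - z rmin. Since C does not
    depend on z, the factor - z rmin - C is as large as desired once z is negative enough. *)
Lemma energy_coercive a b : 0 <= a -> a < b -> b <= T -> exists2 C : R, 0 <= C &
  forall z v v1, z <= 0 -> AC a b v v1 -> bm a b v1 ->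
  int a b (fun t => v1 t ^+ 2) / 2 + (- z * rmin - C) * int a b (fun t => v t ^+ 2) <=
  int a b (fun t => v1 t ^+ 2 + (q t - z * rho t) * v t ^+ 2).
Proof.
move=> a0 ab bT.
have qi' : ig a b q by exact: igS qi.
have rb : bm a b rho by exact: bmS rhob.
have [C C0 HC] := potential_form_bound ab qi'.
exists C => // z v v1 z0 Av v1b.
have h1 := HC v v1 Av v1b.
have vb := AC_bm (ltW ab) Av.
have sqb : bm a b (fun t => v t ^+ 2) by exact: bmM.
have sq1b : bm a b (fun t => v1 t ^+ 2) by exact: bmM.
have h2 : int a b (fun t => v1 t ^+ 2 - `|q t| * v t ^+ 2 + - z * rmin * v t ^+ 2) <=
    int a b (fun t => v1 t ^+ 2 + (q t - z * rho t) * v t ^+ 2).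
  apply: le_int; [by ig_tac|exact: energy_ig|].
  move=> t /andP[at_ tb].
  have s0 := sqr_ge0 (v t).
  have r1 : rmin <= rho t by apply: rho_ge; rewrite (le_lt_trans a0 at_) (le_trans tb bT).
  have q1 : - `|q t| <= q t by have := ler_norm (- q t); rewrite normrN; lra.
  have z1 : - z * rmin <= - z * rho t by rewrite ler_wpM2l// oppr_ge0.
  have := ler_wpM2r s0 q1; have := ler_wpM2r s0 z1.
  by rewrite mulrBl; lra.
rewrite intD in h2; [|by ig_tac..]; rewrite intB in h2; [|by ig_tac..].
rewrite intZ in h2; last exact: bm_ig.
lra.
Qed.

End energy.

Section spectrum.
Context {R : realType}.
Variables (T : R) (q rho : R -> R) (rmin : R).
Hypotheses (T0 : 0 < T) (qi : ig 0 T q) (q2i : ig 0 T (fun x => q x ^+ 2)).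
Hypotheses (rhob : bm 0 T rho) (rmin0 : 0 < rmin).
Hypothesis rho_ge : forall x, 0 < x <= T -> rmin <= rho x.
Variables Phi Phi1 : R -> R -> R.
Hypothesis Phis : forall z, sol T q rho z (fun=> 0) (Phi z) (Phi1 z).
Hypothesis Phi0 : forall z, Phi z 0 = 1.
Hypothesis Phi10 : forall z, Phi1 z 0 = 0.
Implicit Types (z w : R) (u v f g y : R -> R).
Let sol := sol T q rho.
Let ip := wip T rho.

Lemma Phi_bm z : bm 0 T (Phi z). Proof. by have [] := sol_bm T0 (Phis z). Qed.

(** For |z| <= Z the derivative of [Phi z] is bounded by a common D, and [Phi z] starts at 1, so it
    stays above 1/2 on an interval [0, x0] that does not depend on z. *)
Lemma Phi_norm_ge (Z : R) : exists2 c : R, 0 < c & forall z, `|z| <= Z -> c <= ip (Phi z) (Phi z).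
Proof.
have [C C0 HC] := sol_bound T0 qi q2i rhob Z.
have PC z : `|z| <= Z -> forall x, 0 <= x <= T -> `|Phi z x| <= C.
  move=> zZ x xT; have := HC _ _ _ _ zZ (Phis z) x xT.
  rewrite Phi0 Phi10 normr1 normr0 addr0.
  rewrite (_ : int 0 T _ = 0); first by rewrite addr0 mulr1.
  by rewrite -[RHS](int0 0 T); apply: eq_int => t _; rewrite mulr0 normr0.
pose D := C * (int 0 T (fun t => `|q t|) + Z * int 0 T (fun t => `|rho t|)).
have [Z0|Z0] := ltP Z 0.
  exists 1 => // z zZ; have := normr_ge0 z; lra.
have nq := ig_norm qi; have nr := bm_norm rhob.
have D0 : 0 <= D by rewrite mulr_ge0// addr_ge0 ?mulr_ge0//; apply: int_ge0.
have P1D z : `|z| <= Z -> forall x, 0 < x <= T -> `|Phi1 z x| <= D.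
  move=> zZ x /andP[x0 xT]; have [_ _ A1] := Phis z.
  rewrite (A1.2 x) ?(ltW x0)// Phi10 add0r.
  apply: (@le_trans _ _ (int 0 x (fun t => C * (`|q t| + Z * `|rho t|)))).
    apply: norm_int_le_int.
    - by apply: igS (AC_ig A1).
    - by apply: (@igS _ 0 T) => //; apply: igZ; apply: igD => //; apply: igZ; exact: bm_ig.
    move=> t /andP[t0 tx]; rewrite mulr0 subr0 normrM mulrC ler_pM//.
      by apply: PC => //; rewrite ltW//= (le_trans tx xT).
    apply: le_trans (ler_normB _ _) _; rewrite lerD2l normrM ler_wpM2r//.
  have Ci : ig 0 T (fun t => C * (`|q t| + Z * `|rho t|)).
    by apply: igZ; apply: igD => //; apply: igZ; exact: bm_ig.
  apply: (@le_trans _ _ (int 0 T (fun t => C * (`|q t| + Z * `|rho t|)))).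
    rewrite (@int_chasles _ 0 x T) ?xT ?(ltW x0)// lerDl; apply: int_ge0 => t _.
    by rewrite mulr_ge0// addr_ge0// mulr_ge0.
  rewrite intZ; last by apply: igD => //; apply: igZ; exact: bm_ig.
  by rewrite intD// ?intZ//; [exact: bm_ig|apply: igZ; exact: bm_ig].
pose x0 := Num.min T (2 * (D + 1))^-1.
have x00 : 0 < x0 by rewrite lt_min T0 invr_gt0 mulr_gt0//; lra.
have x0T : x0 <= T by rewrite ge_min lexx.
have x0D : D * x0 <= 2^-1.
  apply: (@le_trans _ _ (D * (2 * (D + 1))^-1)).
    by rewrite ler_wpM2l// ge_min lexx orbT.
  by rewrite ler_pdivrMr ?mulr_gt0//; lra.
exists (rmin / 4 * x0); first by rewrite mulr_gt0// divr_gt0.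
move=> z zZ; have [_ A _] := Phis z.
have half x : 0 < x <= x0 -> 2^-1 <= Phi z x.
  move=> /andP[xp xx0].
  have : `|int 0 x (Phi1 z)| <= D * (x - 0).
    apply: norm_int_le; rewrite ?(ltW xp)//.
    - by apply: igS (AC_ig A) => //; exact: le_trans xx0 x0T.
    - by move=> t /andP[t0 tx]; apply: P1D => //; rewrite t0 (le_trans tx (le_trans xx0 x0T)).
  rewrite subr0 ler_norml => /andP[h _].
  rewrite (A.2 x) ?Phi0; last by rewrite ltW//= (le_trans xx0).
  have : D * x <= D * x0 by rewrite ler_wpM2l.
  lra.
have Pb := Phi_bm z.
have Pi : ig 0 T (fun t => rho t * Phi z t * Phi z t) by apply: bm_ig; bm_tac.
rewrite /ip /wip (@int_chasles _ 0 x0 T) ?x0T ?(ltW x00)//.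
rewrite -[leLHS]addr0; apply: lerD; last first.
  apply: int_ge0 => t /andP[t0 tT]; rewrite -mulrA mulr_ge0 -?expr2 ?sqr_ge0//.
  by apply: le_trans (rho_ge _); [exact: ltW|rewrite (lt_trans x00 t0)].
rewrite -[x0 in leLHS]subr0 -int_cst ?(ltW x00)//.
apply: le_int; [exact: bm_ig (bm_cst _ _ _)|exact: igS Pi|].
move=> t tx; have h := half t tx; rewrite -mulrA.
apply: ler_pM => //; [exact: ltW| |].
  by apply: rho_ge; case/andP: tx => -> /= tx; exact: le_trans x0T.
have -> : 4^-1 = 2^-1 * 2^-1 :> R by field.
exact: ler_pM.
Qed.

Lemma Phi_norm_gt0 z : 0 < ip (Phi z) (Phi z).
Proof.
by have [c c0 Hc] := Phi_norm_ge `|z|; apply: lt_le_trans c0 (Hc z (lexx _)).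
Qed.

Lemma Phi_orthogonal z w : Phi z T = 0 -> Phi w T = 0 -> z != w -> ip (Phi z) (Phi w) = 0.
Proof.
move=> zT wT zw; have := lagrange T0 rhob (Phis z) (Phis w).
rewrite zT wT Phi10 Phi10 (ipC T rho (Phi z) (fun=> 0)) !ip0l !(mul0r, mulr0, subrr, subr0, addr0).
by move=> /esym/eqP; rewrite mulf_eq0 subr_eq0 (negbTE zw)/= => /eqP.
Qed.

Lemma Phi_lipschitz (Z : R) : exists2 C : R, 0 <= C & forall z w, `|z| <= Z -> `|w| <= Z ->
  forall x, 0 <= x <= T -> `|Phi z x - Phi w x| <= C * `|z - w|.
Proof.
have [C C0 HC] := sol_lipschitz T0 qi q2i rhob Z 1 0 (bm_cst 0 T 0).
by exists C => // z w zZ wZ; apply: HC.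
Qed.

(** For distinct eigenvalues z and w, orthogonality gives |Phi z|^2 = <Phi z - Phi w, Phi z>, which
    is at most a constant times |z - w|. With the uniform lower bound on the norms, the eigenvalues
    in a bounded set are uniformly separated. *)
Lemma spectrum_finite (Z X : R) : (forall z, z <= - Z -> Phi z T <> 0) ->
  exists2 E : seq R, uniq E & forall z, (z \in E) <-> (Phi z T = 0 /\ z < X).
Proof.
move=> HZ.
pose A := [set z | Phi z T = 0 /\ z < X].
suff /finite_seqP[s As] : finite_set A.
  exists (undup s); first exact: undup_uniq.
  move=> z; rewrite mem_undup; have : A z <-> [set` s] z by rewrite As.
  by move=> [h1 h2]; split; [exact: h2|exact: h1].
pose Y := Num.max `|Z| `|X|.
have [C C0 HC] := Phi_lipschitz Y.
have [B B0 HB] := sol_bound T0 qi q2i rhob Y.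
have [c c0 Hc] := Phi_norm_ge Y.
set N := int 0 T (fun t => `|rho t * B|).
have N0 : 0 <= N by apply: int_ge0.
have NC : 0 < N * C + 1 by rewrite ltr_wpDl// mulr_ge0.
have AY z : A z -> `|z| <= Y.
  move=> [z0 zX]; have [h|h] := leP z (- Z); first by have := HZ z h.
  rewrite ler_norml; apply/andP; split.
    apply: (@le_trans _ _ (- `|Z|)); first by rewrite lerN2 le_max lexx.
    by apply: le_trans (ltW h); rewrite lerN2 ler_norm.
  by apply: (le_trans (ltW zX)); rewrite (le_trans (ler_norm X))// le_max lexx orbT.
have PB z x : A z -> 0 < x <= T -> `|Phi z x| <= B.
  move=> Az /andP[x0 xT]; have := HB _ _ _ _ (AY z Az) (Phis z) x; rewrite (ltW x0) xT.
  rewrite Phi0 Phi10 normr1 normr0 addr0.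
  rewrite (_ : int 0 T _ = 0); first by rewrite addr0 mulr1; apply.
  by rewrite -[RHS](int0 0 T); apply: eq_int => t _; rewrite mulr0 normr0.
apply: (@separated_finite _ A (- Y) Y (c / (N * C + 1))).
- by rewrite divr_gt0.
- by move=> z /AY; rewrite ler_norml.
move=> z w Az Aw zw; rewrite ler_pdivrMr//.
have zb := Phi_bm z; have wb := Phi_bm w.
apply: le_trans (Hc z (AY z Az)) _.
have -> : ip (Phi z) (Phi z) = `|ip (Phi z) (Phi z) - ip (Phi w) (Phi z)|.
  rewrite (@Phi_orthogonal w z) ?subr0 ?(eq_sym w z)//; [|exact: Aw.1|exact: Az.1].
  by rewrite gtr0_norm// Phi_norm_gt0.
have := @ip_diff_le _ T rho rhob (Phi z) (Phi w) (Phi z) (C * `|z - w|) zb wb zb.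
move=> h; apply: le_trans (h _) _.
  by move=> x /andP[x0 xT]; apply: HC; rewrite ?AY ?(ltW x0).
rewrite mulrA mulrC; apply: ler_wpM2l => //.
apply: (@le_trans _ _ (N * C)); last by rewrite lerDl.
apply: ler_wpM2r => //; apply: le_int.
- by apply: bm_ig; bm_tac.
- by apply: bm_ig; bm_tac.
- by move=> t tT; rewrite !normrM ler_wpM2l// (ger0_norm B0) PB.
Qed.

Lemma weyl_exists z : Phi z T <> 0 -> exists g g1,
  [/\ sol z (fun=> 0) g g1, g T = 0 & g1 0 = -1].
Proof.
move=> /eqP zT; have [s [s1 [ss s0 s10]]] := sol_exists T0 qi q2i rhob z 0 1 (bm_cst 0 T 0).
have := solD (solZ (s T / Phi z T) (Phis z)) (solZ (-1) ss).
move=> /(sol_eq (g := fun=> 0)) H.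
eexists; eexists; split.
- by apply: H => x _; rewrite !mulr0 addr0.
- by rewrite /= divfK// mulN1r subrr.
- by rewrite /= Phi10 s10 mulr0 add0r mulr1.
Qed.

(** The energy of an eigenfunction over [0, T] is a boundary term and vanishes; coercivity for very
    negative z then annihilates the integrals of Phi ^ 2 and Phi1 ^ 2, against Phi(0) = 1. *)
Lemma spectrum_bounded_below : exists2 Z : R, 0 <= Z & forall z, z <= - Z -> Phi z T <> 0.
Proof.
have [C C0 HC] := energy_coercive qi rhob rho_ge (lexx 0) T0 (lexx T).
exists ((C + 1) / rmin); first by rewrite divr_ge0 ?addr_ge0// ltW.
move=> z zZ zT.
have z0 : z <= 0.
  apply: le_trans zZ _; rewrite oppr_le0 divr_ge0 ?addr_ge0// ltW//.
have zr : C + 1 <= - z * rmin by rewrite -ler_pdivrMr//; lra.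
have [_ A A1] := Phis z; have [Pb P1b] := sol_bm T0 (Phis z).
have := HC z _ _ z0 A P1b.
rewrite -(energy_identity T0 (lexx 0) (ltW T0) (lexx T) (Phis z)) zT Phi10 mul0r mulr0 subrr.
have := sup_sq_le T0 ltr01 A P1b (x := 0); rewrite lexx (ltW T0) Phi0 => /(_ isT).
rewrite expr1n invr1 mul1r.
have i1 : 0 <= int 0 T (fun t => Phi1 z t ^+ 2) by apply: int_ge0 => *; exact: sqr_ge0.
have i2 : 0 <= int 0 T (fun t => Phi z t ^+ 2) by apply: int_ge0 => *; exact: sqr_ge0.
move: i1 i2; set I1 := int 0 T _; set I2 := int 0 T _ => i1 i2 h1 h2.
have h3 : I2 <= (- z * rmin - C) * I2 by rewrite ler_peMl//; lra.
have I20 : I2 = 0 by lra.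
have I10 : I1 = 0 by lra.
by move: h1; rewrite I20 I10 mulr0 addr0 ler10.
Qed.

(** With g(T) = 0 and g'(0) = - 1 the energy is g(0) itself. [sup_sq_le] bounds g(0) ^ 2 by 2 d
    times the energy as soon as - z rmin - C >= B, where 2 d B = 1 / T + 1 / d; hence g(0) ^ 2 <= 2
    d g(0) with 2 d = e. *)
Lemma weyl_small (e : R) : 0 < e -> exists Z : R, forall z g g1, z <= - Z ->
  sol z (fun=> 0) g g1 -> g T = 0 -> g1 0 = -1 -> `|g 0| <= e.
Proof.
move=> e0; have [C C0 HC] := energy_coercive qi rhob rho_ge (lexx 0) T0 (lexx T).
pose d := e / 2; have d0 : 0 < d by rewrite divr_gt0.
pose B := (T^-1 + d^-1) / (2 * d).
have B0 : 0 <= B.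
  by rewrite divr_ge0 ?addr_ge0 ?invr_ge0 ?mulr_ge0//; apply: ltW.
exists ((C + B) / rmin) => z g g1 zZ gs gT g10.
have z0 : z <= 0.
  by apply: le_trans zZ _; rewrite oppr_le0 divr_ge0 ?addr_ge0//; apply: ltW.
have zr : C + B <= - z * rmin by rewrite -ler_pdivrMr//; lra.
have [gb g1b] := sol_bm T0 gs; have [_ A A1] := gs.
have := HC z _ _ z0 A g1b.
rewrite -(energy_identity T0 (lexx 0) (ltW T0) (lexx T) gs) gT g10 mul0r mulrN1 sub0r opprK.
have := sup_sq_le T0 d0 A g1b (x := 0); rewrite lexx (ltW T0) subr0 => /(_ isT).
have i1 : 0 <= int 0 T (fun t => g1 t ^+ 2) by apply: int_ge0 => *; exact: sqr_ge0.
have i2 : 0 <= int 0 T (fun t => g t ^+ 2) by apply: int_ge0 => *; exact: sqr_ge0.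
move: i1 i2; set I1 := int 0 T _; set I2 := int 0 T _ => i1 i2 h1 h2.
have h3 : B * I2 <= (- z * rmin - C) * I2 by rewrite ler_wpM2r//; lra.
have h4 : B * I2 * (2 * d) = (T^-1 + d^-1) * I2.
  by rewrite /B; field; rewrite !gt_eqF.
have h5 : 0 <= B * I2 by rewrite mulr_ge0.
have g00 : 0 <= g 0 by lra.
have h6 : g 0 ^+ 2 <= 2 * d * g 0.
  apply: le_trans h1 _; rewrite -h4.
  have h7 : I1 / 2 + B * I2 <= g 0 by lra.
  by have := ler_wpM2l (ltW d0) h7; lra.
rewrite ger0_norm//; have [->|gn0] := eqVneq (g 0) 0; first exact: ltW.
have gp : 0 < g 0 by rewrite lt_neqAle eq_sym gn0.
by move: h6; rewrite expr2 ler_pM2r// /d; lra.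
Qed.

End spectrum.

(** * The spectral data determine the Weyl function *)

(** Differentiability by factorisation: the difference quotient at x is k, continuous at x. The
    identities obtained from [lagrange] come in this form. *)
Lemma is_derive_cvg (R : realType) (h k : R -> R) (x : R) :
  (\forall z \near x, h z - h x = (z - x) * k z) -> {for x, continuous k} ->
  is_derive x 1 h (k x).
Proof.
move=> hk kc.
have H : (fun t : R => t^-1 *: (h (t *: 1 + x) - h x)) @ 0^' --> k x.
  have c : (fun t : R => t + x) @ (0 : R) --> x.
    rewrite -[X in _ --> X]add0r.
    by apply: cvgD; [exact: cvg_id|exact: cvg_cst].
  have k0 : (fun t : R => k (t + x)) @ 0^' --> k x.
    apply: cvg_within_filter; apply: (@cvg_comp _ _ _ (fun t : R => t + x) k); [exact: c|exact: kc].
  apply: cvg_trans k0; apply: near_eq_cvg.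
  have hk' : \forall t \near (0 : R)^', h (t + x) - h x = (t + x - x) * k (t + x).
    apply: nbhs_dnbhs; exact: (c _ hk).
  near=> t.
  have t0 : t != 0 by near: t; exact: nbhs_dnbhs_neq.
  rewrite /GRing.scale/= mulr1 (_ : h (t + x) - h x = t * k (t + x)).
    by rewrite mulKf.
  by rewrite -[X in X * _](addrK x t); near: t.
split; first by apply/cvg_ex; exists (k x).
exact/cvg_lim.
Unshelve. all: by end_near.
Qed.

Section resolvent.
Context {R : realType}.
Variables (T : R) (q rho : R -> R) (rmin : R).
Hypotheses (T0 : 0 < T) (qi : ig 0 T q) (q2i : ig 0 T (fun x => q x ^+ 2)).
Hypotheses (rhob : bm 0 T rho) (rmin0 : 0 < rmin).
Hypothesis rho_ge : forall x, 0 < x <= T -> rmin <= rho x.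
Variables Phi Phi1 : R -> R -> R.
Hypothesis Phis : forall z, sol T q rho z (fun=> 0) (Phi z) (Phi1 z).
Hypothesis Phi0 : forall z, Phi z 0 = 1.
Hypothesis Phi10 : forall z, Phi1 z 0 = 0.
Implicit Types (z w : R) (u v f g y : R -> R).
Let sol := sol T q rho.
Local Notation ip := (wip T rho).
Local Notation alpha z := (ip (Phi z) (Phi z)).

Let alpha_gt0 z : 0 < alpha z.
Proof. exact: (Phi_norm_gt0 T0 qi q2i rhob rmin0 rho_ge Phis Phi0 Phi10). Qed.

(** The Wronskian with the solution s, s(0) = 0 and s'(0) = 1, is constant and equals 1 at 0. *)
Lemma Phi1_neq0 z : Phi z T = 0 -> Phi1 z T != 0.
Proof.
move=> zT; apply/eqP => z1T.
have [s [s1 [ss s0 s10]]] := sol_exists T0 qi q2i rhob z 0 1 (bm_cst 0 T 0).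
have := lagrange T0 rhob (Phis z) ss.
rewrite zT z1T Phi0 Phi10 s0 s10 (ipC T rho (Phi z) (fun=> 0)) !ip0l subrr.
by move=> /eqP; rewrite !(mul0r, mulr0, subr0, addr0, mulr1) sub0r oppr_eq0 oner_eq0.
Qed.

(** The pairing of a Weyl solution with an eigenfunction involves only z and w. Together with the
    norming constants it gives all Fourier coefficients of g, which is how the spectral data
    enter. *)
Lemma weyl_pairing w g g1 z : sol w (fun=> 0) g g1 -> g T = 0 -> g1 0 = -1 ->
  Phi z T = 0 -> (z - w) * ip (Phi z) g = 1.
Proof.
move=> gs gT g10 zT; have := lagrange T0 rhob (Phis z) gs.
rewrite zT gT Phi0 Phi10 g10 (ipC T rho (Phi z) (fun=> 0)) !ip0l.
by rewrite !(mul0r, mulr0, subr0, addr0, mulr1, sub0r, mul1r, oppr0, add0r) opprK; move/esym.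
Qed.

Variables (X : R) (E : seq R) (z0 : R) (g0 g01 : R -> R).
Hypothesis Euniq : uniq E.
Hypothesis Espec : forall z, (z \in E) <-> (Phi z T = 0 /\ z < X).
Hypothesis z0T : Phi z0 T <> 0.
Hypotheses (g0s : sol z0 (fun=> 0) g0 g01) (g0T : g0 T = 0) (g010 : g01 0 = -1).

(** The Fourier coefficient <Phi z, g0> / |Phi z|^2, evaluated by [weyl_pairing]. *)
Let c z := (alpha z * (z - z0))^-1.
Let f t := g0 t - \sum_(m <- E) c m * Phi m t.

Let E0 z : z \in E -> Phi z T = 0. Proof. by move=> /Espec[]. Qed.
Let Ez0 z : z \in E -> z - z0 != 0.
Proof. by move=> /E0 zT; rewrite subr_eq0; apply/eqP => h; apply: z0T; rewrite -h. Qed.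
Let Pb := Phi_bm T0 Phis.
Let g0b : bm 0 T g0. Proof. by have [] := sol_bm T0 g0s. Qed.
Let cPb m : bm 0 T (fun t => c m * Phi m t). Proof. exact: bmZ. Qed.
Let Sb : bm 0 T (fun t => \sum_(m <- E) c m * Phi m t).
Proof. exact: bm_sum. Qed.
Let fb : bm 0 T f. Proof. exact: bmB. Qed.

Let ipf u : bm 0 T u -> ip f u = ip g0 u - \sum_(m <- E) c m * ip (Phi m) u.
Proof.
move=> ub; rewrite ipBl//; congr (_ - _).
by rewrite ip_suml//; apply: eq_bigr => m _; rewrite ipZl.
Qed.

Let f_orth m : m \in E -> ip f (Phi m) = 0.
Proof.
move=> mE; rewrite ipf// (bigD1_seq m)//= big1_seq ?addr0.
  have := weyl_pairing g0s g0T g010 (E0 mE); rewrite ipC => h.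
  have a0 : alpha m != 0 by rewrite gt_eqF.
  have -> : c m * wip T rho (Phi m) (Phi m) = (m - z0)^-1.
    by rewrite /c invfM mulrAC mulVf ?mul1r.
  apply/eqP; rewrite subr_eq0; apply/eqP; apply: (mulfI (Ez0 mE)).
  by rewrite ipC -ipC h mulfV// Ez0.
move=> n /andP[nm nE]; rewrite (@Phi_orthogonal _ T q rho T0 rhob Phi Phi1)// ?mulr0//; exact: E0.
Qed.

Let Yexists z : exists Y : (R -> R) * (R -> R),
  [/\ sol z f Y.1 Y.2, Y.1 0 = 0 & Y.2 0 = 0].
Proof.
have [y [y1 [ys y0 y10]]] := sol_exists T0 qi q2i rhob z 0 0 fb.
by exists (y, y1).
Qed.

Let Y z := (projT1 (cid (Yexists z))).1.
Let Y1 z := (projT1 (cid (Yexists z))).2.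
Let Ys z : sol z f (Y z) (Y1 z). Proof. by rewrite /Y /Y1; case: cid => y []. Qed.
Let Y0 z : Y z 0 = 0. Proof. by rewrite /Y; case: cid => y []. Qed.
Let Y10 z : Y1 z 0 = 0. Proof. by rewrite /Y1; case: cid => y []. Qed.
Let Yb z : bm 0 T (Y z). Proof. by have [] := sol_bm T0 (Ys z). Qed.

(* Solvability at an eigenvalue below X: f is orthogonal to the eigenfunction. *)
Let YT z : z < X -> Phi z T = 0 -> Y z T = 0.
Proof.
move=> zX zT; have := lagrange T0 rhob (Ys z) (Phis z).
rewrite zT Y0 Y10 subrr (ipC T rho (Y z) (fun=> 0)) ip0l f_orth; last exact/Espec.
rewrite !(mul0r, mulr0, subrr, subr0, addr0) => /eqP.
by rewrite mulf_eq0 (negbTE (Phi1_neq0 zT)) orbF => /eqP.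
Qed.

(** U z = Y z + beta z Phi z has to vanish at T. Off the spectrum this determines beta. At an
    eigenvalue below X every beta works, and the chosen one makes U z orthogonal to [Phi z], which
    keeps beta continuous across the eigenvalue. *)
Let beta z := if Phi z T == 0 then - ip (Y z) (Phi z) / alpha z else - Y z T / Phi z T.
Let U z t := Y z t + beta z * Phi z t.
Let U1 z t := Y1 z t + beta z * Phi1 z t.

Let Us z : sol z f (U z) (U1 z).
Proof.
have := solD (Ys z) (solZ (beta z) (Phis z)).
by apply: sol_eq => x _; rewrite mulr0 addr0.
Qed.

Let Ub z : bm 0 T (U z). Proof. by have [] := sol_bm T0 (Us z). Qed.

Let U10 z : U1 z 0 = 0. Proof. by rewrite /U1 Y10 Phi10 mulr0 addr0. Qed.

Let betaT z : z < X -> beta z * Phi z T = - Y z T.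
Proof.
move=> zX; rewrite /beta; case: eqP => [zT|/eqP zT]; last by rewrite divfK.
by rewrite zT mulr0 YT// oppr0.
Qed.

Let UT z : z < X -> U z T = 0.
Proof. by move=> zX; rewrite /U betaT// subrr. Qed.

Let U_orth z m : z < X -> m \in E -> ip (U z) (Phi m) = 0.
Proof.
move=> zX mE; have [->|zm] := eqVneq z m.
  rewrite /U ipDl ?ipZl//; last exact: bmZ.
  rewrite /beta E0// eqxx divfK ?subrr//.
  by rewrite gt_eqF.
have := lagrange T0 rhob (Us z) (Phis m).
rewrite UT// (E0 mE) U10 Phi10 (ipC T rho (U z) (fun=> 0)) ip0l f_orth//.
rewrite !(mul0r, mulr0, subrr, subr0, addr0) => /esym/eqP.
by rewrite mulf_eq0 subr_eq0 (negbTE zm)/= => /eqP.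
Qed.

Let h z := ip (U z) f.

Let h_diff z w : z < X -> w < X -> h z - h w = (z - w) * ip (U z) (U w).
Proof.
move=> zX wX; have := lagrange T0 rhob (Us z) (Us w).
rewrite !UT// !U10 (ipC T rho f (U w)) /h; set A := ip _ _; set B := ip _ _; set C := ip _ _.
by move=> H; lra.
Qed.

Let wip_continuous (F : R -> R -> R) (F1 : R -> R -> R) k (y0 y10 : R) v :
  bm 0 T k -> bm 0 T v -> (forall z, sol z k (F z) (F1 z)) -> (forall z, F z 0 = y0) ->
  (forall z, F1 z 0 = y10) ->
  continuous (fun z => ip (F z) v) /\ continuous (fun z => F z T).
Proof.
move=> kb vb Fs F0 F10; split; apply: lipschitz_continuous => Z;
  have [C C0 HC] := sol_lipschitz T0 qi q2i rhob Z y0 y10 kb.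
  exists (int 0 T (fun t => `|rho t * v t|) * C) => z w zZ wZ.
  have [Fzb _] := sol_bm T0 (Fs z); have [Fwb _] := sol_bm T0 (Fs w).
  have H := @ip_diff_le _ T rho rhob (F z) (F w) v (C * `|z - w|) Fzb Fwb vb.
  rewrite -mulrA; apply: H => x /andP[x0 xT].
  by apply: (HC _ _ _ _ _ _ zZ wZ (Fs z) (Fs w)) => //; rewrite ltW.
exists C => z w zZ wZ.
by apply: (HC _ _ _ _ _ _ zZ wZ (Fs z) (Fs w)) => //; rewrite ltW//=.
Qed.

Let Yc v : bm 0 T v -> continuous (fun z => ip (Y z) v) /\ continuous (fun z => Y z T).
Proof. by move=> vb; apply: wip_continuous Ys Y0 Y10. Qed.

Let Phic v : bm 0 T v -> continuous (fun z => ip (Phi z) v) /\ continuous (fun z => Phi z T).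
Proof. by move=> vb; apply: wip_continuous Phis Phi0 Phi10 => //; exact: bm_cst. Qed.

Let quotient_continuous (A B : R -> R) z : z < X -> (forall w, w < X -> beta w * A w = B w) ->
  continuous A -> continuous B -> A z != 0 -> {for z, continuous beta}.
Proof.
move=> zX AB cA cB Az.
have cq : {for z, continuous (fun w => B w / A w)}.
  by apply: cvgM; [exact: cB|apply: cvgV => //; exact: cA].
rewrite /prop_for /continuous_at -(mulfK Az (beta z)) AB//.
apply: cvg_trans cq; apply: near_eq_cvg; near=> w.
have wX : w < X by near: w; exact: lt_nbhsl.
have Aw : A w != 0.
  by near: w; apply: (cvgr_neq0 _ (cA z)).
by rewrite -AB// mulfK.
Unshelve. all: by end_near.
Qed.

(** At an eigenvalue the relation beta w Phi w T = - Y w T degenerates to 0 = 0. Orthogonality of U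
    w to the eigenfunction gives a second relation, beta w <Phi w, Phi z> = - <Y w, Phi z>, whose
    coefficient does not vanish at w = z. *)
Let beta_continuous z : z < X -> {for z, continuous beta}.
Proof.
move=> zX; have [zT|zT] := eqVneq (Phi z T) 0; last first.
  apply: (@quotient_continuous (fun w => Phi w T) (fun w => - Y w T)) => //.
  - by have [] := Phic (bm_cst 0 T 0).
  - by move=> w; apply: cvgN; have [_] := Yc (bm_cst 0 T 0); apply.
have zE : z \in E by exact/Espec.
apply: (@quotient_continuous (fun w => ip (Phi w) (Phi z)) (fun w => - ip (Y w) (Phi z))) => //.
- move=> w wX; have := U_orth wX zE; rewrite /U ipDl ?ipZl//; last exact: bmZ.
  by move=> /eqP; rewrite addrC addr_eq0 => /eqP.
- by have [] := Phic (Pb z).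
- by move=> w; apply: cvgN; have [+ _] := Yc (Pb z); apply.
- by rewrite gt_eqF.
Qed.

Let h_derive z : z < X -> is_derive z 1 h (ip (U z) (U z)).
Proof.
move=> zX; apply: (@is_derive_cvg _ h (fun w => ip (U w) (U z))).
  near=> w; rewrite h_diff//.
  by near: w; exact: lt_nbhsl.
have -> : (fun w => ip (U w) (U z)) =
    (fun w => ip (Y w) (U z) + beta w * ip (Phi w) (U z)).
  by apply/funext => w; rewrite {1}/U ipDl ?ipZl//; exact: bmZ.
apply: cvgD; first by have [+ _] := Yc (Ub z); apply.
apply: cvgM; first exact: beta_continuous.
by have [+ _] := Phic (Ub z); apply.
Unshelve. all: by end_near.
Qed.

(** Bessel's inequality. It replaces |f|^2 in the Riccati bound by |g0|^2, which does not change
    when X and E grow. *)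
Let ipff : ip f f <= ip g0 g0.
Proof.
have e1 : ip f f = ip f g0.
  rewrite ipf// big1_seq ?subr0; first exact: ipC.
  by move=> m /= mE; rewrite ipC f_orth ?mulr0.
rewrite e1 ipf// gerBl big_seq sumr_ge0// => m mE.
have := weyl_pairing g0s g0T g010 (E0 mE) => H.
have -> : ip (Phi m) g0 = (m - z0)^-1.
  by apply: (mulfI (Ez0 mE)); rewrite H mulfV// Ez0.
have -> : c m * (m - z0)^-1 = (alpha m)^-1 * ((m - z0)^-1) ^+ 2.
  by rewrite /c invfM expr2 mulrA.
by rewrite mulr_ge0 ?sqr_ge0// invr_ge0 ltW.
Qed.

(** H is <U z, f>, which equals <U z, g0> because U z is orthogonal to the eigenfunctions in E.
    Pairing U z with g0 and with g computes U z 0 in two ways, whence (z - z0) H = <f, g> - <f, g0>;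
    expanding f leaves pairings known from [weyl_pairing]. Apart from |g0|^2 and the values of M,
    the right-hand side consists of spectral data, and H tends to 0 as X grows. *)
Lemma weyl_expansion z g g1 : z < X -> Phi z T <> 0 ->
  sol z (fun=> 0) g g1 -> g T = 0 -> g1 0 = -1 ->
  exists2 H : R, 0 <= H <= ip g0 g0 / (X - z) &
  (z - z0) ^+ 2 * H = g 0 - g0 0 - (z - z0) * ip g0 g0 -
    (z - z0) * \sum_(m <- E) ((alpha m * (m - z0) * (m - z))^-1 - (alpha m * (m - z0) ^+ 2)^-1).
Proof.
move=> zX zT gs gT g10; exists (h z).
  have hb : 0 <= h z <= ip f f / (X - z).
    apply: (@riccati_bound _ h (fun z => ip (U z) (U z))) => //.
    - exact: ip_ge0 rho_ge _.
    - move=> w wX; rewrite mulrC; exact: (cauchy_schwarz rhob rmin0 rho_ge).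
    - by move=> w _; exact: ip_ge0 rho_ge _.
  case/andP: hb => -> /= hb; apply: le_trans hb _.
  by rewrite ler_pM2r// invr_gt0 subr_gt0.
have gb : bm 0 T g by have [] := sol_bm T0 gs.
have hE : h z = ip (U z) g0.
  rewrite /h ipC ipBl// ip_suml// big1_seq ?subr0; first by rewrite ipC.
  by move=> m /= mE; rewrite ipZl// (ipC T rho) U_orth ?mulr0.
have l1 : U z 0 = (z - z0) * ip (U z) g0 + ip f g0.
  have := lagrange T0 rhob (Us z) g0s.
  rewrite UT// g0T U10 g010 (ipC T rho (U z) (fun=> 0)) ip0l.
  by move=> H; lra.
have l2 : U z 0 = ip f g.
  have := lagrange T0 rhob (Us z) gs.
  rewrite UT// gT U10 g10 (ipC T rho (U z) (fun=> 0)) ip0l.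
  by move=> H; lra.
have l3 : g 0 - g0 0 = (z - z0) * ip g0 g.
  have := lagrange T0 rhob gs g0s.
  rewrite gT g0T g10 g010 (ipC T rho g (fun=> 0)) !ip0l (ipC T rho g).
  by move=> H; lra.
have Ezz m : m \in E -> m - z != 0.
  by move=> /E0 mT; rewrite subr_eq0; apply/eqP => e; apply: zT; rewrite -e.
have -> : (z - z0) ^+ 2 * h z = (z - z0) * (ip f g - ip f g0).
  by rewrite -l2 l1 hE; ring.
rewrite l3 -mulrBr -mulrBr; congr (_ * _).
rewrite !ipf//.
suff -> : \sum_(m <- E) ((alpha m * (m - z0) * (m - z))^-1 - (alpha m * (m - z0) ^+ 2)^-1) =
    \sum_(m <- E) c m * ip (Phi m) g - \sum_(m <- E) c m * ip (Phi m) g0.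
  by set A := \sum_(_ <- _) _; set B := \sum_(_ <- _) _; ring.
rewrite sumrB; congr (_ - _); rewrite big_seq [RHS]big_seq; apply: eq_bigr => m mE.
  have H := weyl_pairing gs gT g10 (E0 mE).
  have -> : ip (Phi m) g = (m - z)^-1.
    by apply: (mulfI (Ezz m mE)); rewrite H mulfV// Ezz.
  by rewrite /c [in LHS]invfM.
have H := weyl_pairing g0s g0T g010 (E0 mE).
have -> : ip (Phi m) g0 = (m - z0)^-1.
  by apply: (mulfI (Ez0 mE)); rewrite H mulfV// Ez0.
by rewrite /c expr2 mulrA [in LHS]invfM.
Qed.

End resolvent.

Section weyl_uniqueness.
Context {R : realType}.
Variables (T : R) (q qt rho : R -> R) (rmin : R).
Hypotheses (T0 : 0 < T) (qi : ig 0 T q) (q2i : ig 0 T (fun x => q x ^+ 2)).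
Hypotheses (qti : ig 0 T qt) (qt2i : ig 0 T (fun x => qt x ^+ 2)).
Hypotheses (rhob : bm 0 T rho) (rmin0 : 0 < rmin).
Hypothesis rho_ge : forall x, 0 < x <= T -> rmin <= rho x.
Variables Phi Phi1 Phit Phit1 : R -> R -> R.
Hypothesis Phis : forall z, sol T q rho z (fun=> 0) (Phi z) (Phi1 z).
Hypothesis Phi0 : forall z, Phi z 0 = 1.
Hypothesis Phi10 : forall z, Phi1 z 0 = 0.
Hypothesis Phits : forall z, sol T qt rho z (fun=> 0) (Phit z) (Phit1 z).
Hypothesis Phit0 : forall z, Phit z 0 = 1.
Hypothesis Phit10 : forall z, Phit1 z 0 = 0.
Hypothesis specE : forall z, Phi z T = 0 <-> Phit z T = 0.
Hypothesis normE : forall z, Phi z T = 0 ->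
  wip T rho (Phi z) (Phi z) = wip T rho (Phit z) (Phit z).

Lemma weyl_unique : exists Z : R, forall z, z <= - Z -> exists g g1 gt gt1,
  [/\ sol T q rho z (fun=> 0) g g1, sol T qt rho z (fun=> 0) gt gt1, 
      [/\ g T = 0, g1 0 = -1, gt T = 0 & gt1 0 = -1] & g 0 = gt 0].
Proof.
have [Z Z0 HZ] := spectrum_bounded_below T0 qi rhob rmin0 rho_ge Phis Phi0 Phi10.
have HZt z : z <= - Z -> Phit z T <> 0 by move=> /HZ h /specE.
have G z : exists g : ((R -> R) * (R -> R)) * ((R -> R) * (R -> R)), z <= - Z ->
  [/\ sol T q rho z (fun=> 0) g.1.1 g.1.2, sol T qt rho z (fun=> 0) g.2.1 g.2.2,
      g.1.1 T = 0 /\ g.1.2 0 = -1 & g.2.1 T = 0 /\ g.2.2 0 = -1].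
  have [zZ|zZ] := leP z (- Z); last by exists ((id, id), (id, id)) => h; lra.
  have [g [g1 [gs gT g10]]] := weyl_exists T0 qi q2i rhob Phis Phi10 (HZ z zZ).
  have [k [k1 [ks kT k10]]] := weyl_exists T0 qti qt2i rhob Phits Phit10 (HZt z zZ).
  by exists ((g, g1), (k, k1)).
have {G} [G HG] := choice G.
pose F z := (G z).1.1 0 - (G z).2.1 0.
have affine z0 : z0 <= - Z -> exists B : R, forall z, z <= - Z -> F z = F z0 + (z - z0) * B.
  move=> z0Z; have [gs0 ks0 [gT0 g10_0] [kT0 k10_0]] := HG z0 z0Z.
  pose K := wip T rho (G z0).1.1 (G z0).1.1; pose Kt := wip T rho (G z0).2.1 (G z0).2.1.
  have K0 : 0 <= K by exact: ip_ge0 rho_ge _.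
  have Kt0 : 0 <= Kt by exact: ip_ge0 rho_ge _.
  exists (K - Kt) => z zZ; have [gs ks [gT g10] [kT k10]] := HG z zZ.
  apply/eqP; rewrite -subr_eq0 -normr_le0; apply/ler_addgt0Pr => e e0; rewrite add0r.
  pose D := (z - z0) ^+ 2 * (K + Kt).
  have D0 : 0 <= D by rewrite mulr_ge0 ?sqr_ge0 ?addr_ge0.
  (* Large enough for the remainder bound (z - z0)^2 (K + Kt) / (X - z) to be at most e. One list E
     serves both problems because their spectra agree. *)
  pose X := 1 + D / e.
  have X0 : 1 <= X by rewrite lerDl divr_ge0// ltW.
  have Xz : D / e <= X - z by rewrite /X; lra.
  have zX : z < X by lra.
  have Xz0 : 0 < X - z by rewrite subr_gt0.
  have [E Eu HE] := spectrum_finite T0 qi q2i rhob rmin0 rho_ge Phis Phi0 Phi10 X HZ.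
  have HEt w : (w \in E) <-> (Phit w T = 0 /\ w < X).
    by rewrite HE; split => -[/specE].
  have [H /andP[H0 HK] HH] := weyl_expansion T0 qi q2i rhob rmin0 rho_ge Phis Phi0 Phi10
    Eu HE (HZ _ z0Z) gs0 gT0 g10_0 zX (HZ _ zZ) gs gT g10.
  have [Ht /andP[Ht0 HtK] HHt] := weyl_expansion T0 qti qt2i rhob rmin0 rho_ge Phits Phit0 Phit10
    Eu HEt (HZt _ z0Z) ks0 kT0 k10_0 zX (HZt _ zZ) ks kT k10.
  have SE : \sum_(m <- E) ((wip T rho (Phi m) (Phi m) * (m - z0) * (m - z))^-1 -
        (wip T rho (Phi m) (Phi m) * (m - z0) ^+ 2)^-1) =
      \sum_(m <- E) ((wip T rho (Phit m) (Phit m) * (m - z0) * (m - z))^-1 -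
        (wip T rho (Phit m) (Phit m) * (m - z0) ^+ 2)^-1).
    by rewrite !big_seq; apply: eq_bigr => m /HE[mT _]; rewrite normE.
  rewrite SE in HH.
  have -> : F z - (F z0 + (z - z0) * (K - Kt)) = (z - z0) ^+ 2 * (H - Ht).
    rewrite [RHS]mulrBr HH HHt /F /K /Kt; set S := \sum_(_ <- _) _; ring.
  rewrite normrM (ger0_norm (sqr_ge0 _)).
  apply: (@le_trans _ _ ((z - z0) ^+ 2 * ((K + Kt) / (X - z)))).
    apply: ler_wpM2l; first exact: sqr_ge0.
    rewrite mulrDl ler_norml; move: HK HtK; rewrite -/K -/Kt => HK HtK; apply/andP; split; lra.
  rewrite mulrA -/D ler_pdivrMr// mulrC -ler_pdivrMr//.
exists Z => z zZ; have [gs ks [gT g10] [kT k10]] := HG z zZ.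
exists (G z).1.1, (G z).1.2, (G z).2.1, (G z).2.2; split => //.
apply/eqP; rewrite -subr_eq0 -normr_le0 -/(F z); apply/ler_addgt0Pr => e e0; rewrite add0r.
have e6 : 0 < e / 6 by rewrite divr_gt0.
have [A HA] := weyl_small T0 qi rhob rmin0 rho_ge e6.
have [At HAt] := weyl_small T0 qti rhob rmin0 rho_ge e6.
have Fs w : w <= - Z -> w <= - A -> w <= - At -> `|F w| <= e / 3.
  move=> wZ wA wAt; have [ws wts [wT w1] [wtT wt1]] := HG w wZ.
  apply: le_trans (ler_normB _ _) _.
  have := HA _ _ _ wA ws wT w1; have := HAt _ _ _ wAt wts wtT wt1; lra.
have [B HB] := affine z zZ.
pose w1 := Num.min z (Num.min (- A) (- At)).
have w1z : w1 <= z by rewrite ge_min lexx.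
have w1A : w1 <= - A by rewrite !ge_min lexx ?orbT.
have w1At : w1 <= - At by rewrite !ge_min lexx ?orbT.
(* w1 is the midpoint of z and w2, so the affine F satisfies F z = 2 F w1 - F w2, and both points
   are so far to the left that |F| <= e / 3 there. *)
pose w2 := z + 2 * (w1 - z).
have F1 : `|F w1| <= e / 3 by apply: Fs => //; lra.
have F2 : `|F w2| <= e / 3 by apply: Fs; rewrite /w2; lra.
have -> : F z = 2 * F w1 - F w2.
  rewrite (HB w1) ?(HB w2); [rewrite /w2; ring| |]; rewrite /w2; lra.
apply: le_trans (ler_normB _ _) _; rewrite normrM ger0_norm//; lra.
Qed.

End weyl_uniqueness.

(** * Families of exponentially weighted solutions *)

Section exponential_family.
Context {R : realType}.
Implicit Types (a b e x v r s k : R) (f g q : R -> R).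

Lemma bm_id a b : bm a b (fun x => x).
Proof.
split; first exact: measurable_id.
exists (`|a| + `|b|) => x /andP[ax xb]; rewrite ler_norml; apply/andP; split.
  by have := ler_norm (- a); rewrite normrN; have := normr_ge0 b; lra.
by have := ler_norm b; have := normr_ge0 a; lra.
Qed.

Lemma bm_max a b f g : bm a b f -> bm a b g -> bm a b (fun x => Num.max (f x) (g x)).
Proof.
move=> fb gb; have : bm a b (fun x => 2^-1 * (f x + g x + `|f x - g x|)) by bm_tac.
by apply: eq_bm => x _; rewrite maxr_absE mulrC.
Qed.

Lemma bm_expR a b f : bm a b f -> bm a b (fun x => expR (f x)).
Proof.
move=> [mf [M fM]]; split; first by apply: measurableT_comp.
exists (expR M) => x xab; rewrite ger0_norm ?expR_ge0// ler_expR.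
exact: le_trans (ler_norm _) (fM x xab).
Qed.

(** Up to sign, the Green kernel of m'' - 2 k m' on [b, e] with m prescribed at b and m' at e; it
    does not depend on e. *)
Definition kernel b k x s :=
  (expR (- (2 * k) * (Num.max x s - x)) - expR (- (2 * k) * (s - b))) / (2 * k).

Lemma kernel_bm a c b k x : bm a c (kernel b k x).
Proof.
have i := bm_id a c; rewrite /kernel.
have h : bm a c (fun s => (2 * k)^-1 * (expR (- (2 * k) * (Num.max x s - x))
    - expR (- (2 * k) * (s - b)))).
  apply: bmZ; apply: bmB; apply: bm_expR; apply: bmZ; apply: bmB; try exact: bm_cst.
    by apply: bm_max => //; exact: bm_cst.
  by [].
by apply: eq_bm h => s _; rewrite mulrC.
Qed.

(** Multiplied by exp (- 2 k v), the kernel is an integral of exp (- 2 k r) over a range of r that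
    does not depend on k. A sum over several k therefore becomes an integral of one Dirichlet
    polynomial, and the factor 1 / (2 k) disappears. *)
Lemma kernel_int b k x s v : 0 < k -> Num.max x s - x <= s - b ->
  expR (- (2 * k) * v) * kernel b k x s =
  int (v + (Num.max x s - x)) (v + (s - b)) (fun r => expR (- (2 * k) * r)).
Proof.
move=> k0 h; set r1 := v + _; set r2 := v + _.
have r12 : r1 <= r2 by rewrite lerD2l.
have := AC_diff (AC_expR (- (2 * k)) 0 r12) (lexx r1) r12 (lexx r2).
rewrite intZ; last exact: bm_ig (expR_bm _ _ r12).
rewrite (@eq_int _ _ _ (fun x0 : R => expR (- (2 * k) * x0 + 0)) (fun r => expR (- (2 * k) * r))); last first.
  by move=> t _; rewrite addr0.
rewrite !addr0 => H.
have k2 : - (2 * k) != 0 by rewrite oppr_eq0 mulf_neq0// gt_eqF.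
apply: (mulfI k2); rewrite -H /kernel /r1 /r2 !mulrDr !expRD.
by field; rewrite gt_eqF.
Qed.

Lemma volterra_form b e k q m n : b < e -> 0 < k -> ig b e q ->
  AC b e m n -> AC b e n (fun t => 2 * k * n t + q t * m t) -> m b = 1 ->
  forall x, b <= x <= e ->
  m x - 1 = n e * ((expR (- (2 * k) * (e - x)) - expR (- (2 * k) * (e - b))) / (2 * k))
    - int b e (fun s => q s * m s * kernel b k x s).
Proof.
move=> be k0 qi Am An m1 x /andP[bx xe].
have mb := AC_bm (ltW be) Am.
have qmi : ig b e (fun s => q s * m s) by ig_tac.
have qmi1 : ig b x (fun s => q s * m s) by exact: igS qmi.
have qmi2 : ig x e (fun s => q s * m s) by exact: igS qmi.
pose E y s := expR (- (2 * k) * s + 2 * k * y).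
have Eb y c d : c <= d -> bm c d (E y) by move=> cd; exact: expR_bm.
have AE y : AC b e (fun s => E y s * n s) (fun s => E y s * (q s * m s)).
  apply: eq_AC (ACM (ltW be) (AC_expR (- (2 * k)) (2 * k * y) (ltW be)) An) => // t _.
  by rewrite /E; ring.
have nx y : b <= y -> y <= e -> n y = E y e * n e - int y e (fun s => E y s * (q s * m s)).
  move=> by_ ye; rewrite -(AC_diff (AE y) by_ ye (lexx e)).
  have -> : E y y = 1 by rewrite /E mulNr addNr expR0.
  by ring.
have h1 : n x - n b = 2 * k * (m x - m b) + int b x (fun s => q s * m s).
  rewrite (AC_diff An (lexx b) bx xe) (AC_diff Am (lexx b) bx xe).
  have ni : ig b x n by apply: igS (AC_ig Am).
  by rewrite -intZ// -intD//; exact: igZ.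
have k2 : 2 * k != 0 by rewrite mulf_neq0// gt_eqF.
have -> : m x - 1 = (n x - n b - int b x (fun s => q s * m s)) / (2 * k).
  by rewrite h1 m1; field; rewrite gt_eqF.
rewrite (nx x)// (nx b)//; last exact: ltW.
have bxi : ig b x (fun s => E b s * (q s * m s)).
  by apply: igS (AC_ig (AE b)).
have xei : ig x e (fun s => E b s * (q s * m s)).
  by apply: igS (AC_ig (AE b)).
have xei' : ig x e (fun s => E x s * (q s * m s)).
  by apply: igS (AC_ig (AE x)).
rewrite (@int_chasles _ b x e (fun s => E b s * (q s * m s))) ?bx//; last exact: AC_ig (AE b).
rewrite (@int_chasles _ b x e) ?bx//; last by apply: ig_bmM => //; exact: kernel_bm.
have -> : int b x (fun s => q s * m s * kernel b k x s) =
    (2 * k)^-1 * (int b x (fun s => q s * m s) - int b x (fun s => E b s * (q s * m s))).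
  rewrite -intB// -intZ; last exact: igB.
  apply: eq_int => s /andP[bs sx]; rewrite /kernel (max_l sx) subrr mulr0 expR0 /E.
  have -> : - (2 * k) * (s - b) = - (2 * k) * s + 2 * k * b by ring.
  by field; rewrite gt_eqF.
have -> : int x e (fun s => q s * m s * kernel b k x s) =
    (2 * k)^-1 * (int x e (fun s => E x s * (q s * m s)) - int x e (fun s => E b s * (q s * m s))).
  rewrite -intB// -intZ; last exact: igB.
  apply: eq_int => s /andP[xs se]; rewrite /kernel (max_r (ltW xs)) /E.
  have -> : - (2 * k) * (s - b) = - (2 * k) * s + 2 * k * b by ring.
  have -> : - (2 * k) * (s - x) = - (2 * k) * s + 2 * k * x by ring.
  by field; rewrite gt_eqF.
have -> : - (2 * k) * (e - b) = - (2 * k) * e + 2 * k * b by ring.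
have -> : - (2 * k) * (e - x) = - (2 * k) * e + 2 * k * x by ring.
rewrite /E; set I1 := int _ _ _; set I2 := int _ _ _; set I3 := int _ _ _; set I4 := int _ _ _.
set e1 := expR _; set e2 := expR _.
by field; rewrite gt_eqF.
Qed.

Section finite_family.
Variables (b e : R) (J : nat) (kk : 'I_J -> R) (W : 'I_J -> R).
Hypotheses (be : b < e) (kk1 : forall j, 1 <= kk j) (W1 : forall j, 1 <= W j).
Let l := e - b.
Let l0 : 0 < l. Proof. by rewrite subr_gt0. Qed.
Let kk0 j : 0 < kk j. Proof. exact: lt_le_trans (kk1 j). Qed.
Let W0 j : 0 <= W j. Proof. exact: le_trans (W1 j). Qed.

Definition dirichlet (c : 'I_J -> R) v := \sum_j c j * expR (- (2 * kk j) * v).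
(** The Dirichlet polynomial without cancellation, with an allowance V j for the growth of the
    solutions. It is affordable only near v = l, where the exponentials beat the coefficients. *)
Definition weight (V : 'I_J -> R) (c : 'I_J -> R) v := \sum_j `|c j| * V j * expR (- (2 * kk j) * v).
Definition tailint (c : 'I_J -> R) v := int v l (fun r => `|dirichlet c r|).

Lemma dirichlet_bm c x y : bm x y (dirichlet c).
Proof.
apply: bm_sum => j; apply: bmZ; apply: bm_expR; apply: bmZ; exact: bm_id.
Qed.

Lemma tailint_ge0 c v : 0 <= tailint c v. Proof. by apply: int_ge0. Qed.

Lemma weight_ge0 V c v : (forall j, 0 <= V j) -> 0 <= weight V c v.
Proof. by move=> V0; apply: sumr_ge0 => j _; rewrite !mulr_ge0 ?expR_ge0. Qed.

Lemma le_weight V c v v' : (forall j, 0 <= V j) -> v <= v' -> weight V c v' <= weight V c v.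
Proof.
move=> V0 vv; apply: ler_sum => j _; apply: ler_wpM2l; first by rewrite mulr_ge0.
by rewrite ler_expR !mulNr lerN2 ler_wpM2l// mulr_ge0// ltW.
Qed.

Lemma dirichlet_le_weight c v : `|dirichlet c v| <= weight W c v.
Proof.
apply: le_trans (ler_norm_sum _ _ _) _; apply: ler_sum => j _.
rewrite normrM (ger0_norm (expR_ge0 _)) ler_wpM2r ?expR_ge0//.
by rewrite ler_peMr.
Qed.

Lemma le_tailint c v v' : v <= v' -> tailint c v' <= tailint c v.
Proof.
move=> vv; have [lv|vl] := leP l v'.
  by rewrite {1}/tailint int_nil// tailint_ge0.
rewrite /tailint (@int_chasles _ v v' l) ?vv ?(ltW vl)//.
  by rewrite lerDr; apply: int_ge0.
by apply: bm_ig; apply: bm_norm; exact: dirichlet_bm.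
Qed.

(** Put a v x = sum_j c_j exp (- 2 k_j v) m_j(x). By [volterra_form] and [kernel_int], a v x - P(v)
    is a boundary term at e minus the integral of q(s) times an integral of a r s over r, so the
    estimate reproduces itself with factor l |q|_1 <= 1/2. The relation leads from (v, x) to other
    pairs (r, s), which is why v and x are independent. The constant 5 + 2 |q|_1 is 2 (2 + |q|_1) +
    1 from [halving_bound]. *)
Lemma family_bound q (m n : 'I_J -> R -> R) : ig b e q ->
  l * int b e (fun t => `|q t|) <= 2^-1 ->
  (forall j, AC b e (m j) (n j)) ->
  (forall j, AC b e (n j) (fun t => 2 * kk j * n j t + q t * m j t)) ->
  (forall j, m j b = 1) -> (forall j x, b <= x <= e -> `|m j x| <= W j) ->
  (forall j, `|n j e| <= W j) ->
  forall c v x, 0 <= v -> b <= x <= e ->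
  `|\sum_j c j * expR (- (2 * kk j) * v) * m j x - dirichlet c v| <=
  (5 + 2 * int b e (fun t => `|q t|)) * (tailint c v + weight W c (Num.min l (v + e - x))).
Proof.
move=> qi lq Am An mb mW nW c v x v0 xbe.
set Nq := int b e (fun t => `|q t|) in lq *.
have Nq0 : 0 <= Nq by apply: int_ge0.
pose a v x := \sum_j c j * expR (- (2 * kk j) * v) * m j x.
pose err v x := weight W c (Num.min l (v + e - x)).
have err0 v' x' : 0 <= err v' x' by exact: weight_ge0.
pose P K := forall v x, 0 <= v -> b <= x <= e ->
  `|a v x - dirichlet c v| <= K * (tailint c v + err v x).
have triv v' x' : b <= x' <= e -> `|a v' x' - dirichlet c v'| <= 2 * weight W c v'.
  move=> x'be; apply: le_trans (ler_normB _ _) _; rewrite mulr_natl mulr2n; apply: lerD; last first.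
    exact: dirichlet_le_weight.
  apply: le_trans (ler_norm_sum _ _ _) _; apply: ler_sum => j _.
  rewrite !normrM (ger0_norm (expR_ge0 _)) mulrAC ler_wpM2r ?expR_ge0// ler_wpM2l//.
  exact: mW.
pose kmax := \sum_j kk j.
have kmaxP j : kk j <= kmax.
  rewrite /kmax (bigD1 j)//= lerDl sumr_ge0// => i _; exact: ltW.
(* This first constant depends on the rates and on l; only its existence matters, since halving
   removes it. *)
have PN : P (2 * expR (2 * kmax * l)).
  move=> v' x' v'0 x'be; apply: le_trans (triv v' x' x'be) _.
  rewrite -[leRHS]mulrA ler_wpM2l//.
  apply: (@le_trans _ _ (expR (2 * kmax * l) * err v' x')); last first.
    by rewrite ler_wpM2l ?expR_ge0// lerDr tailint_ge0.
  apply: (@le_trans _ _ (expR (2 * kmax * l) * weight W c (v' + l))); last first.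
    rewrite ler_wpM2l ?expR_ge0// le_weight// ge_min; apply/orP; right.
    by rewrite -addrA lerD2l lerD2l lerN2; case/andP: x'be.
  rewrite /weight mulr_sumr; apply: ler_sum => j _.
  rewrite mulrCA; apply: ler_wpM2l; first by rewrite mulr_ge0.
  rewrite -expRD ler_expR.
  have : kk j * l <= kmax * l by rewrite ler_wpM2r// ltW.
  by lra.
have step K : 0 <= K -> P K -> P (K / 2 + (2 + Nq)).
  move=> K0 PK v' x' v'0 /[dup] x'be /andP[bx xe].
  have TE0 : 0 <= tailint c v' + err v' x' by rewrite addr_ge0 ?tailint_ge0.
  have [lv|vl] := leP l v'.
    apply: le_trans (triv v' x' x'be) _.
    have : weight W c v' <= err v' x'.
      by apply: le_weight => //; rewrite ge_min lv.
    have := tailint_ge0 c v'; have : 0 <= (K / 2 + Nq) * (tailint c v' + err v' x').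
      by rewrite mulr_ge0// addr_ge0// divr_ge0.
    lra.
  pose D s := \sum_j c j * expR (- (2 * kk j) * v') * m j s * kernel b (kk j) x' s.
  have mbm j := AC_bm (ltW be) (Am j).
  have Db : bm b e D.
    apply: bm_sum => j; apply: bmM; last exact: kernel_bm.
    exact: bmZ.
  have -> : a v' x' - dirichlet c v' =
     \sum_j c j * expR (- (2 * kk j) * v') * (n j e * ((expR (- (2 * kk j) * (e - x'))
       - expR (- (2 * kk j) * (e - b))) / (2 * kk j))) - int b e (fun s => q s * D s).
    have -> : int b e (fun s => q s * D s) = \sum_j c j * expR (- (2 * kk j) * v') *
       int b e (fun s => q s * m j s * kernel b (kk j) x' s).
      have H := @int_sum _ b e _ (index_enum 'I_J) (fun j s => c j * expR (- (2 * kk j) * v') *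
         (q s * m j s * kernel b (kk j) x' s)).
      have Hi j : ig b e (fun s => q s * m j s * kernel b (kk j) x' s).
        by apply: ig_bmM; [apply: ig_bmM|exact: kernel_bm].
      have [|_ H2] := H; first by move=> j; exact: igZ.
      transitivity (\sum_j int b e (fun s => c j * expR (- (2 * kk j) * v') *
         (q s * m j s * kernel b (kk j) x' s))); last first.
        by apply: eq_bigr => j _; rewrite intZ.
      rewrite -H2; apply: eq_int => s _; rewrite /D mulr_sumr; apply: eq_bigr => j _; ring.
    rewrite /a /dirichlet -!sumrB; apply: eq_bigr => j _.
    rewrite -mulrBr -(@volterra_form b e (kk j) q (m j) (n j))//; ring.
  apply: le_trans (ler_normB _ _) _.
  have h1 : `|\sum_j c j * expR (- (2 * kk j) * v') * (n j e * ((expR (- (2 * kk j) * (e - x'))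
       - expR (- (2 * kk j) * (e - b))) / (2 * kk j)))| <= err v' x'.
    apply: (@le_trans _ _ (weight W c (v' + e - x'))); last first.
      by apply: le_weight => //; rewrite ge_min lexx orbT.
    apply: le_trans (ler_norm_sum _ _ _) _; apply: ler_sum => j _.
    have -> : expR (- (2 * kk j) * (v' + e - x')) =
       expR (- (2 * kk j) * v') * expR (- (2 * kk j) * (e - x')).
      by rewrite -expRD; congr expR; ring.
    rewrite !normrM (ger0_norm (expR_ge0 _)).
    rewrite [X in _ <= X](_ : _ = `|c j| * expR (- (2 * kk j) * v') * (W j * expR (- (2 * kk j) * (e - x')))); last by ring.
    apply: ler_wpM2l; first by rewrite mulr_ge0 ?expR_ge0.
    apply: ler_pM => //.
    have e12 : expR (- (2 * kk j) * (e - b)) <= expR (- (2 * kk j) * (e - x')).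
      by rewrite ler_expR !mulNr lerN2 ler_wpM2l ?mulr_ge0 ?(ltW (kk0 j))//; lra.
    rewrite -normrM ger0_norm; last by rewrite divr_ge0 ?subr_ge0// mulr_ge0// ltW.
    rewrite ler_pdivrMr ?mulr_gt0//.
    have E0 := expR_ge0 (- (2 * kk j) * (e - b)); have E1 := expR_ge0 (- (2 * kk j) * (e - x')).
    apply: (@le_trans _ _ (expR (- (2 * kk j) * (e - x')) * 1)); first lra.
    by rewrite ler_wpM2l//; have := kk1 j; lra.
  (* On the range of integration r >= v' and r + e - s >= v' + e - x', so neither the tail integral
     nor the boundary error grows on passing from (v', x') to (r, s). *)
  have DI s : b < s <= e -> `|D s| <= tailint c v' + l * err v' x' + l * (K * (tailint c v' + err v' x')).
    move=> /andP[bs se].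
    pose r1 := v' + (Num.max x' s - x'); pose r2 := v' + (s - b).
    have mx0 : 0 <= Num.max x' s - x' by rewrite subr_ge0 le_max lexx.
    have mx1 : s - x' <= Num.max x' s - x' by rewrite lerD2r le_max lexx orbT.
    have mx2 : Num.max x' s - x' <= s - b.
      by case: (leP x' s) => hs; lra.
    have r12 : r1 <= r2 by rewrite lerD2l.
    have -> : D s = int r1 r2 (fun r => a r s).
      have H := @int_sum _ r1 r2 _ (index_enum 'I_J) (fun j r => c j * m j s * expR (- (2 * kk j) * r)).
      have Hi j : ig r1 r2 (fun r => expR (- (2 * kk j) * r)).
        by apply: bm_ig; apply: bm_expR; apply: bmZ; exact: bm_id.
      have [|_ H2] := H; first by move=> j; exact: igZ.
      transitivity (int r1 r2 (fun r => \sum_j c j * m j s * expR (- (2 * kk j) * r))).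
        rewrite H2 /D; apply: eq_bigr => j _; rewrite intZ// -kernel_int//; ring.
      by apply: eq_int => r _; apply: eq_bigr => j _; ring.
    have Pb u w : ig u w (fun r => `|dirichlet c r|).
      by apply: bm_ig; apply: bm_norm; exact: dirichlet_bm.
    have ab : bm r1 r2 (fun r => a r s).
      by apply: bm_sum => j; apply: bmM; [apply: bmZ; apply: bm_expR; apply: bmZ; exact: bm_id|exact: bm_cst].
    apply: (@le_trans _ _ (int r1 r2 (fun r => `|dirichlet c r| + K * (tailint c v' + err v' x')))).
      apply: norm_int_le_int; [exact: bm_ig|apply: igD => //; exact: bm_ig (bm_cst _ _ _)|].
      move=> r /andP[r1r rr2].
      have vr : v' <= r by move: r1r; rewrite /r1; lra.
      rewrite -[a r s](subrK (dirichlet c r)) addrC; apply: le_trans (ler_normD _ _) _.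
      rewrite lerD2l; apply: le_trans (PK r s _ _) _.
      - exact: le_trans vr.
      - by rewrite (ltW bs).
      apply: ler_wpM2l => //; apply: lerD; first exact: le_tailint.
      apply: le_weight => //; rewrite le_min; apply/andP; split; first by rewrite ge_min lexx.
      by rewrite ge_min; apply/orP; right; move: r1r; rewrite /r1; lra.
    rewrite intD//; last exact: bm_ig (bm_cst _ _ _).
    rewrite int_cst//.
    have r21 : r2 - r1 <= l by rewrite /r2 /r1 /l; lra.
    apply: lerD; last first.
      rewrite [leRHS]mulrC; apply: ler_wpM2l => //; exact: mulr_ge0.
    apply: (@le_trans _ _ (int v' (v' + l) (fun r => `|dirichlet c r|))).
      rewrite (@int_chasles _ v' r1 (v' + l)); last 2 first.
      - by rewrite /r1 /l; apply/andP; split; lra.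
      - exact: Pb.
      rewrite (@int_chasles _ r1 r2 (v' + l)); last 2 first.
      - by rewrite r12 /r2 /l; lra.
      - exact: Pb.
      have ? : 0 <= int v' r1 (fun r => `|dirichlet c r|) by apply: int_ge0.
      have ? : 0 <= int r2 (v' + l) (fun r => `|dirichlet c r|) by apply: int_ge0.
      lra.
    rewrite (@int_chasles _ v' l (v' + l)); last 2 first.
    - by rewrite (ltW vl) lerDr.
    - exact: Pb.
    rewrite lerD2l.
    apply: (@le_trans _ _ (int l (v' + l) (fun=> err v' x'))).
      apply: le_int; [exact: Pb|exact: bm_ig (bm_cst _ _ _)|].
      move=> r /andP[lr _]; apply: le_trans (dirichlet_le_weight _ _) _.
      by apply: le_weight => //; rewrite ge_min ltW.
    rewrite int_cst ?lerDr// addrK mulrC ler_wpM2r// ltW//.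
  have h2 : `|int b e (fun s => q s * D s)| <=
      Nq * (tailint c v' + l * err v' x' + l * (K * (tailint c v' + err v' x'))).
    rewrite mulrC -intZ; last exact: ig_norm.
    apply: norm_int_le_int; [exact: ig_bmM|by apply: igZ; exact: ig_norm|].
    by move=> s sbe; rewrite normrM mulrC ler_wpM2r// DI.
  apply: le_trans (lerD h1 h2) _.
  have t0 := tailint_ge0 c v'; have er0 := err0 v' x'.
  have h3 := ler_wpM2r er0 lq; have h4 : l * Nq * (K * (tailint c v' + err v' x')) <= 2^-1 * (K * (tailint c v' + err v' x')).
    by rewrite ler_wpM2r// mulr_ge0.
  have h5 : 0 <= Nq * err v' x' by rewrite mulr_ge0.
  lra.
have N0 : 0 <= 2 * expR (2 * kmax * l) by rewrite mulr_ge0 ?expR_ge0.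
have C0 : 0 <= 2 + Nq by rewrite addr_ge0.
have [K /andP[K0 KC] PK] := halving_bound N0 PN step C0 ltr01.
apply: le_trans (PK v x v0 xbe) _; apply: ler_wpM2r; last lra.
by rewrite addr_ge0 ?tailint_ge0.
Qed.

End finite_family.
End exponential_family.

(** * Products of two normalised solutions *)

Section product_family.
Context {R : realType}.
Variables (b e : R) (J : nat) (kk : 'I_J -> R) (W : 'I_J -> R) (q qt p : R -> R).
Hypotheses (be : b < e) (kk1 : forall j, 1 <= kk j) (W1 : forall j, 1 <= W j).
Hypotheses (qi : ig b e q) (qti : ig b e qt) (p_i : ig b e p).
Let l := e - b.
Hypothesis lq : l * int b e (fun t => `|q t|) <= 2^-1.
Hypothesis lqt : l * int b e (fun t => `|qt t|) <= 2^-1.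
Variables m n mt nt : 'I_J -> R -> R.
Hypothesis Am : forall j, AC b e (m j) (n j).
Hypothesis An : forall j, AC b e (n j) (fun t => 2 * kk j * n j t + q t * m j t).
Hypothesis Amt : forall j, AC b e (mt j) (nt j).
Hypothesis Ant : forall j, AC b e (nt j) (fun t => 2 * kk j * nt j t + qt t * mt j t).
Hypotheses (mb : forall j, m j b = 1) (mtb : forall j, mt j b = 1).
Hypothesis mW : forall j x, b <= x <= e -> `|m j x| <= W j.
Hypothesis mtW : forall j x, b <= x <= e -> `|mt j x| <= W j.
Hypotheses (nW : forall j, `|n j e| <= W j) (ntW : forall j, `|nt j e| <= W j).
Let Nq := 5 + 2 * int b e (fun t => `|q t|).
Let Nqt := 5 + 2 * int b e (fun t => `|qt t|).
Let K := Nq * (1 + l * Nqt) + Nqt.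
Let W2 j := W j ^+ 2.
Let l0 : 0 < l. Proof. by rewrite subr_gt0. Qed.
Let W0 j : 0 <= W j. Proof. exact: le_trans (W1 j). Qed.
Let W20 j : 0 <= W2 j. Proof. exact: sqr_ge0. Qed.
Let Nq0 : 0 <= Nq.
Proof. by rewrite addr_ge0// mulr_ge0//; apply: int_ge0. Qed.
Let Nqt0 : 0 <= Nqt.
Proof. by rewrite addr_ge0// mulr_ge0//; apply: int_ge0. Qed.

(* For fixed x the products c_j mt_j(x) are again coefficients of a Dirichlet
   polynomial, so the linear bound applies twice. *)
Lemma product_bound c x : b <= x <= e ->
  `|\sum_j c j * expR (- (2 * kk j) * (x - b)) * (m j x * mt j x) - dirichlet kk c (x - b)| <=
  K * (tailint b e kk c (x - b) + weight kk W2 c l).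
Proof.
move=> /[dup] xbe /andP[bx xe]; set v := x - b.
have v0 : 0 <= v by rewrite subr_ge0.
pose c' j := c j * mt j x.
have vl : Num.min l (v + e - x) = l by rewrite min_l// /v /l; lra.
have ww : weight kk W c l <= weight kk W2 c l.
  apply: ler_sum => j _; rewrite ler_wpM2r ?expR_ge0// ler_wpM2l//.
  by rewrite /W2 expr2 ler_peMr.
set T := tailint b e kk c v; set w := weight kk W2 c l.
have T0 : 0 <= T by exact: tailint_ge0.
have w0 : 0 <= w by apply: weight_ge0.
have h1 := family_bound be kk1 W1 qi lq Am An mb mW nW c' v0 xbe.
rewrite -/l vl -/Nq in h1.
have w' : weight kk W c' l <= w.
  apply: ler_sum => j _; rewrite ler_wpM2r ?expR_ge0// normrM -mulrA ler_wpM2l//.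
  by rewrite /W2 expr2 ler_wpM2r// mtW.
have Q r : v <= r -> `|dirichlet kk c' r - dirichlet kk c r| <= Nqt * (T + w).
  move=> vr; have r0 : 0 <= r by exact: le_trans vr.
  have := family_bound be kk1 W1 qti lqt Amt Ant mtb mtW ntW c r0 xbe.
  rewrite -/l -/Nqt => h.
  have -> : dirichlet kk c' r = \sum_j c j * expR (- (2 * kk j) * r) * mt j x.
    by apply: eq_bigr => j _; rewrite /c' mulrAC.
  apply: le_trans h _; apply: ler_wpM2l => //; apply: lerD; first exact: le_tailint.
  apply: le_trans ww; apply: le_weight => //.
  by rewrite le_min lexx/= /l; move: vr; rewrite /v; lra.
have T' : tailint b e kk c' v <= T + l * (Nqt * (T + w)).
  have [lv|lv] := leP l v.
    rewrite /tailint -/l int_nil//; apply: addr_ge0 => //.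
    by apply: mulr_ge0; [exact: ltW|apply: mulr_ge0 => //; exact: addr_ge0].
  have vle := ltW lv.
  apply: (@le_trans _ _ (int v l (fun r => `|dirichlet kk c r| + Nqt * (T + w)))).
    apply: le_int.
    - by apply: bm_ig; apply: bm_norm; exact: dirichlet_bm.
    - apply: igD; last exact: bm_ig (bm_cst _ _ _).
      by apply: bm_ig; apply: bm_norm; exact: dirichlet_bm.
    move=> r /andP[vr _]; rewrite -[dirichlet kk c' r](subrK (dirichlet kk c r)) addrC.
    by apply: le_trans (ler_normD _ _) _; rewrite lerD2l Q// ltW.
  rewrite intD; [|by apply: bm_ig; apply: bm_norm; exact: dirichlet_bm|exact: bm_ig (bm_cst _ _ _)].
  rewrite int_cst//; apply: lerD => //.
  rewrite [leRHS]mulrC; apply: ler_wpM2l; last lra.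
  by apply: mulr_ge0 => //; exact: addr_ge0.
have -> : \sum_j c j * expR (- (2 * kk j) * v) * (m j x * mt j x) =
    \sum_j c' j * expR (- (2 * kk j) * v) * m j x.
  by apply: eq_bigr => j _; rewrite /c'; ring.
rewrite -[X in `|X|](subrK (dirichlet kk c' v)) -addrA addrAC -addrA.
rewrite (_ : _ + _ = (\sum_j c' j * expR (- (2 * kk j) * v) * m j x - dirichlet kk c' v)
  + (dirichlet kk c' v - dirichlet kk c v)); last by ring.
apply: le_trans (ler_normD _ _) _.
have h2 := Q v (lexx v).
have h3 : Nq * (tailint b e kk c' v + weight kk W c' l) <= Nq * (T + l * (Nqt * (T + w)) + w).
  by apply: ler_wpM2l => //; apply: lerD.
rewrite /K; lra.
Qed.

(** Each product of solutions is almost annihilated by p, and [product_bound] controls the cost of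
    replacing the products by 1. The split at b + t prepares for a polynomial that is small beyond
    t: there only the tail from t remains. *)
Lemma dirichlet_functional_bound c t : 0 <= t <= l ->
  (forall j, `|int b e (fun x => p x * (expR (- (2 * kk j) * (x - b)) * (m j x * mt j x)))|
     <= W j * expR (- (2 * kk j) * l)) ->
  `|int b e (fun x => p x * dirichlet kk c (x - b))| <= weight kk W2 c l +
  K * ((tailint b e kk c 0 + weight kk W2 c l) * int b (b + t) (fun x => `|p x|)
    + (tailint b e kk c t + weight kk W2 c l) * int (b + t) e (fun x => `|p x|)).
Proof.
move=> /andP[t0 tl] pW.
have bmx f : bm b e f -> ig b e (fun x => p x * f x) by move=> fb; exact: ig_bmM.
have mbm j := AC_bm (ltW be) (Am j); have mtbm j := AC_bm (ltW be) (Amt j).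
have eb k : bm b e (fun x => expR (- (2 * k) * (x - b))).
  by apply: bm_expR; apply: bmZ; apply: bmB; [exact: bm_id|exact: bm_cst].
pose G x := \sum_j c j * expR (- (2 * kk j) * (x - b)) * (m j x * mt j x).
have Gb : bm b e G.
  by apply: bm_sum => j; apply: bmM; [exact: bmZ|exact: bmM].
have Db : bm b e (fun x => dirichlet kk c (x - b)).
  by apply: bm_sum => j; exact: bmZ.
set w := weight kk W2 c l; set A := tailint b e kk c.
have w0 : 0 <= w by apply: weight_ge0.
have h1 : `|int b e (fun x => p x * G x)| <= w.
  have -> : int b e (fun x => p x * G x) =
      \sum_j c j * int b e (fun x => p x * (expR (- (2 * kk j) * (x - b)) * (m j x * mt j x))).
    have Hi j : ig b e (fun x => p x * (expR (- (2 * kk j) * (x - b)) * (m j x * mt j x))).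
      by apply: bmx; apply: bmM => //; exact: bmM.
    have [|_ H] := @int_sum _ b e _ (index_enum 'I_J)
      (fun j x => c j * (p x * (expR (- (2 * kk j) * (x - b)) * (m j x * mt j x)))).
      by move=> j; exact: igZ.
    transitivity (\sum_j int b e (fun x => c j * (p x * (expR (- (2 * kk j) * (x - b)) * (m j x * mt j x))))).
      rewrite -H; apply: eq_int => x _; rewrite /G mulr_sumr; apply: eq_bigr => j _; ring.
    by apply: eq_bigr => j _; rewrite intZ.
  apply: le_trans (ler_norm_sum _ _ _) _; apply: ler_sum => j _.
  rewrite normrM -mulrA ler_wpM2l//; apply: le_trans (pW j) _.
  by rewrite ler_wpM2r ?expR_ge0// /W2 expr2 ler_peMr.
have np := ig_norm p_i.
have bt1 : b <= b + t by rewrite lerDl.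
have bt2 : b + t <= e by move: tl; rewrite /l; lra.
have h2 : `|int b e (fun x => p x * (G x - dirichlet kk c (x - b)))| <=
    K * ((A 0 + w) * int b (b + t) (fun x => `|p x|) + (A t + w) * int (b + t) e (fun x => `|p x|)).
  have GDb : bm b e (fun x => G x - dirichlet kk c (x - b)) by exact: bmB.
  have GDi := bmx _ GDb.
  rewrite (@int_chasles _ b (b + t) e) ?bt1//.
  have K0 : 0 <= K by rewrite addr_ge0// mulr_ge0// addr_ge0// mulr_ge0// ltW.
  apply: le_trans (ler_normD _ _) _; rewrite mulrDr !mulrA; apply: lerD.
    rewrite -intZ; last exact: igS np.
    apply: norm_int_le_int; [exact: igS GDi|by apply: igZ; exact: igS np|].
    move=> x /andP[bx xt]; rewrite normrM mulrC ler_wpM2r//.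
    apply: le_trans (product_bound c _) _; first by rewrite (ltW bx) (le_trans xt).
    apply: ler_wpM2l => //; apply: lerD => //; apply: le_tailint; rewrite subr_ge0; exact: ltW.
  rewrite -intZ; last exact: igS np.
  apply: norm_int_le_int; [exact: igS GDi|by apply: igZ; exact: igS np|].
  move=> x /andP[bx xe]; rewrite normrM mulrC ler_wpM2r//.
  apply: le_trans (product_bound c _) _; first by rewrite xe (le_trans bt1 (ltW bx)).
  by apply: ler_wpM2l => //; apply: lerD => //; apply: le_tailint; rewrite lerBrDl ltW.
have -> : int b e (fun x => p x * dirichlet kk c (x - b)) =
    int b e (fun x => p x * G x) - int b e (fun x => p x * (G x - dirichlet kk c (x - b))).
  rewrite -intB; [|exact: bmx|by apply: bmx; exact: bmB].
  by apply: eq_int => x _; ring.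
by apply: le_trans (ler_normB _ _) (lerD h1 h2).
Qed.

End product_family.

(** * Dirichlet polynomials approximating step functions *)

Lemma bin_le_expn n k : ('C(n, k) <= n ^ k)%N.
Proof.
elim: n k => [|n ih] [|k]; rewrite ?bin0 ?bin0n ?expn0//.
rewrite binS (leq_trans (leq_add (ih k.+1) (ih k)))//.
rewrite expnS -mulSnr expnS leq_mul2l/=.
by case: k => [|k]; rewrite ?expn0// leq_exp2r.
Qed.

Section cutoff.
Context {R : realType}.
Implicit Types (y t v d C : R).

Lemma bernoulli_lower y (M : nat) : 0 <= y <= 1 -> 1 - M%:R * y <= (1 - y) ^+ M.
Proof.
move=> /andP[y0 y1]; elim: M => [|M ih]; first by rewrite mul0r subr0 expr0.
rewrite exprS; apply: (@le_trans _ _ ((1 - y) * (1 - M%:R * y))); last first.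
  by rewrite ler_wpM2l// subr_ge0.
have : 0 <= M%:R * y ^+ 2 by rewrite mulr_ge0 ?sqr_ge0.
by rewrite -natr1; lra.
Qed.

Lemma bernoulli_upper y (M : nat) : 0 <= y <= 1 -> (1 - y) ^+ M * (1 + M%:R * y) <= 1.
Proof.
move=> /andP[y0 y1]; elim: M => [|M ih]; first by rewrite mul0r addr0 expr0 mul1r.
apply: le_trans ih; rewrite exprS mulrAC mulrC; apply: ler_wpM2l.
  by rewrite exprn_ge0// subr_ge0.
have : 0 <= (M%:R + 1) * y ^+ 2 by rewrite mulr_ge0 ?sqr_ge0// addr_ge0.
by rewrite -natr1; lra.
Qed.

Lemma inv_nat_cvg (u : nat -> R) (l C : R) (N0 : nat) :
  (forall N, (N0 <= N)%N -> (0 < N)%N -> `|u N - l| <= C / N%:R) -> u @ \oo --> l.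
Proof.
move=> H; apply/cvgrPdist_le => e e0.
exists (maxn N0 (Num.truncn (`|C| / e)).+1) => // N /=.
rewrite geq_max => /andP[N0N N1N].
have Np : (0 < N)%N by exact: leq_trans N1N.
have Np' : 0 < N%:R :> R by rewrite ltr0n.
rewrite distrC; apply: le_trans (H N N0N Np) _.
rewrite ler_pdivrMr//; apply: (le_trans (ler_norm C)).
rewrite mulrC -ler_pdivrMr//; apply: le_trans (ltW (truncnS_gt _)) _.
by rewrite ler_nat.
Qed.

(** With M about N exp (2 N t), (1 - exp (- 2 N v)) ^ M is close to exp (- N exp (2 N (t - v))). The
    factor N in front forces the limit 0 at v = t as well. *)
Definition cutoff_degree t (N : nat) := (Num.truncn (N%:R * expR (2 * N%:R * t))).+1.

(* As N grows this tends to the indicator function of v > t. *)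
Definition cutoff t (N : nat) v := (1 - expR (- (2 * N%:R) * v)) ^+ cutoff_degree t N.

Lemma expR_le1 (N : nat) v : 0 <= v -> 0 <= expR (- (2 * N%:R) * v) <= 1.
Proof.
move=> v0; rewrite expR_ge0/= -expR0 ler_expR mulNr oppr_le0 mulr_ge0// mulr_ge0//.
Qed.

Lemma cutoff_degree_ge t (N : nat) : N%:R * expR (2 * N%:R * t) <= (cutoff_degree t N)%:R.
Proof. exact/ltW/truncnS_gt. Qed.

Lemma cutoff_degree_le t (N : nat) : (0 < N)%N -> 0 <= t ->
  (cutoff_degree t N)%:R <= 2 * N%:R * expR (2 * N%:R * t).
Proof.
move=> N0 t0; rewrite /cutoff_degree -natr1.
have NR : 1 <= N%:R :> R by rewrite ler1n.
have E1 : 1 <= expR (2 * N%:R * t) by rewrite -expR0 ler_expR !mulr_ge0.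
have p : 0 <= N%:R * expR (2 * N%:R * t) by rewrite mulr_ge0 ?expR_ge0.
have := truncn_itv p => /andP[h _].
have : 1 <= N%:R * expR (2 * N%:R * t) by rewrite -[leLHS]mulr1 ler_pM.
lra.
Qed.

Lemma cutoff_degree_homo t t' (N : nat) : t <= t' -> (cutoff_degree t N <= cutoff_degree t' N)%N.
Proof.
move=> tt; rewrite ltnS; apply: le_truncn; rewrite ler_wpM2l// ler_expR ler_wpM2l//.
Qed.

Lemma cutoff_itv t (N : nat) v : 0 <= v -> 0 <= cutoff t N v <= 1.
Proof.
move=> v0; have /andP[y0 y1] := expR_le1 N v0.
rewrite exprn_ge0 ?subr_ge0//= exprn_ile1 ?subr_ge0//; lra.
Qed.

Lemma cutoff_cvg t v : 0 <= t -> 0 <= v ->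
  (fun N => cutoff t N v) @ \oo --> (if v <= t then 0 else 1 : R).
Proof.
move=> t0 v0; case: ifPn => [vt|]; last rewrite -ltNge => tv.
  apply: (@inv_nat_cvg _ _ 1 0) => N _ N0; have NR : 0 < N%:R :> R by rewrite ltr0n.
  have /andP[c0 _] := cutoff_itv t N v0; rewrite subr0 ger0_norm//.
  have y01 := expR_le1 N v0; have h := bernoulli_upper (cutoff_degree t N) y01.
  have hM : N%:R <= (cutoff_degree t N)%:R * expR (- (2 * N%:R) * v).
    apply: (@le_trans _ _ (N%:R * expR (2 * N%:R * t) * expR (- (2 * N%:R) * v))).
      rewrite -mulrA -expRD ler_peMr ?(ltW NR)// -expR0 ler_expR.
      by rewrite mulNr -mulrBr !mulr_ge0 ?subr_ge0.
    by rewrite ler_wpM2r ?expR_ge0// cutoff_degree_ge.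
  rewrite ler_pdivlMr//; apply: le_trans h; rewrite -/(cutoff t N v) ler_wpM2l//; lra.
have d0 : 0 < v - t by rewrite subr_gt0.
apply: (@inv_nat_cvg _ _ ((v - t) ^+ 2)^-1 0) => N _ N0; have NR : 0 < N%:R :> R by rewrite ltr0n.
have /andP[_ c1] := cutoff_itv t N v0; rewrite distrC ger0_norm ?subr_ge0//.
have y01 := expR_le1 N v0; have h := bernoulli_lower (cutoff_degree t N) y01.
rewrite -/(cutoff t N v) in h.
apply: (@le_trans _ _ ((cutoff_degree t N)%:R * expR (- (2 * N%:R) * v))); first lra.
apply: (@le_trans _ _ (2 * N%:R * expR (2 * N%:R * t) * expR (- (2 * N%:R) * v))).
  by rewrite ler_wpM2r ?expR_ge0// cutoff_degree_le.
rewrite -mulrA -expRD mulNr -mulrBr -opprB mulrN expRN.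
set d := v - t in d0 *.
have x0 : 0 <= 2 * N%:R * d by rewrite !mulr_ge0// ltW.
have := expR_ge1Dxn 1 x0; rewrite (_ : 2`!%:R = 2 :> R)// => hE.
have xp : 0 < 2 * N%:R * d by rewrite !mulr_gt0.
have hE2 : 2 * N%:R ^+ 2 * d ^+ 2 <= expR (2 * N%:R * d).
  apply: le_trans hE; have : 0 <= N%:R ^+ 2 * d ^+ 2 by rewrite mulr_ge0 ?sqr_ge0.
  by rewrite !exprMn; lra.
apply: (@le_trans _ _ (2 * N%:R * (2 * N%:R ^+ 2 * d ^+ 2)^-1)).
  rewrite ler_wpM2l ?mulr_ge0// lef_pV2 ?posrE ?expR_gt0//.
  by rewrite !mulr_gt0 ?exprn_gt0.
rewrite le_eqVlt; apply/orP; left; apply/eqP.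
by field; rewrite !gt_eqF.
Qed.

(** The coefficients of the difference of two cutoffs with the same N, which approximates the
    indicator of ]t, t']. The constant terms cancel, hence the shift to j.+1; the shorter expansion
    is padded with the vanishing binomials. *)
Definition cutoff_coef t t' (N : nat) (j : 'I_(cutoff_degree t' N)) : R :=
  ('C(cutoff_degree t N, j.+1)%:R - 'C(cutoff_degree t' N, j.+1)%:R) * (-1) ^+ j.+1.

Lemma binomial_padded y (M L : nat) : (M <= L)%N ->
  (1 - y) ^+ M = \sum_(i < L.+1) 'C(M, i)%:R * (-1) ^+ i * y ^+ i.
Proof.
move=> ML; rewrite exprDn.
have -> : \sum_(i < M.+1) (1 ^+ (M - i) * (- y) ^+ i) *+ 'C(M, i) =
    \sum_(i < M.+1) 'C(M, i)%:R * (-1) ^+ i * y ^+ i.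
  by apply: eq_bigr => i _; rewrite expr1n mul1r [(- y) ^+ i]exprNn -mulr_natl mulrA.
rewrite (big_ord_widen L.+1 (fun i => 'C(M, i)%:R * (-1) ^+ i * y ^+ i))//.
rewrite [RHS](bigID (fun i : 'I_L.+1 => (i < M.+1)%N))/= [X in _ + X]big1 ?addr0//.
by move=> i; rewrite -leqNgt => Mi; rewrite bin_small// mul0r mul0r.
Qed.

Lemma cutoff_dirichlet t t' (N : nat) v : t <= t' ->
  cutoff t N v - cutoff t' N v =
  dirichlet (fun j : 'I_(cutoff_degree t' N) => (j.+1 * N)%:R) (@cutoff_coef t t' N) v.
Proof.
move=> tt; set y := expR (- (2 * N%:R) * v).
rewrite /cutoff -/y (binomial_padded y (cutoff_degree_homo N tt)) (binomial_padded y (leqnn _)).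
rewrite -sumrB big_ord_recl/= !bin0 !expr0 subrr add0r; apply: eq_bigr => j _.
rewrite /bump/= add1n /cutoff_coef.
have -> : expR (- (2 * (j.+1 * N)%:R) * v) = y ^+ j.+1.
  by rewrite /y -expRM_natl; congr expR; rewrite natrM; ring.
by ring.
Qed.

Lemma geometric_sum_le (x : R) (M : nat) : 0 <= x <= 2^-1 -> \sum_(j < M) x ^+ j.+1 <= 2 * x.
Proof.
move=> /andP[x0 x1].
have H : \sum_(j < M) x ^+ j.+1 <= x * (2 - 2 * 2^-1 ^+ M).
  elim: M => [|M ih]; first by rewrite big_ord0 expr0 mulr1 subrr mulr0.
  rewrite big_ord_recr/=; apply: (le_trans (lerD ih (_ : _ <= x * 2^-1 ^+ M))).
    by rewrite exprS ler_wpM2l// lerXn2r ?nnegrE.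
  by rewrite -mulrDr exprS ler_wpM2l//; lra.
apply: le_trans H _; rewrite mulrC ler_wpM2r// gerBl mulr_ge0// exprn_ge0//; lra.
Qed.

(** The coefficients are at most 2 M ^ j.+1 with M <= 2 N exp (2 N t'), and the exponentials
    contribute exp (- 2 N l) ^ j.+1. As t' < l the sum is dominated by a geometric series of ratio
    x, in which 4 ^ dg absorbs the powers of j.+1. *)
Lemma cutoff_weight_le t t' (l C : R) (dg : nat) : 0 <= t -> t <= t' -> t' < l -> 0 <= C ->
  exists B : R, exists N0 : nat, forall N, (N0 <= N)%N -> (0 < N)%N ->
  weight (fun j : 'I_(cutoff_degree t' N) => (j.+1 * N)%:R)
    (fun j => (C * (j.+1 * N)%:R ^+ dg) ^+ 2) (@cutoff_coef t t' N) l <= B / N%:R.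
Proof.
move=> t0 tt tl C0.
have t'0 := le_trans t0 tt.
pose d := l - t'; have d0 : 0 < d by rewrite subr_gt0.
(* In exp y >= y ^ K / K! this exponent beats N ^ (2 dg) from the squared weights and N from M, and
   leaves 1 / N. *)
pose K := (dg + dg).+2.
pose A : R := 2 * 4 ^+ dg * K`!%:R / (2 * d) ^+ K.
have A0 : 0 <= A.
  apply: divr_ge0; first by rewrite !mulr_ge0 ?exprn_ge0.
  by apply: exprn_ge0; apply: mulr_ge0 => //; exact: ltW.
exists (4 * C ^+ 2 * A), (Num.truncn (2 * A)).+1 => N N0N Np.
have NR : 0 < N%:R :> R by rewrite ltr0n.
have NR1 : 1 <= N%:R :> R by rewrite ler1n.
set M := cutoff_degree t' N.
pose x : R := M%:R * 4 ^+ dg * expR (- (2 * N%:R) * l).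
have x0 : 0 <= x by rewrite !mulr_ge0 ?expR_ge0 ?exprn_ge0.
have xA : N%:R ^+ (dg + dg) * x <= A / N%:R.
  have h1 : x <= 2 * N%:R * 4 ^+ dg * (expR (2 * N%:R * d))^-1.
    apply: (@le_trans _ _ (2 * N%:R * expR (2 * N%:R * t') * 4 ^+ dg * expR (- (2 * N%:R) * l))).
      by rewrite ler_wpM2r ?expR_ge0// ler_wpM2r ?exprn_ge0// cutoff_degree_le.
    rewrite -expRN le_eqVlt; apply/orP; left; apply/eqP.
    have -> : expR (- (2 * N%:R * d)) = expR (2 * N%:R * t') * expR (- (2 * N%:R) * l).
      by rewrite -expRD /d; congr expR; ring.
    by ring.
  have y0 : 0 <= 2 * N%:R * d by rewrite !mulr_ge0// ltW.
  have yp : 0 < (2 * N%:R * d) ^+ K / K`!%:R.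
    by rewrite divr_gt0 ?exprn_gt0 ?mulr_gt0// ltr0n fact_gt0.
  have h2 : (expR (2 * N%:R * d))^-1 <= K`!%:R / (2 * N%:R * d) ^+ K.
    rewrite -[leRHS]invrK invf_div lef_pV2 ?posrE ?expR_gt0//.
    by have := expR_ge1Dxn (dg + dg).+1 y0; rewrite -/K; lra.
  apply: (@le_trans _ _ (N%:R ^+ (dg + dg) * (2 * N%:R * 4 ^+ dg * (K`!%:R / (2 * N%:R * d) ^+ K)))).
    rewrite ler_wpM2l ?exprn_ge0//; apply: le_trans h1 _.
    by rewrite ler_wpM2l// !mulr_ge0 ?exprn_ge0.
  rewrite /A /K !exprMn !exprS le_eqVlt; apply/orP; left; apply/eqP.
  by field; rewrite !expf_neq0 ?gt_eqF.
have x2 : x <= 2^-1.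
  apply: (@le_trans _ _ (A / N%:R)).
    by apply: le_trans xA; rewrite ler_peMl// exprn_ege1.
  rewrite ler_pdivrMr//.
  have : 2 * A <= N%:R by apply: le_trans (ltW (truncnS_gt _)) _; rewrite ler_nat.
  lra.
apply: (@le_trans _ _ (\sum_(j < M) 2 * C ^+ 2 * N%:R ^+ (dg + dg) * x ^+ j.+1)).
  apply: ler_sum => j _.
  have cj : `|cutoff_coef t (j : 'I_(cutoff_degree t' N))| <= 2 * M%:R ^+ j.+1.
    rewrite /cutoff_coef normrM normrX normrN1 expr1n mulr1.
    apply: le_trans (ler_normB _ _) _; rewrite !ger0_norm// mulr_natl mulr2n.
    have bM : 'C(M, j.+1)%:R <= M%:R ^+ j.+1 :> R.
      by rewrite -natrX ler_nat bin_le_expn.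
    apply: lerD => //; apply: le_trans bM.
    by rewrite ler_nat leq_bin2l// cutoff_degree_homo.
  have ej : expR (- (2 * (j.+1 * N)%:R) * l) = expR (- (2 * N%:R) * l) ^+ j.+1.
    by rewrite -expRM_natl; congr expR; rewrite natrM; ring.
  rewrite ej natrM.
  have jj : (j.+1%:R ^+ dg) ^+ 2 <= (4 ^+ dg) ^+ j.+1 :> R.
    have -> : (4 ^+ dg) ^+ j.+1 = ((2 ^+ j.+1) ^+ dg) ^+ 2 :> R.
      rewrite (_ : 4 = 2 ^+ 2 :> R); last by rewrite -natrX.
      by rewrite -!exprM; congr (_ ^+ _); rewrite mulnC -mulnA mulnCA.
    have j2 : j.+1%:R <= 2 ^+ j.+1 :> R by rewrite -natrX ler_nat ltnW// ltn_expl.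
    by rewrite !(lerXn2r, nnegrE, exprn_ge0, ler0n).
  rewrite [leLHS](_ : _ = `|cutoff_coef t (j : 'I_(cutoff_degree t' N))| *
     ((j.+1%:R ^+ dg) ^+ 2 * (C ^+ 2 * N%:R ^+ (dg + dg) * expR (- (2 * N%:R) * l) ^+ j.+1))); last first.
    by rewrite !exprMn exprD; ring.
  apply: (@le_trans _ _ (2 * M%:R ^+ j.+1 * ((4 ^+ dg) ^+ j.+1 *
     (C ^+ 2 * N%:R ^+ (dg + dg) * expR (- (2 * N%:R) * l) ^+ j.+1)))).
    have p1 : 0 <= C ^+ 2 * N%:R ^+ (dg + dg) * expR (- (2 * N%:R) * l) ^+ j.+1.
      by rewrite !mulr_ge0 ?exprn_ge0 ?expR_ge0.
    apply: ler_pM => //; first by rewrite mulr_ge0 ?sqr_ge0.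
    exact: ler_wpM2r.
  by rewrite /x !exprMn le_eqVlt; apply/orP; left; apply/eqP; ring.
rewrite -mulr_sumr.
have p2 : 0 <= 2 * C ^+ 2 * N%:R ^+ (dg + dg) by rewrite !mulr_ge0 ?exprn_ge0 ?sqr_ge0.
apply: (le_trans (ler_wpM2l p2 (geometric_sum_le M _))); first by rewrite x0.
rewrite [leLHS](_ : _ = 4 * C ^+ 2 * (N%:R ^+ (dg + dg) * x)); last by ring.
by rewrite -[leRHS]mulrA ler_wpM2l// mulr_ge0 ?sqr_ge0.
Qed.

End cutoff.

(** * Dominated convergence and Lebesgue differentiation *)

Section limits.
Context {R : realType}.
Notation mu := (@lebesgue_measure R).

Lemma int_dominated_cvg (a b : R) (p : R -> R) (f_ : nat -> R -> R) (f : R -> R) :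
  ig a b p -> (forall n, bm a b (f_ n)) -> bm a b f ->
  (forall n x, a < x <= b -> `|f_ n x| <= 1) ->
  (forall x, a < x <= b -> (fun n => f_ n x) @ \oo --> f x) ->
  (fun n => int a b (fun x => p x * f_ n x)) @ \oo --> int a b (fun x => p x * f x).
Proof.
move=> pi_ fb_ fb f1 ff.
have pfi n : ig a b (fun x => p x * f_ n x) by exact: ig_bmM.
have pf : ig a b (fun x => p x * f x) by exact: ig_bmM.
have mf_ n : measurable_fun `]a, b] (fun x => (p x * f_ n x)%:E).
  apply/measurable_EFinP; exact: ig_meas (pfi n).
have mf : measurable_fun `]a, b] (fun x => (p x * f x)%:E).
  apply/measurable_EFinP; exact: ig_meas pf.
have cv : {ae mu, forall x, `]a, b]%classic x -> (fun n => (p x * f_ n x)%:E) @ \oo --> (p x * f x)%:E}.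
  apply: aeW => x /=; rewrite in_itv/= => xab; apply: cvg_EFin.
    exact: nearW.
  by apply: cvgM; [exact: cvg_cst|exact: ff].
have dom : {ae mu, forall x n, `]a, b]%classic x -> (`|(p x * f_ n x)%:E| <= `|p x|%:E)%E}.
  apply: aeW => x n /=; rewrite in_itv/= => xab.
  by rewrite lee_fin normrM ler_piMr// f1.
have [//|_ _ H] := @dominated_convergence _ _ _ mu `]a, b] _ _ _ _ mf_ mf cv (ig_norm pi_) dom.
have pff : (\int[mu]_(x in `]a, b]) (p x * f x)%:E)%E = (int a b (fun x => p x * f x))%:E.
  by rewrite /int /Rintegral fineK//; exact: (integrable_fin_num _ pf).
rewrite pff in H; have /fine_cvgP[_] := H.
by apply: cvg_trans; apply: near_eq_cvg; near=> n.
Unshelve. all: by end_near.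
Qed.

(** By Lebesgue differentiation p is almost everywhere the derivative of its primitive, so |p| <= L
    almost everywhere. The endpoint e is discarded as a null set to make two-sided difference
    quotients available. *)
Lemma lipschitz_primitive_int_le (b e L : R) (p : R -> R) : b < e -> 0 <= L -> ig b e p ->
  (forall x y, b <= x -> x <= y -> y < e -> `|int x y p| <= L * (y - x)) ->
  int b e (fun x => `|p x|) <= L * (e - b).
Proof.
move=> be L0 pi_ pL.
pose f := p \_ `]b, e].
have fi : mu.-integrable setT (EFin \o f).
  move: (pi_); rewrite /ig => h; move: h.
  by rewrite integrable_mkcond//= (restrict_EFin p).
have fint y : mu.-integrable `]b, y] (EFin \o f) by exact: integrableS fi.
have loc : locally_integrable [set: R] f by exact: integrable_locally.
have H := @FTC1 _ f (BRight b) fint loc.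
set F := fun x => (\int[mu]_(t in `]b, x]) f t)%R in H.
have FE x y : b <= x -> x <= y -> y <= e -> F y - F x = int x y p.
  move=> bx xy ye; have fi' : ig b e f by exact: fint.
  rewrite -[F y - F x]/(int b y f - int b x f) (@int_chasles _ b x y) ?bx//; last exact: igS fi'.
  rewrite addrC addKr; apply: eq_int => t /andP[xt ty].
  by rewrite /f patchE mem_set//= in_itv/= (le_lt_trans bx xt) (le_trans ty ye).
have bound : {ae mu, forall x, `]b, e]%classic x -> (`|(p x)%:E| <= L%:E)%E}.
  have e0 : mu [set e] = 0 by rewrite lebesgue_measure_set1.
  have He : {ae mu, forall x, x <> e}.
    by exists [set e]; split => // x /= /contrapT.
  move: H He; apply: filterS2; first exact: (ae_filter_ringOfSetsType mu).
  move=> x H xe /=; rewrite in_itv/= => /andP[bx xle].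
  have {}xe : x < e by rewrite lt_neqAle xle andbT; apply/eqP.
  have [dF F'] := H bx.
  rewrite lee_fin.
  have -> : p x = f x by rewrite /f patchE mem_set//= in_itv/= bx xle.
  rewrite -F' derive1E.
  have C : (fun h : R => h^-1 *: (F (h *: 1 + x) - F x)) @ 0^' --> 'D_1 F x by exact: dF.
  apply: (cvgr_to_le (cvg_norm C)); near=> h.
  have h0 : h != 0 by near: h; exact: nbhs_dnbhs_neq.
  have hsm : `|h| < Num.min (x - b) (e - x).
    by near: h; apply: dnbhs0_lt; rewrite lt_min !subr_gt0 bx xe.
  rewrite /GRing.scale/= mulr1 normrM normfV mulrC ler_pdivrMr ?normr_gt0//.
  move: hsm; rewrite lt_min => /andP[h1 h2].
  have [hp|hn] := leP 0 h.
    rewrite (ger0_norm hp) in h1 h2 *.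
    rewrite FE ?(ltW bx) ?lerDr//; last lra.
    apply: le_trans (pL _ _ _ _ _) _; rewrite ?(ltW bx) ?lerDr ?addrK//; lra.
  rewrite (ltr0_norm hn) in h1 h2 *.
  rewrite distrC FE; [|lra..].
  by apply: le_trans (pL _ _ _ _ _) _; [lra|lra|exact: xe|lra].
have mp : measurable_fun `]b, e] (fun x => (p x)%:E).
  apply/measurable_EFinP; exact: ig_meas pi_.
have L0' : (0%R <= L%:E)%E by rewrite lee_fin.
have := @integral_le_bound _ _ _ mu `]b, e] _ L%:E _ mp L0' bound.
move=> /(_ (measurable_itv _)).
rewrite /= lebesgue_measure_itv/= lte_fin be -EFinB -EFinM => h.
rewrite -lee_fin; apply: le_trans h.
have np := ig_norm pi_.
by rewrite /int /Rintegral fineK//; exact: (integrable_fin_num _ np).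
Unshelve. all: by end_near.
Qed.

End limits.

(** * Vanishing of p on a short interval to the right of b *)

Section local_uniqueness.
Context {R : realType}.
Variables (b e : R) (q qt p : R -> R) (C : R) (dg N0 : nat).
Hypotheses (be : b < e) (qi : ig b e q) (qti : ig b e qt) (p_i : ig b e p).
Let l := e - b.
Hypothesis lq : l * int b e (fun t => `|q t|) <= 2^-1.
Hypothesis lqt : l * int b e (fun t => `|qt t|) <= 2^-1.
Hypothesis C1 : 1 <= C.
Hypothesis family : forall k : nat, (N0 <= k)%N -> (0 < k)%N ->
  exists m n mt nt : R -> R,
  [/\ [/\ AC b e m n, AC b e n (fun t => 2 * k%:R * n t + q t * m t),
          AC b e mt nt & AC b e nt (fun t => 2 * k%:R * nt t + qt t * mt t)],
      m b = 1 /\ mt b = 1,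
      forall x, b <= x <= e -> `|m x| <= C * k%:R ^+ dg /\ `|mt x| <= C * k%:R ^+ dg,
      `|n e| <= C * k%:R ^+ dg /\ `|nt e| <= C * k%:R ^+ dg &
      `|int b e (fun x => p x * (expR (- (2 * k%:R) * (x - b)) * (m x * mt x)))|
        <= C * k%:R ^+ dg * expR (- (2 * k%:R) * l)].
Let Nq := 5 + 2 * int b e (fun t => `|q t|).
Let Nqt := 5 + 2 * int b e (fun t => `|qt t|).
Let K := Nq * (1 + l * Nqt) + Nqt.
Let l0 : 0 < l. Proof. by rewrite subr_gt0. Qed.
Let K0 : 0 < K.
Proof.
have h1 : 0 <= int b e (fun t => `|q t|) by apply: int_ge0.
have h2 : 0 <= int b e (fun t => `|qt t|) by apply: int_ge0.
have n1 : 0 <= Nq by rewrite /Nq; lra.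
have n2 : 0 < Nqt by rewrite /Nqt; lra.
rewrite /K ltr_wpDl// mulr_ge0// addr_ge0// mulr_ge0// ltW//.
Qed.

Lemma cutoff_bm (t s : R) N x y : bm x y (fun v => cutoff t N (v - s)).
Proof.
rewrite /cutoff; elim: (cutoff_degree t N) => [|M ih].
  by apply: eq_bm (bm_cst x y 1) => v _; rewrite expr0.
apply: eq_bm (bmM _ ih) => [v _|]; first by rewrite exprS.
apply: bmB; first exact: bm_cst.
apply: bm_expR; apply: bmZ; apply: bmB; [exact: bm_id|exact: bm_cst].
Qed.

Let step (t v : R) : R := if v <= t then 0 else 1.

Let step_bm (t s x y : R) : bm x y (fun v => step t (v - s)).
Proof.
split; last by exists 1 => v _; rewrite /step; case: ifP; rewrite ?normr0 ?normr1.
apply: measurable_funTS; apply: measurable_fun_ifT; [|exact: measurable_cst..].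
apply: measurable_fun_ler; last exact: measurable_cst.
by apply: measurable_funB; [exact: measurable_id|exact: measurable_cst].
Qed.

(** Apply [dirichlet_functional_bound] to the polynomials tending to the indicator of ]t1, t2]. As N
    grows the weight tends to 0, the tail integral from 0 to t2 - t1, and the tail integral from t >
    t2 to 0, so p beyond b + t drops out. *)
Lemma primitive_bound (t1 t2 t : R) : 0 <= t1 -> t1 <= t2 -> t2 < t -> t < l ->
  `|int (b + t1) (b + t2) p| <= K * int b (b + t) (fun x => `|p x|) * (t2 - t1).
Proof.
move=> t10 t12 t2t tl.
have t20 := le_trans t10 t12; have t0 : 0 <= t := le_trans t20 (ltW t2t).
have t2l := lt_trans t2t tl.
have C0 : 0 <= C := le_trans ler01 C1.
pose g N v : R := cutoff t1 N v - cutoff t2 N v.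
pose ch v := step t1 v - step t2 v.
have gb s x y N : bm x y (fun v => g N (v - s)) by apply: bmB; exact: cutoff_bm.
have gb0 x y N : bm x y (g N) by apply: eq_bm (gb 0 x y N) => v _; rewrite subr0.
have chb s x y : bm x y (fun v => ch (v - s)) by apply: bmB; exact: step_bm.
have chb0 x y : bm x y ch by apply: eq_bm (chb 0 x y) => v _; rewrite subr0.
have g1 N v : 0 <= v -> `|g N v| <= 1.
  move=> v0; have /andP[h1 h2] := cutoff_itv t1 N v0; have /andP[h3 h4] := cutoff_itv t2 N v0.
  by rewrite ler_norml /g; apply/andP; split; lra.
have gc v : 0 <= v -> (fun N => g N v) @ \oo --> ch v.
  by move=> v0; apply: cvgB; exact: cutoff_cvg.
have lim1 : (fun N => int b e (fun x => p x * g N (x - b))) @ \oo -->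
    int b e (fun x => p x * ch (x - b)).
  apply: int_dominated_cvg => //.
  - by move=> n x /andP[bx _]; apply: g1; rewrite subr_ge0 ltW.
  - by move=> x /andP[bx _]; apply: gc; rewrite subr_ge0 ltW.
have lim2 s : 0 <= s -> (fun N => int s l (fun v => `|g N v|)) @ \oo --> int s l (fun v => `|ch v|).
  move=> s0.
  have H : (fun N => int s l (fun v => 1 * `|g N v|)) @ \oo --> int s l (fun v => 1 * `|ch v|).
    apply: (@int_dominated_cvg _ s l (fun=> 1) (fun N v => `|g N v|) (fun v => `|ch v|)).
    - exact: bm_ig (bm_cst _ _ _).
    - by move=> n; exact: bm_norm.
    - exact: bm_norm.
    - by move=> n x /andP[sx _]; rewrite normr_id; apply: g1; exact: ltW (le_lt_trans s0 sx).
    - by move=> x /andP[sx _]; apply: cvg_norm; apply: gc; exact: ltW (le_lt_trans s0 sx).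
  have e1 (h : R -> R) : int s l (fun v => 1 * h v) = int s l h.
    by apply: eq_int => v _; rewrite mul1r.
  rewrite e1 in H; apply: cvg_trans H; apply: near_eq_cvg; near=> N.
  by rewrite -[RHS]e1.
have ch0 v : t2 < v -> ch v = 0.
  by move=> v2; rewrite /ch /step !leNgt v2 (le_lt_trans t12 v2)/= subrr.
have ch1 v : t1 < v <= t2 -> ch v = 1.
  by move=> /andP[v1 v2]; rewrite /ch /step leNgt v1 v2/= subr0.
have ch2 v : v <= t1 -> ch v = 0.
  by move=> v1; rewrite /ch /step v1 (le_trans v1 t12) subrr.
have int_t : int t l (fun v => `|ch v|) = 0.
  rewrite -[RHS](int0 t l); apply: eq_int => v /andP[tv _].
  by rewrite ch0 ?normr0//; exact: lt_trans t2t tv.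
have int_0 : int 0 l (fun v => `|ch v|) = t2 - t1.
  have ci x y : ig x y (fun v => `|ch v|) by apply: bm_ig; exact: bm_norm.
  rewrite (@int_chasles _ 0 t1 l) ?t10 ?(le_trans t12 (ltW t2l))//.
  rewrite (@int_chasles _ t1 t2 l) ?t12 ?(ltW t2l)//.
  rewrite (@eq_int _ 0 t1 _ (fun=> 0)); last by move=> v /andP[_ v1]; rewrite ch2 ?normr0.
  rewrite (@eq_int _ t1 t2 _ (fun=> 1)); last by move=> v v12; rewrite ch1 ?normr1.
  rewrite (@eq_int _ t2 l _ (fun=> 0)); last by move=> v /andP[v1 _]; rewrite ch0 ?normr0.
  by rewrite !int0 int_cst// mul1r add0r addr0.
have int_p : int b e (fun x => p x * ch (x - b)) = int (b + t1) (b + t2) p.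
  have ci : ig b e (fun x => p x * ch (x - b)) by exact: ig_bmM.
  have h1 : b <= b + t1 by rewrite lerDl.
  have h2 : b + t1 <= b + t2 by rewrite lerD2l.
  have h3 : b + t2 <= e by move: t2l; rewrite /l; lra.
  rewrite (@int_chasles _ b (b + t1) e) ?h1 ?(le_trans h2 h3)//.
  rewrite (@int_chasles _ (b + t1) (b + t2) e) ?h2 ?h3//; last exact: igS ci.
  rewrite (@eq_int _ b (b + t1) _ (fun=> 0)); last first.
    by move=> v /andP[_ v1]; rewrite ch2 ?mulr0// lerBlDl.
  rewrite (@eq_int _ (b + t1) (b + t2) _ p); last first.
    by move=> v /andP[v1 v2]; rewrite ch1 ?mulr1// ltrBrDl v1 lerBlDl.
  rewrite (@eq_int _ (b + t2) e _ (fun=> 0)); last first.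
    by move=> v /andP[v1 _]; rewrite ch0 ?mulr0// ltrBrDl.
  by rewrite !int0 add0r addr0.
have [B [N1 HB]] := @cutoff_weight_le _ t1 t2 l C dg t10 t12 t2l C0.
pose w N := weight (fun j : 'I_(cutoff_degree t2 N) => (j.+1 * N)%:R)
    (fun j => (C * (j.+1 * N)%:R ^+ dg) ^+ 2) (@cutoff_coef _ t1 t2 N) l.
have w0 : w @ \oo --> 0.
  apply: (@inv_nat_cvg _ w 0 B N1) => N N1N Np; rewrite subr0 ger0_norm; first exact: HB.
  by apply: weight_ge0 => j; exact: sqr_ge0.
pose PA := int b (b + t) (fun x => `|p x|); pose PB := int (b + t) e (fun x => `|p x|).
have ineq : \forall N \near \oo, `|int b e (fun x => p x * g N (x - b))| <=
    w N + K * ((int 0 l (fun v => `|g N v|) + w N) * PA + (int t l (fun v => `|g N v|) + w N) * PB).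
  exists (maxn N0 1) => // N /=; rewrite geq_max => /andP[N0N Np].
  pose J := cutoff_degree t2 N.
  have kN (j : 'I_J) : (N0 <= j.+1 * N)%N /\ (0 < j.+1 * N)%N.
    split; last by rewrite muln_gt0.
    by apply: leq_trans N0N _; rewrite mulSn leq_addr.
  have fam (j : 'I_J) : exists F : (R -> R) * (R -> R) * (R -> R) * (R -> R),
    let: (m, n, mt, nt) := F in
    [/\ [/\ AC b e m n, AC b e n (fun t => 2 * (j.+1 * N)%:R * n t + q t * m t),
          AC b e mt nt & AC b e nt (fun t => 2 * (j.+1 * N)%:R * nt t + qt t * mt t)],
      m b = 1 /\ mt b = 1,
      forall x, b <= x <= e -> `|m x| <= C * (j.+1 * N)%:R ^+ dg /\ `|mt x| <= C * (j.+1 * N)%:R ^+ dg,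
      `|n e| <= C * (j.+1 * N)%:R ^+ dg /\ `|nt e| <= C * (j.+1 * N)%:R ^+ dg &
      `|int b e (fun x => p x * (expR (- (2 * (j.+1 * N)%:R) * (x - b)) * (m x * mt x)))|
        <= C * (j.+1 * N)%:R ^+ dg * expR (- (2 * (j.+1 * N)%:R) * l)].
    have [m [n [mt [nt H]]]] := family (kN j).1 (kN j).2.
    by exists (m, n, mt, nt).
  have [F HF] := choice fam.
  pose m j := (F j).1.1.1; pose n j := (F j).1.1.2; pose mt j := (F j).1.2; pose nt j := (F j).2.
  have {}HF (j : 'I_J) : [/\ [/\ AC b e (m j) (n j), AC b e (n j) (fun t => 2 * (j.+1 * N)%:R * n j t + q t * m j t),
          AC b e (mt j) (nt j) & AC b e (nt j) (fun t => 2 * (j.+1 * N)%:R * nt j t + qt t * mt j t)],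
      m j b = 1 /\ mt j b = 1,
      forall x, b <= x <= e -> `|m j x| <= C * (j.+1 * N)%:R ^+ dg /\ `|mt j x| <= C * (j.+1 * N)%:R ^+ dg,
      `|n j e| <= C * (j.+1 * N)%:R ^+ dg /\ `|nt j e| <= C * (j.+1 * N)%:R ^+ dg &
      `|int b e (fun x => p x * (expR (- (2 * (j.+1 * N)%:R) * (x - b)) * (m j x * mt j x)))|
        <= C * (j.+1 * N)%:R ^+ dg * expR (- (2 * (j.+1 * N)%:R) * l)].
    by move: (HF j); rewrite /m /n /mt /nt; case: (F j) => [[[? ?] ?] ?].
  have kk1 (j : 'I_J) : 1 <= (j.+1 * N)%:R :> R by rewrite ler1n; exact: (kN j).2.
  have W1 (j : 'I_J) : 1 <= C * (j.+1 * N)%:R ^+ dg.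
    by rewrite -[leLHS]mulr1 ler_pM// exprn_ege1.
  have t0l : 0 <= t <= e - b by rewrite t0 ltW.
  have := @dirichlet_functional_bound _ b e J (fun j => (j.+1 * N)%:R)
    (fun j => C * (j.+1 * N)%:R ^+ dg) q qt p be kk1 W1 qi qti p_i lq lqt m n mt nt.
  move=> /(_ _ _ _ _ _ _ _ _ _ _ (@cutoff_coef _ t1 t2 N) t t0l).
  have dE v : dirichlet (fun j : 'I_J => (j.+1 * N)%:R) (@cutoff_coef _ t1 t2 N) v = g N v.
    by rewrite -cutoff_dirichlet.
  have tE s : tailint b e (fun j : 'I_J => (j.+1 * N)%:R) (@cutoff_coef _ t1 t2 N) s =
      int s l (fun v => `|g N v|).
    by apply: eq_int => v _; rewrite dE.
  rewrite !tE (@eq_int _ b e (fun x => p x * dirichlet _ _ (x - b)) (fun x => p x * g N (x - b))); last first.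
    by move=> x _; rewrite dE.
  apply.
  - by move=> j; have [[]] := HF j.
  - by move=> j; have [[]] := HF j.
  - by move=> j; have [[]] := HF j.
  - by move=> j; have [[]] := HF j.
  - by move=> j; have [_ []] := HF j.
  - by move=> j; have [_ []] := HF j.
  - by move=> j x xbe; have [_ _ /(_ x xbe)[]] := HF j.
  - by move=> j x xbe; have [_ _ /(_ x xbe)[]] := HF j.
  - by move=> j; have [_ _ _ []] := HF j.
  - by move=> j; have [_ _ _ []] := HF j.
  - by move=> j; have [] := HF j.
have L1 : (fun N => `|int b e (fun x => p x * g N (x - b))|) @ \oo --> `|int (b + t1) (b + t2) p|.
  by rewrite -int_p; apply: cvg_norm; exact: lim1.
have L2 : (fun N => w N + K * ((int 0 l (fun v => `|g N v|) + w N) * PA +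
     (int t l (fun v => `|g N v|) + w N) * PB)) @ \oo -->
    0 + K * ((t2 - t1 + 0) * PA + (0 + 0) * PB).
  apply: cvgD => //; apply: cvgM; first exact: cvg_cst.
  apply: cvgD; apply: cvgM; try exact: cvg_cst; apply: cvgD => //.
    by rewrite -int_0; exact: lim2.
  by rewrite -int_t; exact: lim2.
have L3 : (fun N => `|int b e (fun x => p x * g N (x - b))| - (w N + K * ((int 0 l (fun v => `|g N v|) + w N) * PA +
     (int t l (fun v => `|g N v|) + w N) * PB))) @ \oo -->
    `|int (b + t1) (b + t2) p| - (0 + K * ((t2 - t1 + 0) * PA + (0 + 0) * PB)).
  by apply: cvgB; [exact: L1|exact: L2].
have : `|int (b + t1) (b + t2) p| - (0 + K * ((t2 - t1 + 0) * PA + (0 + 0) * PB)) <= 0.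
  apply: (@cvgr_to_le _ _ _ _ _ _ _ L3); near=> N; rewrite subr_le0.
  by near: N; exact: ineq.
by rewrite subr_le0 !addr0 add0r mul0r addr0 -mulrA [(t2 - t1) * _]mulrC.
Unshelve. all: by end_near.
Qed.

Lemma local_vanish : exists2 t : R, 0 < t <= l & int b (b + t) (fun x => `|p x|) = 0.
Proof.
(* With K t <= 1/2 the Lipschitz bound K A on the primitive gives A <= K A t <= A / 2 for A the
   integral of |p| over [b, b + t]. *)
pose t := Num.min (l / 2) (2 * K)^-1.
have t0 : 0 < t by rewrite lt_min divr_gt0// invr_gt0 mulr_gt0.
have tl : t < l.
  by rewrite (le_lt_trans (_ : t <= l / 2))// ?ge_min ?lexx//; have := l0; lra.
have tK : K * t <= 2^-1.
  apply: (@le_trans _ _ (K * (2 * K)^-1)).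
    by rewrite ler_wpM2l ?(ltW K0)// ge_min lexx orbT.
  by rewrite invfM mulrCA divff ?mulr1// gt_eqF.
exists t; first by rewrite t0 ltW.
set A := int b (b + t) (fun x => `|p x|).
have A0 : 0 <= A by apply: int_ge0.
have bt : b < b + t by rewrite ltrDl.
have bte : b + t <= e by move: tl; rewrite /l; lra.
have pt : ig b (b + t) p by exact: igS p_i.
have := @lipschitz_primitive_int_le _ b (b + t) (K * A) p bt _ pt.
rewrite -/A (addrC b t) addrK (addrC t b) => H.
have {}H : A <= K * A * t.
  apply: H; first by rewrite mulr_ge0// ltW.
  move=> x y bx xy yt.
  have := @primitive_bound (x - b) (y - b) t.
  rewrite (_ : b + (x - b) = x); last by ring.
  rewrite (_ : b + (y - b) = y); last by ring.
  rewrite (_ : y - b - (x - b) = y - x); last by ring.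
  by apply => //; lra.
have h2 : A * (K * t) <= A * 2^-1 by rewrite ler_wpM2l.
by apply/eqP; rewrite eq_le A0 andbT; lra.
Qed.

End local_uniqueness.

(** * Decay of the Weyl solution *)

Section weyl_decay.
Context {R : realType}.
Variables (T : R) (q rho : R -> R) (rmin : R).
Hypotheses (T0 : 0 < T) (qi : ig 0 T q) (q2i : ig 0 T (fun x => q x ^+ 2)).
Hypotheses (rhob : bm 0 T rho) (rmin0 : 0 < rmin).
Hypothesis rho_ge : forall x, 0 < x <= T -> rmin <= rho x.
Implicit Types (z a b e c : R) (u v : R -> R).
Let sol := sol T q rho.

(** The energy over [a, T] is - u(a) u'(a), so coercivity gives the sign. If u(a) were 0, then u and
    u' would vanish at T, and the Wronskian with the solution of data (1, 0) at 0 would contradict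
    u'(0) = - 1. The bound on u' / u is a comparison of energies: u has least energy among functions
    with its boundary values. *)
Lemma weyl_logderiv a : 0 <= a -> a < T -> exists2 C : R, 0 <= C & exists Z : R,
  forall z u u1, z <= - Z -> sol z (fun=> 0) u u1 -> u T = 0 -> u1 0 = -1 ->
  [/\ u a != 0, u a * u1 a <= 0 & `|u1 a| <= C * (1 - z) * `|u a|].
Proof.
move=> a0 aT; have Ta : 0 < T - a by rewrite subr_gt0.
have [C0 C00 HC] := energy_coercive qi rhob rho_ge a0 aT (lexx T).
have qi' : ig a T q by exact: igS qi.
have rb : bm a T rho by exact: bmS rhob.
pose Iq := int a T (fun t => `|q t|); pose Ir := int a T (fun t => `|rho t|).
have Iq0 : 0 <= Iq by apply: int_ge0.
have Ir0 : 0 <= Ir by apply: int_ge0.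
exists ((T - a)^-1 + Iq + Ir); first by rewrite !addr_ge0// invr_ge0 ltW.
exists ((C0 + 1) / rmin) => z u u1 zZ us uT u10.
have z0 : z <= 0.
  by apply: le_trans zZ _; rewrite oppr_le0 divr_ge0 ?addr_ge0// ltW.
have zr : C0 + 1 <= - z * rmin by rewrite -ler_pdivrMr//; lra.
have [ub u1b] := sol_bm T0 us; have [_ Au Au1] := us.
have Aua : AC a T u u1 by apply: AC_sub Au.
have Au1a := AC_sub a0 (lexx T) Au1.
have ub' : bm a T u by exact: bmS ub.
have u1b' : bm a T u1 by exact: bmS u1b.
have E1 := energy_identity T0 a0 (ltW aT) (lexx T) us.
rewrite uT mul0r sub0r in E1.
have Epos v v1 : AC a T v v1 -> bm a T v1 ->
    int a T (fun t => v1 t ^+ 2) / 2 + int a T (fun t => v t ^+ 2) <=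
    int a T (fun t => v1 t ^+ 2 + (q t - z * rho t) * v t ^+ 2).
  move=> Av v1b; apply: le_trans (HC z v v1 z0 Av v1b); rewrite lerD2l ler_peMl//; last lra.
  by apply: int_ge0 => *; exact: sqr_ge0.
have sq0 (v : R -> R) : 0 <= int a T (fun t => v t ^+ 2) by apply: int_ge0 => *; exact: sqr_ge0.
have Eu := Epos u u1 Aua u1b'; rewrite -E1 in Eu.
have ua0 : u a != 0.
  apply/eqP => ua; rewrite ua mul0r oppr0 in Eu.
  have i1 : int a T (fun t => u1 t ^+ 2) = 0 by have := sq0 u1; have := sq0 u; lra.
  have i2 : int a T (fun t => u t ^+ 2) = 0 by have := sq0 u1; have := sq0 u; lra.
  have uz x : a <= x <= T -> u x = 0.
    move=> xaT; have := sup_sq_le aT ltr01 Aua u1b' xaT.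
    rewrite i1 i2 !mulr0 addr0 => h; apply/eqP.
    by rewrite -sqrf_eq0 eq_le h sqr_ge0.
  have u1c x : a <= x <= T -> u1 x = u1 T.
    move=> /andP[ax xT]; apply/eqP; rewrite eq_sym -subr_eq0.
    rewrite (AC_diff Au1a ax xT (lexx T)); apply/eqP; apply: etrans (int0 x T); apply: eq_int => t /andP[xt tT].
    rewrite uz; first by ring.
    by rewrite tT (le_trans ax (ltW xt)).
  have u1T : u1 T = 0.
    move: i1; rewrite (@eq_int _ a T _ (fun=> u1 T ^+ 2)); last first.
      by move=> t /andP[at_ tT]; rewrite u1c// tT ltW.
    rewrite int_cst ?(ltW aT)// => /eqP; rewrite mulf_eq0 sqrf_eq0 (gt_eqF Ta) orbF.
    by move=> /eqP.
  have [y [y1 [ys y0 y10]]] := sol_exists T0 qi q2i rhob z 1 0 (bm_cst 0 T 0).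
  have := lagrange T0 rhob ys us.
  rewrite uT u1T y0 y10 u10 (ipC T rho y (fun=> 0)) !ip0l subrr => h; lra.
have uu1 : u a * u1 a <= 0 by have := sq0 u1; have := sq0 u; lra.
split => //.
(* The affine trial function, 1 at a and 0 at T. Nonnegativity of the energy of u - u(a) y yields -
   u(a) u'(a) <= u(a) ^ 2 times the energy of y. *)
pose y x := (T - a)^-1 * (T - x); pose y1 (x : R) := - (T - a)^-1.
have Ay : AC a T y y1.
  have A1 : AC a T (fun x => x) (fun=> 1).
    by apply: AC_derive; [exact: ltW|move=> x; exact: cvg_cst].
  apply: eq_AC (ACZ (T - a)^-1 (ACB (AC_cst a T T) A1)) => // x _.
  by rewrite /y1 sub0r mulrN1.
have yb : bm a T y by apply: AC_bm Ay; exact: ltW.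
have y1b : bm a T y1 by exact: bm_cst.
have ya : y a = 1 by rewrite /y mulVf// gt_eqF.
have yT : y T = 0 by rewrite /y subrr mulr0.
have Ec := AC_diff (ACM (ltW aT) Ay Au1a) (lexx a) (ltW aT) (lexx T).
rewrite yT ya mul0r mul1r sub0r in Ec.
set k := u a.
have Av : AC a T (fun x => u x - k * y x) (fun x => u1 x - k * y1 x).
  by apply: ACB => //; exact: ACZ.
have vb : bm a T (fun x => u1 x - k * y1 x) by bm_tac.
have h := Epos _ _ Av vb.
have hpos : 0 <= int a T (fun t => (u1 t - k * y1 t) ^+ 2 + (q t - z * rho t) * (u t - k * y t) ^+ 2).
  apply: le_trans h; have := sq0 (fun x => u1 x - k * y1 x); have := sq0 (fun x => u x - k * y x); lra.
have eu : ig a T (fun t => u1 t ^+ 2 + (q t - z * rho t) * u t ^+ 2).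
  exact: (energy_ig qi rhob z a0 (lexx T) ub' u1b').
have ey : ig a T (fun t => y1 t ^+ 2 + (q t - z * rho t) * y t ^+ 2).
  exact: (energy_ig qi rhob z a0 (lexx T) yb y1b).
have ec := AC_ig (ACM (ltW aT) Ay Au1a).
have hE : int a T (fun t => (u1 t - k * y1 t) ^+ 2 + (q t - z * rho t) * (u t - k * y t) ^+ 2) =
   - (u a * u1 a) + 2 * k * u1 a + k ^+ 2 * int a T (fun t => y1 t ^+ 2 + (q t - z * rho t) * y t ^+ 2).
  rewrite E1.
  have -> : 2 * k * u1 a = - (2 * k) * - u1 a by ring.
  rewrite Ec -!intZ// -intD//; last exact: igZ.
  rewrite -intD//; last 2 first.
  - by apply: igD => //; exact: igZ.
  - exact: igZ.
  by apply: eq_int => t _; ring.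
have Ey : int a T (fun t => y1 t ^+ 2 + (q t - z * rho t) * y t ^+ 2) <=
    ((T - a)^-1 + Iq + Ir) * (1 - z).
  apply: (@le_trans _ _ (int a T (fun t => (T - a)^-1 ^+ 2 + (`|q t| + - z * `|rho t|)))).
    apply: le_int => //.
      apply: igD; first exact: bm_ig (bm_cst _ _ _).
      by apply: igD; [exact: ig_norm|apply: igZ; apply: bm_ig; exact: bm_norm].
    move=> t /andP[at_ tT]; rewrite /y1 sqrrN lerD2l.
    have yt0 : 0 <= y t by rewrite mulr_ge0 ?subr_ge0// invr_ge0 ltW.
    have yt1 : y t <= 1 by rewrite /y mulrC ler_pdivrMr// mul1r lerD2l lerN2 ltW.
    have y0' := sqr_ge0 (y t); have y1' : y t ^+ 2 <= 1 by exact: exprn_ile1.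
    apply: (@le_trans _ _ (`|q t - z * rho t| * 1)).
      apply: (@le_trans _ _ (`|q t - z * rho t| * y t ^+ 2)).
        by rewrite ler_wpM2r// ler_norm.
      by rewrite ler_wpM2l.
    rewrite mulr1; apply: le_trans (ler_normB _ _) _; rewrite lerD2l normrM ler_wpM2r//.
    by rewrite ler0_norm.
  have iq := ig_norm qi'; have ir : ig a T (fun t => `|rho t|) by apply: bm_ig; exact: bm_norm.
  rewrite intD; [|exact: bm_ig (bm_cst _ _ _)|by apply: igD => //; exact: igZ].
  rewrite intD//; last exact: igZ.
  rewrite int_cst ?(ltW aT)// intZ// -/Iq -/Ir.
  have -> : (T - a)^-1 ^+ 2 * (T - a) = (T - a)^-1 by field; rewrite gt_eqF.
  have i0 : 0 <= (T - a)^-1 by rewrite invr_ge0 ltW.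
  have h1 : 0 <= - z * (T - a)^-1 by rewrite mulr_ge0// oppr_ge0.
  have h2 : 0 <= - z * Iq by rewrite mulr_ge0// oppr_ge0.
  lra.
rewrite hE /k in hpos.
have uap : 0 < `|u a| by rewrite normr_gt0.
have hn : `|u1 a| * `|u a| = - (u a * u1 a) by rewrite -normrM mulrC ler0_norm.
rewrite -(ler_pM2r uap) hn -[leRHS]mulrA -expr2 real_normK ?num_real//.
have := ler_wpM2l (sqr_ge0 (u a)) Ey; move: hpos.
move: (int a T _) ((T - a)^-1 + Iq + Ir) => I CC hpos hI.
rewrite /k [leRHS](_ : _ = u a ^+ 2 * (CC * (1 - z))); last by ring.
apply: le_trans hI; rewrite -subr_ge0; apply: le_trans hpos _.
by rewrite le_eqVlt; apply/orP; left; apply/eqP; ring.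
Qed.

(** A weighted energy estimate on [b, e]: the boundary term at e has the right sign and the one at b
    is controlled by [weyl_logderiv]. It bounds the normalised solution by a multiple of k; the
    derivative at e costs a further k ^ 2 through the logarithmic derivative, hence the exponent
    3. *)
Lemma weyl_decay b e c : 0 <= b -> b < e -> e < T -> 0 < c ->
  (forall x, b < x <= e -> rho x = c ^+ 2) ->
  exists2 C : R, 1 <= C & exists N0 : nat, forall (k : nat) u u1, (N0 <= k)%N -> (0 < k)%N ->
  sol (- (k%:R / c) ^+ 2) (fun=> 0) u u1 -> u T = 0 -> u1 0 = -1 ->
  [/\ u b != 0,
    forall x, b <= x <= e -> `|expR (k%:R * (x - b)) * u x / u b| <= C * k%:R ^+ 3 &
    `|expR (k%:R * (e - b)) * u1 e / u b| <= C * k%:R ^+ 3].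
Proof.
move=> b0 be eT c0 rc.
have bT := lt_trans be eT; have e0 := le_trans b0 (ltW be).
have [Cb Cb0 [Zb HZb]] := weyl_logderiv b0 bT.
have [Ce Ce0 [Ze HZe]] := weyl_logderiv e0 eT.
have qi' : ig b e q by apply: igS qi => //; exact: ltW.
have [Cq Cq0 HCq] := potential_form_bound be qi'.
have l0 : 0 < e - b by rewrite subr_gt0.
pose D := 1 + (c ^+ 2)^-1.
have c20 : 0 <= (c ^+ 2)^-1 by rewrite invr_ge0 sqr_ge0.
have D1 : 1 <= D by rewrite lerDl.
pose B := 2 * ((e - b)^-1 + 2) * (Cb * D) * expR (2 * (e - b)).
have B0 : 0 <= B.
  rewrite !mulr_ge0 ?expR_ge0// ?addr_ge0// ?invr_ge0//; exact: ltW.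
exists ((1 + B) * (1 + Ce * D)).
  rewrite -[leLHS]mulr1 ler_pM//; first by rewrite lerDl.
  by rewrite lerDl mulr_ge0// addr_ge0.
exists (Num.truncn (c ^+ 2 * (`|Zb| + `|Ze|)) + Num.truncn (Cq + 2)).+2 => k u u1 kN kp us uT u10.
have kR1 : 1 <= k%:R :> R by rewrite ler1n.
have kR : 0 < k%:R :> R by rewrite ltr0n.
set z := - (k%:R / c) ^+ 2.
have zE : - z = k%:R ^+ 2 * (c ^+ 2)^-1 by rewrite /z opprK exprMn exprVn.
have k2 : k%:R <= k%:R ^+ 2 :> R by rewrite expr2 ler_peMl// ltW.
have kZ : c ^+ 2 * (`|Zb| + `|Ze|) <= k%:R.
  apply: le_trans (ltW (truncnS_gt _)) _; rewrite ler_nat; apply: leq_trans kN.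
  by rewrite ltnS ltnW// ltnS leq_addr.
have kq : Cq + 2 <= k%:R.
  apply: le_trans (ltW (truncnS_gt _)) _; rewrite ler_nat; apply: leq_trans kN.
  by rewrite ltnS ltnW// ltnS leq_addl.
have zZ : `|Zb| + `|Ze| <= - z.
  rewrite zE ler_pdivlMr ?exprn_gt0// mulrC; exact: le_trans kZ k2.
have zb : z <= - Zb by have := ler_norm Zb; have := normr_ge0 Ze; lra.
have ze : z <= - Ze by have := ler_norm Ze; have := normr_ge0 Zb; lra.
have [ub0 _ ubd] := HZb z u u1 zb us uT u10.
have [ue0 ue1 ued] := HZe z u u1 ze us uT u10.
have zD : 1 - z <= D * k%:R ^+ 2.
  by rewrite /D mulrDl mul1r zE [_^-1 * _]mulrC lerD2r (le_trans kR1 k2).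
have [_ Au Au1] := us.
have Aub : AC b e u u1 by apply: AC_sub Au => //; exact: ltW.
have Au1b := AC_sub b0 (ltW eT) Au1.
have ubm := AC_bm (ltW be) Aub; have u1bm := AC_bm (ltW be) Au1b.
(* The weight exp ((k - 1)(x - b)) leaves q + k ^ 2 - (k - 1) ^ 2 = q + 2 k - 1 as potential, and 2
   k - 1 dominates q for large k. The missing factor exp (x - b) is bounded. *)
pose t : R := k%:R - 1.
pose E x := expR (t * x + - (t * b)).
have AE : AC b e E (fun x => t * E x) by exact: AC_expR (ltW be).
have Ebm : bm b e E by apply: AC_bm AE; exact: ltW.
pose v x := E x * u x; pose v1 x := E x * (u1 x + t * u x).
have Av : AC b e v v1.
  apply: eq_AC (ACM (ltW be) AE Aub) => // x _; rewrite /v1; ring.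
have v1b : bm b e v1 by apply: bmM => //; apply: bmD => //; exact: bmZ.
have vb : bm b e v by exact: bmM.
have sqb : bm b e (fun t => v t ^+ 2) by exact: bmM.
have sq1b : bm b e (fun t => v1 t ^+ 2) by exact: bmM.
have AF := ACM (ltW be) Av (ACM (ltW be) AE Au1b).
have HF := AC_diff AF (lexx b) (ltW be) (lexx e).
have c2 : c ^+ 2 != 0 by rewrite expf_neq0// gt_eqF.
rewrite (@eq_int _ b e _ (fun x => v1 x ^+ 2 + (q x + (2 * k%:R - 1)) * v x ^+ 2)) in HF; last first.
  move=> x xbe; rewrite rc// /v /v1 /t /z exprMn exprVn; by field; rewrite gt_eqF.
have Eb1 : E b = 1 by rewrite /E subrr expR0.
have Ee0 : 0 <= E e by exact: expR_ge0.
have Fe : v e * (E e * u1 e) <= 0.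
  by rewrite /v (_ : _ * _ = E e ^+ 2 * (u e * u1 e)); [rewrite mulr_ge0_le0 ?sqr_ge0|ring].
have Fb : v b * (E b * u1 b) = u b * u1 b by rewrite /v Eb1 !mul1r.
rewrite Fb in HF.
set I1 := int b e (fun x => v1 x ^+ 2); set I2 := int b e (fun x => v x ^+ 2).
have I10 : 0 <= I1 by apply: int_ge0 => *; exact: sqr_ge0.
have I20 : 0 <= I2 by apply: int_ge0 => *; exact: sqr_ge0.
have low : I1 / 2 + I2 <= - (u b * u1 b).
  have h1 : int b e (fun x => v1 x ^+ 2 - `|q x| * v x ^+ 2 + (2 * k%:R - 1) * v x ^+ 2) <=
      int b e (fun x => v1 x ^+ 2 + (q x + (2 * k%:R - 1)) * v x ^+ 2).
    apply: le_int; [by ig_tac|by ig_tac|].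
    move=> x _; have s0 := sqr_ge0 (v x).
    have q1 : - `|q x| <= q x by have := ler_norm (- q x); rewrite normrN; lra.
    by have := ler_wpM2r s0 q1; rewrite mulrDl; lra.
  rewrite intD in h1; [|by ig_tac..]; rewrite intB in h1; [|by ig_tac..].
  rewrite intZ in h1; last exact: bm_ig.
  have h2 := HCq v v1 Av v1b; rewrite -/I1 -/I2 in h1 h2.
  have h3 : I2 <= (2 * k%:R - 1 - Cq) * I2 by rewrite ler_peMl//; lra.
  lra.
have up : 0 < u b ^+ 2 by rewrite lt_neqAle eq_sym expf_neq0// sqr_ge0.
have uu : - (u b * u1 b) <= Cb * D * k%:R ^+ 2 * u b ^+ 2.
  apply: le_trans (ler_norm _) _; rewrite normrN normrM.
  apply: (@le_trans _ _ (`|u b| * (Cb * (D * k%:R ^+ 2) * `|u b|))).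
    by rewrite ler_wpM2l//; apply: le_trans ubd _; rewrite ler_wpM2r// ler_wpM2l.
  rewrite -[u b ^+ 2]real_normK ?num_real// le_eqVlt; apply/orP; left; apply/eqP; ring.
have vs x : b <= x <= e -> v x ^+ 2 <= 2 * ((e - b)^-1 + 2) * (Cb * D * k%:R ^+ 2 * u b ^+ 2).
  move=> xbe; apply: le_trans (sup_sq_le be ltr01 Av v1b xbe) _.
  rewrite -/I1 -/I2 invr1 mul1r.
  have i0 : 0 <= (e - b)^-1 by rewrite invr_ge0 ltW.
  have := le_trans low uu; set X := _ * u b ^+ 2 => hX.
  have := ler_wpM2l i0 hX.
  have := mulr_ge0 i0 I10; have := mulr_ge0 i0 I20; lra.
have mk x : b <= x <= e -> `|expR (k%:R * (x - b)) * u x / u b| <= (1 + B) * k%:R.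
  move=> xbe; have /andP[bx xe] := xbe.
  have p : 0 <= (1 + B) * k%:R by rewrite mulr_ge0// addr_ge0.
  rewrite -(@ler_pXn2r _ 2)// ?nnegrE// real_normK ?num_real//.
  have -> : (expR (k%:R * (x - b)) * u x / u b) ^+ 2 = v x ^+ 2 * expR (2 * (x - b)) / u b ^+ 2.
    have -> : expR (2 * (x - b)) = expR (x - b) ^+ 2 by rewrite expr2 -expRD; congr expR; ring.
    have -> : expR (k%:R * (x - b)) = E x * expR (x - b).
      by rewrite /E -expRD /t; congr expR; ring.
    by rewrite /v; field.
  rewrite ler_pdivrMr//.
  apply: (@le_trans _ _ (2 * ((e - b)^-1 + 2) * (Cb * D * k%:R ^+ 2 * u b ^+ 2) * expR (2 * (e - b)))).
    apply: ler_pM; rewrite ?sqr_ge0 ?expR_ge0//; first exact: vs.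
    by rewrite ler_expR ler_wpM2l// lerD2r.
  have -> : 2 * ((e - b)^-1 + 2) * (Cb * D * k%:R ^+ 2 * u b ^+ 2) * expR (2 * (e - b)) =
      B * (k%:R ^+ 2 * u b ^+ 2) by rewrite /B; ring.
  rewrite [leRHS](_ : _ = (1 + B) ^+ 2 * (k%:R ^+ 2 * u b ^+ 2)); last by ring.
  apply: ler_wpM2r; first by rewrite mulr_ge0 ?sqr_ge0.
  by have := sqr_ge0 B; have := B0; lra.
have k13 : k%:R <= k%:R ^+ 3 :> R.
  by rewrite exprS ler_peMr ?(ltW kR)// exprn_ege1.
have CD1 : 1 <= 1 + Ce * D by rewrite lerDl mulr_ge0// addr_ge0.
have B1 : 0 <= 1 + B by rewrite addr_ge0.
split => //.
  move=> x xbe; apply: le_trans (mk x xbe) _; apply: ler_pM => //.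
  by rewrite ler_peMr.
have ee : b <= e <= e by rewrite lexx ltW.
rewrite -mulrA mulrCA normrM.
apply: (@le_trans _ _ (Ce * (1 - z) * `|u e| * `|expR (k%:R * (e - b)) / u b|)).
  by rewrite ler_wpM2r.
rewrite -mulrA -normrM (_ : u e * _ = expR (k%:R * (e - b)) * u e / u b); last by ring.
apply: (@le_trans _ _ (Ce * (D * k%:R ^+ 2) * ((1 + B) * k%:R))).
  apply: ler_pM; rewrite ?mulr_ge0 ?mk//; last by rewrite ler_wpM2l.
  by have := zE; have : 0 <= k%:R ^+ 2 * (c ^+ 2)^-1 by [rewrite mulr_ge0 ?sqr_ge0]; lra.
rewrite [leLHS](_ : _ = (1 + B) * (Ce * D) * k%:R ^+ 3); last by ring.
by rewrite ler_wpM2r ?exprn_ge0// ler_wpM2l// lerDr.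
Qed.

End weyl_decay.

(** * The potential is determined *)

Section normalized_solution.
Context {R : realType}.
Implicit Types (b e c k z : R).

Lemma normalized_solution_AC T b e c k (q rho u u1 : R -> R) :
  0 <= b -> b < e -> e <= T -> 0 < c -> (forall x, b < x <= e -> rho x = c ^+ 2) ->
  sol T q rho (- (k / c) ^+ 2) (fun=> 0) u u1 ->
  AC b e (fun x => expR (k * (x - b)) * u x / u b)
    (fun x => expR (k * (x - b)) * (u1 x + k * u x) / u b) /\
  AC b e (fun x => expR (k * (x - b)) * (u1 x + k * u x) / u b)
    (fun x => 2 * k * (expR (k * (x - b)) * (u1 x + k * u x) / u b) +
       q x * (expR (k * (x - b)) * u x / u b)).
Proof.
move=> b0 be eT c0 rc [_ Au Au1].
have Aub : AC b e u u1 by exact: AC_sub Au.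
have Au1b := AC_sub b0 eT Au1.
have EE x : expR (k * x + - (k * b)) = expR (k * (x - b)) by rewrite mulrBr.
have AE := AC_expR k (- (k * b)) (ltW be).
split.
  apply: eq_AC (ACZ (u b)^-1 (ACM (ltW be) AE Aub)) => x _; rewrite EE; ring.
apply: eq_AC (ACZ (u b)^-1 (ACM (ltW be) AE (ACD Au1b (ACZ k Aub)))) => x xbe; rewrite EE; first by ring.
rewrite rc// (_ : - (k / c) ^+ 2 * c ^+ 2 = - k ^+ 2); last by field; rewrite gt_eqF.
by ring.
Qed.

End normalized_solution.

Section uniqueness.
Context {R : realType}.
Variables (T : R) (q qt rho : R -> R) (rmin : R).
Hypotheses (T0 : 0 < T) (qi : ig 0 T q) (q2i : ig 0 T (fun x => q x ^+ 2)).
Hypotheses (qti : ig 0 T qt) (qt2i : ig 0 T (fun x => qt x ^+ 2)).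
Hypotheses (rhob : bm 0 T rho) (rmin0 : 0 < rmin).
Hypothesis rho_ge : forall x, 0 < x <= T -> rmin <= rho x.
Hypothesis rho_right : forall b, 0 <= b -> b < T -> exists e c : R,
  [/\ b < e <= T, 0 < c & forall x, b < x <= e -> rho x = c ^+ 2].
Variable Z : R.
Hypothesis weyl : forall z, z <= - Z -> exists g g1 gt gt1,
  [/\ sol T q rho z (fun=> 0) g g1, sol T qt rho z (fun=> 0) gt gt1,
      [/\ g T = 0, g1 0 = -1, gt T = 0 & gt1 0 = -1] & g 0 = gt 0].
Let p x := qt x - q x.
Let p_i : ig 0 T p. Proof. exact: igB. Qed.

Lemma uniqueness_step b : 0 <= b -> b < T -> int 0 b (fun x => `|p x|) = 0 ->
  exists2 b', b < b' <= T & int 0 b' (fun x => `|p x|) = 0.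
Proof.
move=> b0 bT pb.
have [e0 [c [/andP[be0 e0T] c0 rc]]] := rho_right b0 bT.
pose I := int 0 T (fun t => `|q t|) + int 0 T (fun t => `|qt t|).
have I1 : 0 <= int 0 T (fun t => `|q t|) by apply: int_ge0.
have I2 : 0 <= int 0 T (fun t => `|qt t|) by apply: int_ge0.
have I0 : 0 <= I by rewrite addr_ge0.
(* Three constraints: rho is constant on ]b, e]; e < T, as the logarithmic derivative at e requires;
   and e - b is small against the L^1 norms of q and qt. *)
pose e := Num.min e0 (Num.min ((b + T) / 2) (b + (2 * (I + 1))^-1)).
have I1p : 0 < 2 * (I + 1) by rewrite mulr_gt0//; lra.
have be : b < e.
  rewrite !lt_min be0 ltrDl invr_gt0 I1p andbT/=; lra.
have ee0 : e <= e0 by rewrite ge_min lexx.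
have eT : e < T.
  by apply: (@le_lt_trans _ _ ((b + T) / 2)); [rewrite !ge_min lexx orbT|lra].
have el : e - b <= (2 * (I + 1))^-1 by rewrite lerBlDl !ge_min lexx !orbT.
have sub (f : R -> R) : ig 0 T f -> int b e (fun t => `|f t|) <= int 0 T (fun t => `|f t|).
  move=> /ig_norm nf; rewrite (@int_chasles _ 0 b T) ?b0 ?(ltW bT)//.
  rewrite (@int_chasles _ b e T) ?(ltW be) ?(ltW eT)//; last exact: igS nf.
  have ? : 0 <= int 0 b (fun t => `|f t|) by apply: int_ge0.
  have ? : 0 <= int e T (fun t => `|f t|) by apply: int_ge0.
  lra.
have l0 : 0 < e - b by rewrite subr_gt0.
have lI (x : R) : 0 <= x -> x <= I -> (e - b) * x <= 2^-1.
  move=> x0 xI; apply: (@le_trans _ _ ((2 * (I + 1))^-1 * (I + 1))).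
    by apply: ler_pM => //; [exact: ltW|lra].
  by rewrite invfM -mulrA mulVf ?mulr1// gt_eqF//; lra.
have lq : (e - b) * int b e (fun t => `|q t|) <= 2^-1.
  apply: lI; first exact: int_ge0.
  by apply: le_trans (sub q qi) _; rewrite lerDl.
have lqt : (e - b) * int b e (fun t => `|qt t|) <= 2^-1.
  apply: lI; first exact: int_ge0.
  by apply: le_trans (sub qt qti) _; rewrite lerDr.
have rce x : b < x <= e -> rho x = c ^+ 2.
  by move=> /andP[bx xe]; apply: rc; rewrite bx (le_trans xe ee0).
have [C C1 [N0 HC]] := weyl_decay T0 qi q2i rhob rmin0 rho_ge b0 be eT c0 rce.
have [Ct Ct1 [Nt0 HCt]] := weyl_decay T0 qti qt2i rhob rmin0 rho_ge b0 be eT c0 rce.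
pose A := C * Ct.
have C0 := le_trans ler01 C1; have Ct0 := le_trans ler01 Ct1.
have CA : C <= A by rewrite ler_peMr.
have CtA : Ct <= A by rewrite ler_peMl.
have A1 : 1 <= A := le_trans C1 CA.
have A0 := le_trans ler01 A1.
have A2 : A <= A ^+ 2 by rewrite expr2 ler_peMr.
have qie : ig b e q by apply: igS qi => //; exact: ltW.
have qtie : ig b e qt by apply: igS qti => //; exact: ltW.
have pie : ig b e p by apply: igS p_i => //; exact: ltW.
pose N1 := (N0 + Nt0 + (Num.truncn (c ^+ 2 * `|Z|)).+1)%N.
have [t /andP[tp tl] pt] : exists2 t : R, 0 < t <= e - b & int b (b + t) (fun x => `|p x|) = 0.
  (* The exponent 6 and the factor 2 A ^ 2 come from the Wronskian at e: two products of quantities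
     bounded by A k ^ 3. *)
  apply: (@local_vanish _ b e q qt p (2 * A ^+ 2) 6 N1) => //; first lra.
  move=> k kN kp.
  have kR1 : 1 <= k%:R :> R by rewrite ler1n.
  have kN0 : (N0 <= k)%N by apply: leq_trans kN; rewrite /N1 -addnA leq_addr.
  have kNt0 : (Nt0 <= k)%N by apply: leq_trans kN; rewrite /N1 addnAC leq_addl.
  have kZ : - (k%:R / c) ^+ 2 <= - Z.
    rewrite lerN2 exprMn exprVn ler_pdivlMr ?exprn_gt0// mulrC.
    apply: (@le_trans _ _ (c ^+ 2 * `|Z|)); first by rewrite ler_wpM2l ?sqr_ge0// ler_norm.
    apply: (@le_trans _ _ k%:R); last by rewrite expr2 ler_peMl.
    apply: le_trans (ltW (truncnS_gt _)) _; rewrite ler_nat; apply: leq_trans kN.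
    by rewrite /N1 leq_addl.
  have [u [u1 [v [v1 [us vs [uT u10 vT v10] uv0]]]]] := weyl kZ.
  have [ub0 um u1m] := HC k u u1 kN0 kp us uT u10.
  have [vb0 vm v1m] := HCt k v v1 kNt0 kp vs vT v10.
  pose m x := expR (k%:R * (x - b)) * u x / u b.
  pose n x := expR (k%:R * (x - b)) * (u1 x + k%:R * u x) / u b.
  pose mt x := expR (k%:R * (x - b)) * v x / v b.
  pose nt x := expR (k%:R * (x - b)) * (v1 x + k%:R * v x) / v b.
  have [Am An] := normalized_solution_AC b0 be (ltW eT) c0 rce us.
  have [Amt Ant] := normalized_solution_AC b0 be (ltW eT) c0 rce vs.
  have k3 : 0 <= k%:R ^+ 3 :> R by rewrite exprn_ge0.
  have k36 : k%:R ^+ 3 <= k%:R ^+ 6 :> R by rewrite ler_weXn2l.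
  have k46 : k%:R ^+ 4 <= k%:R ^+ 6 :> R by rewrite ler_weXn2l.
  have b36 : A * k%:R ^+ 3 <= 2 * A ^+ 2 * k%:R ^+ 6 by apply: ler_pM => //; lra.
  have b46 : 2 * A * k%:R ^+ 4 <= 2 * A ^+ 2 * k%:R ^+ 6.
    by apply: ler_pM => //; lra.
  have ebe : b <= e <= e by rewrite lexx ltW.
  have mA x : b <= x <= e -> `|m x| <= A * k%:R ^+ 3.
    by move=> xbe; apply: le_trans (um x xbe) _; rewrite ler_wpM2r.
  have mtA x : b <= x <= e -> `|mt x| <= A * k%:R ^+ 3.
    by move=> xbe; apply: le_trans (vm x xbe) _; rewrite ler_wpM2r.
  pose ul := expR (k%:R * (e - b)) * u1 e / u b.
  pose vl := expR (k%:R * (e - b)) * v1 e / v b.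
  have ulA : `|ul| <= A * k%:R ^+ 3 by apply: le_trans u1m _; rewrite ler_wpM2r.
  have vlA : `|vl| <= A * k%:R ^+ 3 by apply: le_trans v1m _; rewrite ler_wpM2r.
  have nbound (x y : R) : `|x| <= A * k%:R ^+ 3 -> `|y| <= A * k%:R ^+ 3 ->
      `|x + k%:R * y| <= 2 * A ^+ 2 * k%:R ^+ 6.
    move=> hx hy; apply: le_trans b46; apply: le_trans (ler_normD _ _) _.
    rewrite normrM ger0_norm//.
    have h1 : k%:R * `|y| <= A * k%:R ^+ 4.
      by rewrite exprS mulrCA ler_wpM2l.
    have h2 : A * k%:R ^+ 3 <= A * k%:R ^+ 4 by rewrite ler_wpM2l// ler_weXn2l.
    lra.
  exists m, n, mt, nt; split => //.
  - by split; rewrite /m /mt subrr mulr0 expR0 mul1r divff.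
  - by move=> x xbe; split; apply: le_trans b36; [exact: mA|exact: mtA].
  - split.
    + have -> : n e = ul + k%:R * m e by rewrite /n /ul /m; ring.
      by apply: nbound => //; exact: mA.
    + have -> : nt e = vl + k%:R * mt e by rewrite /nt /vl /mt; ring.
      by apply: nbound => //; exact: mtA.
  have [ub u1b] := sol_bm T0 us; have [vb v1b] := sol_bm T0 vs.
  have [_ Au Au1] := us; have [_ Av Av1] := vs.
  (* W' = p u v. W vanishes at 0 because the two Weyl functions agree there and both derivatives are
     - 1, and it is still 0 at b because p is null on [0, b]. *)
  pose W x := u x * v1 x - u1 x * v x.
  have AW : AC 0 T W (fun x => p x * (u x * v x)).
    apply: eq_AC (ACB (ACM (ltW T0) Au Av1) (ACM (ltW T0) Au1 Av)) => // x _.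
    by rewrite /p; ring.
  have W0 : W 0 = 0 by rewrite /W u10 v10 uv0; ring.
  have Wb : W b = 0.
    have h := AC_diff AW (lexx 0) b0 (ltW bT); rewrite W0 subr0 in h.
    apply/eqP; rewrite h -normr_le0.
    have uvb : bm 0 T (fun x => u x * v x) by exact: bmM.
    have [M HM] := uvb.2.
    have pib : ig 0 b p by apply: igS p_i => //; exact: ltW.
    have := @norm_int_le_int _ 0 b (fun x => p x * (u x * v x)) (fun x => M * `|p x|).
    rewrite intZ; last exact: ig_norm.
    rewrite pb mulr0; apply.
    - by apply: igS (AC_ig AW) => //; exact: ltW.
    - by apply: igZ; exact: ig_norm.
    - move=> x /andP[x0 xb]; rewrite normrM mulrC ler_wpM2r// HM// x0 (le_trans xb)// ltW//.
  have We := AC_diff AW b0 (ltW be) (ltW eT); rewrite Wb subr0 in We.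
  have -> : int b e (fun x => p x * (expR (- (2 * k%:R) * (x - b)) * (m x * mt x))) =
      (u b * v b)^-1 * W e.
    rewrite We -intZ; last by apply: igS (AC_ig AW) => //; exact: ltW.
    apply: eq_int => x _; rewrite /m /mt.
    have -> : expR (- (2 * k%:R) * (x - b)) = (expR (k%:R * (x - b)) ^+ 2)^-1.
      by rewrite expr2 -expRD -expRN; congr expR; ring.
    by field; rewrite ub0 vb0 gt_eqF// expR_gt0.
  (* In terms of the normalised solutions the Wronskian at e carries the factor exp (- 2 k (e - b));
     everything else grows polynomially in k. *)
  have -> : (u b * v b)^-1 * W e = (m e * vl - ul * mt e) * expR (- (2 * k%:R) * (e - b)).
    rewrite /m /mt /vl /ul /W.
    have -> : expR (- (2 * k%:R) * (e - b)) = (expR (k%:R * (e - b)) ^+ 2)^-1.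
      by rewrite expr2 -expRD -expRN; congr expR; ring.
    by field; rewrite ub0 vb0 gt_eqF// expR_gt0.
  rewrite normrM (ger0_norm (expR_ge0 _)) ler_wpM2r ?expR_ge0//.
  apply: le_trans (ler_normB _ _) _; rewrite (normrM (m e)) (normrM ul).
  have h1 : `|m e| * `|vl| <= A * k%:R ^+ 3 * (A * k%:R ^+ 3) by apply: ler_pM => //; exact: mA.
  have h2 : `|ul| * `|mt e| <= A * k%:R ^+ 3 * (A * k%:R ^+ 3) by apply: ler_pM => //; exact: mtA.
  apply: le_trans (lerD h1 h2) _.
  by rewrite le_eqVlt; apply/orP; left; apply/eqP; ring.
have bt : b + t <= T by lra.
exists (b + t); first by rewrite ltrDl tp.
have np := ig_norm p_i.
by rewrite (@int_chasles _ 0 b (b + t)) ?b0 ?lerDl ?(ltW tp)//; [rewrite pb pt addr0|exact: igS np].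
Qed.

(** Continuation: the set of x for which |p| has integral 0 over [0, x] contains its supremum by
    continuity of the primitive, and [uniqueness_step] forbids a supremum below T. *)
Lemma potential_unique : int 0 T (fun x => `|p x|) = 0.
Proof.
have np := ig_norm p_i.
pose Y x := int 0 x (fun x => `|p x|).
have Ymono x y : 0 <= x -> x <= y -> y <= T -> Y x <= Y y.
  move=> x0 xy yT; rewrite /Y (@int_chasles _ 0 x y) ?x0//; last exact: igS np.
  by rewrite lerDl; apply: int_ge0.
have Y0 x : 0 <= Y x by apply: int_ge0.
pose S := [set x | 0 <= x <= T /\ Y x = 0].
have S0 : S 0 by split; [rewrite lexx ltW|rewrite /Y int_nil].
have Sub : has_ubound S by exists T => x [/andP[]].
have Ssup : has_sup S by split => //; exists 0.
pose s := sup S.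
have s0 : 0 <= s by exact: ub_le_sup.
have sT : s <= T by apply: ge_sup; [exists 0|move=> x [/andP[]]].
have below x : 0 <= x -> x < s -> Y x = 0.
  move=> x0 xs; have sx : 0 < s - x by rewrite subr_gt0.
  have [y [/andP[y0 yT] Yy]] := sup_adherent sx Ssup; rewrite opprB addrC subrK => xy.
  by apply/eqP; rewrite eq_le Y0 andbT -Yy; apply: Ymono => //; exact: ltW.
have Ys : Y s = 0.
  have [s00|sn0] := eqVneq s 0; first by rewrite s00 /Y int_nil.
  have sp : 0 < s by rewrite lt_neqAle eq_sym sn0.
  have cY : {within `[0, T], continuous Y} by apply: int_continuous => //; exact: ltW.
  have cY' : {within `[0, s], continuous Y}.
    by apply: continuous_subspaceW cY; apply: subset_itvl; rewrite bnd_simp.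
  have /(continuous_within_itvP _ sp)[_ _ Yl] := cY'.
  have Y0l : Y x @[x --> s^'-] --> 0.
    apply: cvg_near_cst; near=> x.
    by apply: below; near: x; [exact: nbhs_left_ge|exact: nbhs_left_lt].
  exact: cvg_unique Yl Y0l.
have [<-//|sneT] := eqVneq s T.
have sltT : s < T by rewrite lt_neqAle sneT.
have [b' /andP[sb bT] Yb] := uniqueness_step s0 sltT Ys.
have : b' <= s by apply: ub_le_sup => //; split => //; rewrite (le_trans s0 (ltW sb)).
by rewrite leNgt sb.
Unshelve. all: by end_near.
Qed.

End uniqueness.

(** * From the boundary value problem on [0, pi] to the abstract setting *)

Section piecewise_density.
Context {R : realType}.

Lemma L2_on_ig (q : R -> R) : L2_on q -> ig 0 pi q /\ ig 0 pi (fun x => q x ^+ 2).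
Proof.
move=> [mq q2]; have q2i : ig 0 pi (fun x => q x ^+ 2) by exact/ig_cc.
split=> //.
have h : ig 0 pi (fun x => q x ^+ 2 + 1) by apply: igD => //; exact: bm_ig (bm_cst _ _ _).
apply: ig_le h _; first by apply: measurable_funS mq => //; exact: subset_itv_oc_cc.
move=> x _; rewrite -[q x ^+ 2]real_normK ?num_real//.
have := sqr_ge0 (`|q x| - 1); have := normr_ge0 (q x); lra.
Qed.

Lemma rho_bm (a al x y : R) : bm x y (rho a al).
Proof.
split.
  apply: measurable_funTS; apply: measurable_fun_ifT; [|exact: measurable_cst..].
  by apply: measurable_fun_ler; [exact: measurable_id|exact: measurable_cst].
exists (1 + al ^+ 2) => t _; have s0 := sqr_ge0 al; rewrite /rho; case: ifP => _.
  by rewrite normr1; lra.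
by rewrite ger0_norm//; lra.
Qed.

Lemma ivp_solution_sol (a al mu : R) (q y : R -> R) : ivp_solution a al q mu y ->
  exists y1, [/\ sol pi q (rho a al) mu (fun=> 0) y y1, y 0 = 1 & y1 0 = 0].
Proof.
move=> [y1 [[y0 y10] /ig_cc y1i /ig_cc Qi ye y1e]]; exists y1; split=> //.
split; first exact: bm_cst.
- split=> // x /[dup] xpi /andP[x0 xp]; rewrite ye//; congr (_ + _).
  by apply: int_cc; exact: igS y1i.
- have h : AC 0 pi y1 (fun t => (q t - mu * rho a al t) * y t).
    split=> // x /[dup] xpi /andP[x0 xp]; rewrite y1e//; congr (_ + _).
    by apply: int_cc; exact: igS Qi.
  by apply: eq_AC h => // x _; rewrite mulr0 subr0.
Qed.

Lemma norming_wip (a al : R) (y : R -> R) : bm 0 pi y ->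
  norming a al y = wip pi (rho a al) y y.
Proof.
move=> yb; have rb := rho_bm a al 0 pi.
have i : ig 0 pi (fun x => rho a al x * y x ^+ 2).
  by apply: bm_ig; apply: bmM => //; exact: bmM.
by rewrite /norming int_cc//; apply: eq_int => x _; rewrite expr2 mulrA.
Qed.

Lemma rho_right (a al b : R) : 0 < al -> a < pi -> 0 <= b -> b < pi ->
  exists e c : R, [/\ b < e <= pi, 0 < c & forall x, b < x <= e -> rho a al x = c ^+ 2].
Proof.
move=> al0 api b0 bpi; have [ba|ab] := ltP b a.
  exists a, 1; split=> //; first by rewrite ba ltW.
  by move=> x /andP[_ xa]; rewrite /rho xa expr1n.
exists pi, al; split=> //; first by rewrite bpi lexx.
by move=> x /andP[bx _]; rewrite /rho leNgt (le_lt_trans ab bx).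
Qed.

Lemma int_norm_eq0_ae (q qt : R -> R) : ig 0 pi q -> ig 0 pi qt ->
  int 0 pi (fun x => `|qt x - q x|) = 0 ->
  {ae (@lebesgue_measure R), forall x, x \in `[0, pi] -> q x = qt x}.
Proof.
move=> qi qti p0; have p_i := igB qti qi; have np := ig_norm p_i.
have mp : measurable_fun `]0, pi] (fun x => (qt x - q x)%:E).
  by apply/measurable_EFinP; exact: ig_meas p_i.
have H := (ae_eq_integral_abs lebesgue_measure (measurable_itv _) mp).1.
have I0 : (\int[lebesgue_measure]_(x in `]0%R, pi]) `|(qt x - q x)%:E|)%E = 0%E.
  transitivity (int 0 pi (fun x => `|qt x - q x|))%:E; last by rewrite p0.
  by rewrite /int /Rintegral fineK//; exact: (integrable_fin_num _ np).
have {}H : {ae (@lebesgue_measure R), forall x, `]0, pi]%classic x -> (qt x - q x)%:E = 0%E}.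
  exact: H I0.
have He : {ae (@lebesgue_measure R), forall x, x <> 0}.
  by exists [set 0]; split => //; [exact: lebesgue_measure_set1|move=> x /= /contrapT].
move: H He; apply: filterS2; first exact: (ae_filter_ringOfSetsType (@lebesgue_measure R)).
move=> x H x0; rewrite in_itv/= => /andP[x0' xpi].
have : (qt x - q x)%:E = 0%E.
  by apply: H; rewrite /= in_itv/= xpi andbT lt_neqAle x0' andbT; apply/eqP => h; apply: x0.
by move=> [] /eqP; rewrite subr_eq0 => /eqP.
Qed.

End piecewise_density.

Theorem theorem3 (R : realType) (a al : R) (q qt : R -> R)
  (phi phit : R -> R -> R) :
  0 < a -> a < pi -> 0 < al -> pi * al < a * (1 + al) ->
  L2_on q -> L2_on qt ->
  (forall mu : R, ivp_solution a al q mu (phi mu)) ->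
  (forall mu : R, ivp_solution a al qt mu (phit mu)) ->
  (forall mu : R, phi mu pi = 0 <-> phit mu pi = 0) ->
  (forall mu : R, phi mu pi = 0 ->
     norming a al (phi mu) = norming a al (phit mu)) ->
  {ae (@lebesgue_measure R), forall x, x \in `[0, pi] -> q x = qt x}.
Proof.
move=> a0 api al0 _ /L2_on_ig[qi q2i] /L2_on_ig[qti qt2i] ivp ivpt spec norm.
have [phi1 H1] := choice (fun mu => ivp_solution_sol (ivp mu)).
have [phit1 H2] := choice (fun mu => ivp_solution_sol (ivpt mu)).
have T0 : 0 < pi :> R := pi_gt0 R.
have rb := rho_bm a al 0 pi.
pose rmin := Num.min 1 (al ^+ 2).
have rmin0 : 0 < rmin by rewrite lt_min ltr01 exprn_gt0.
have rho_ge x : 0 < x <= pi -> rmin <= rho a al x.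
  by move=> _; rewrite /rho; case: ifP => _; rewrite ge_min lexx ?orbT.
have phis mu := let: And3 s _ _ := H1 mu in s.
have phi0 mu := let: And3 _ s _ := H1 mu in s.
have phi10 mu := let: And3 _ _ s := H1 mu in s.
have phits mu := let: And3 s _ _ := H2 mu in s.
have phit0 mu := let: And3 _ s _ := H2 mu in s.
have phit10 mu := let: And3 _ _ s := H2 mu in s.
have normE mu : phi mu pi = 0 ->
    wip pi (rho a al) (phi mu) (phi mu) = wip pi (rho a al) (phit mu) (phit mu).
  move=> /norm; rewrite !norming_wip//.
  - by have [] := sol_bm T0 (phits mu).
  - by have [] := sol_bm T0 (phis mu).
have [Z weyl] := weyl_unique T0 qi q2i qti qt2i rb rmin0 rho_ge
  phis phi0 phi10 phits phit0 phit10 spec normE.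
apply: int_norm_eq0_ae => //.
apply: (potential_unique T0 qi q2i qti qt2i rb rmin0 rho_ge _ weyl).
by move=> b b0 bpi; exact: rho_right.
Qed.
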